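(* For the decreasing diffeomorphism $\mathfrak{C}:[0,1]\to\left[\frac{3\sqrt3}{\pi},\frac{16}{3\pi}\right]$ defined by $$\mathfrak{C}(r)=\frac{r\sqrt{4-r^2}\,(2+r^2)+4(1-r^2)\tan^{-1}\left[\frac{r\sqrt{4-r^2}}{-2+r^2}\right]}{\pi r^3}$$ (with the value at $r=0$ understood as the limit $r\to0^+$), we have, for every $x\in\mathbf{B}^4$ with $r=|x|$, the sharp inequality $$|\nabla u(x)|\le\frac{\mathfrak{C}(r)}{1-r^2}\,|u|_\infty,\qquad u\in h^\infty(\mathbf{B}^4).$$
   Context: $\mathbf{B}^4$ is the open unit ball of $\mathbf{R}^4$; $h^\infty(\mathbf{B}^4)$ is the Hardy space of bounded (real-valued) harmonic functions on $\mathbf{B}^4$; $|u|_\infty=\sup_{y\in\mathbf{B}^4}|u(y)|$; $|\nabla u(x)|$ is the Euclidean norm of the gradient of $u$ at $x$; $\tan^{-1}$ is the principal branch of the arctangent, with values in $(-\pi/2,\pi/2)$. ''Sharp'' means that for each fixed $x$ the factor $\mathfrak{C}(|x|)/(1-|x|^2)$ is the smallest constant for which the inequality holds for all $u\in h^\infty(\mathbf{B}^4)$.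
   Formalization: Since C'(0)=0, the inverse of C is not differentiable at 16/(3π); instead of ''diffeomorphism'' on [0,1] it is proved that C is a decreasing homeomorphism of the closed intervals, smooth on [0,1], and a diffeomorphism from (0,1] onto [3√3/π, 16/(3π)). *)

(* Defs.v *)
From mathcomp Require Export all_boot all_order all_algebra.
From mathcomp Require Export all_classical all_reals all_analysis.

Set Implicit Arguments.
Unset Strict Implicit.
Unset Printing Implicit Defensive.

Export Order.TTheory GRing.Theory Num.Theory.
Export numFieldNormedType.Exports.

Local Open Scope classical_set_scope.
Local Open Scope ring_scope.

(* The norm that the library puts on ['rV[R]_n] is the sup norm; it has the
   same topology, hence the same derivatives, as the Euclidean norm, but the
   ball and the length of the gradient must be taken in the latter. *)
Definition euclidean_norm (R : realType) (n : nat) (x : 'rV[R]_n) : R :=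
  Num.sqrt (\sum_(i < n) x 0 i ^+ 2).

Definition unit_ball (R : realType) (n : nat) : set 'rV[R]_n :=
  [set x | euclidean_norm x < 1].

Definition partial (R : realType) (n : nat) (i : 'I_n.+1)
    (u : 'rV[R]_n.+1 -> R) (x : 'rV[R]_n.+1) : R :=
  'D_(delta_mx 0 i) u x.

Definition gradient (R : realType) (n : nat) (u : 'rV[R]_n.+1 -> R)
    (x : 'rV[R]_n.+1) : 'rV[R]_n.+1 :=
  \row_i partial i u x.

Definition laplacian (R : realType) (n : nat) (u : 'rV[R]_n.+1 -> R)
    (x : 'rV[R]_n.+1) : R :=
  \sum_(i < n.+1) partial i (partial i u) x.

(* Functions on a domain are represented by total functions. The set [D] is
   meant to be open, so that [{for x, continuous _}] and the partial
   derivatives at a point of [D] depend only on the restriction to [D]. *)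
Definition C1_on (R : realType) (n : nat) (D : set 'rV[R]_n.+1)
    (u : 'rV[R]_n.+1 -> R) : Prop :=
  forall x, D x -> {for x, continuous u} /\
    forall i, derivable u x (delta_mx 0 i) /\
      {for x, continuous (partial i u)}.

Definition C2_on (R : realType) (n : nat) (D : set 'rV[R]_n.+1)
    (u : 'rV[R]_n.+1 -> R) : Prop :=
  C1_on D u /\ forall i, C1_on D (partial i u).

Definition harmonic_on (R : realType) (n : nat) (D : set 'rV[R]_n.+1)
    (u : 'rV[R]_n.+1 -> R) : Prop :=
  C2_on D u /\ forall x, D x -> laplacian u x = 0.

Definition sup_norm_on (R : realType) (T : Type) (D : set T) (u : T -> R) : R :=
  sup [set `|u y| | y in D].

Definition hardy_infty (R : realType) (n : nat) : set ('rV[R]_n.+1 -> R) :=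
  [set u | harmonic_on (@unit_ball R n.+1) u /\
           exists M : R, forall y, unit_ball y -> `|u y| <= M].

Definition gradient_bound (R : realType) (n : nat) (x : 'rV[R]_n.+1) (c : R)
    : Prop :=
  forall u, hardy_infty u ->
    euclidean_norm (gradient u x) <= c * sup_norm_on (@unit_ball R n.+1) u.

Definition frakC_formula (R : realType) (r : R) : R :=
  (r * Num.sqrt (4 - r ^+ 2) * (2 + r ^+ 2)
   + 4 * (1 - r ^+ 2) * atan (r * Num.sqrt (4 - r ^+ 2) / (- 2 + r ^+ 2)))
  / (pi * r ^+ 3).

Definition frakC (R : realType) (r : R) : R :=
  if r == 0 then lim (frakC_formula s @[s --> 0^'+]) else frakC_formula r.

(* Smoothness on an arbitrary (not necessarily open) subset of the line:
   near each point of [A], [f] agrees on [A] with a function that is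
   infinitely differentiable on an open set. *)
Definition smooth_on (R : realType) (A : set R) (f : R -> R) : Prop :=
  forall x, A x -> exists (U : set R) (F : R -> R),
    [/\ open U, U x,
        forall (k : nat) y, U y -> derivable (derive1n k F) y 1
      & forall y, U y -> A y -> F y = f y].

(* In the next two definitions [g] is the inverse of the bijection [f] on [B];
   its values outside [B] are irrelevant. *)
Definition homeomorphism_on (R : realType) (A B : set R) (f : R -> R) : Prop :=
  [/\ set_bij A B f, {within A, continuous f} &
      exists g : R -> R,
        (forall x, A x -> g (f x) = x) /\ {within B, continuous g}].

(* [frakC] is the restriction of an even smooth function near [0], so its
   derivative vanishes there and its inverse is not differentiable at
   [frakC 0]: on [0, 1] it is a smooth homeomorphism with a smooth inverse away
   from [frakC 0], that is, a diffeomorphism from ]0, 1] onto its image. *)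
Definition diffeomorphism_on (R : realType) (A B : set R) (f : R -> R) : Prop :=
  [/\ set_bij A B f, smooth_on A f &
      exists g : R -> R, (forall x, A x -> g (f x) = x) /\ smooth_on B g].

(* Main.v *)
Require Import Defs.
From mathcomp Require Import ring lra.
From mathcomp Require Import measurable_realfun lebesgue_integral_under.

(* By rotation the unit sphere can be parametrized by angles [phi], [lambda],
   [beta] so that [x] lies on the polar axis and the direction [l] in the plane
   [beta = 0]. The Poisson formula, applied on balls of radius [t < 1] and letting
   [t] tend to 1, bounds [l . grad u(x)] by [|u|_oo] times the integral of
   [|l . grad P(x, .)|], where [P y u = (1 - |y|^2) / |y - u|^4]; the harmonic
   function with boundary values [sgn (l . grad P(x, .))] shows that this is the
   best constant for [l]. It remains to see that the radial [l] is the worst one.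
   Integrating over [lambda] and then applying a Moebius involution of the
   interval [-1 <= cos phi <= 1] that swaps the factors of the kernel turns the
   integral into
     [int (l1 |t - r/2| + ...) sqrt (1 - t^2) / (1 + r^2 - 2 r t) dt];
   the layer-cake formula writes both terms as integrals in [xi] of the moment
   of [(t - r/2)^2 / (1 + r^2 - 2 r t)] over the chord
   [xi |t - r/2| < sqrt (1 - t^2)], and the claim follows from Chebyshev's
   association inequality, because the normalized moment is monotone in [xi].
   For radial [l] the integral is elementary and gives the formula for [frakC].
   With [a = 2 arcsin (r/2)] the numerator of that formula has derivative
   [8 r (sin a + a)] in [r], so that dividing twice by powers of [r] shows that
   [frakC] is smooth, also at 0. *)

Set Implicit Arguments.
Unset Strict Implicit.
Unset Printing Implicit Defensive.

Local Open Scope classical_set_scope.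
Local Open Scope ring_scope.

(** For a direction [l] with radial part [l1] the reduced integral is [l1] times the radial one plus
    an excess, which has to be at most [1 - l1] times the radial one. This is false for the
    integrands: at [t = r/2] only the excess is nonzero. In layer-cake form both sides integrate the
    same function of [xi] against two weights, [1 - l1] and the positive part of [l2 xi - l1]. These
    have equal integrals against [(1 + xi^2)^(-3/2)], the factor by which the moment is normalized,
    and their difference changes sign only at [xi = 1 / l2]; a single crossing is what makes
    monotonicity of the moment sufficient. The rotation to the polar axis takes place in the
    parametrization, not in the measure: the Poisson representation is proved for every weighted
    parametrization of the sphere under which the Poisson kernel has mean 1 at each point of the
    ball, and this condition passes to rotated parametrizations because the kernel depends on inner
    products only. The mean 1 itself comes from the harmonicity of [|y - u|^-2] in dimension 4. *)

Notation der x f d := (is_derive (x : _) (1 : _) f d).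

(** * Differentiation and measurability *)

Section RealDerivatives.
Context {R : realType}.
Implicit Types (f g : R -> R) (x : R).

Lemma der_eq f x a b : der x f a -> a = b -> der x f b.
Proof. by move=> fa <-. Qed.
Lemma der_cst (a x : R) : der x (fun=> a) (0 : R).
Proof. exact: is_derive_cst. Qed.
Lemma der_id x : der x (fun y : R => y) (1 : R).
Proof. exact: is_derive_id. Qed.
Lemma der_add f g x a b : der x f a -> der x g b -> der x (fun y => f y + g y) (a + b).
Proof. exact: is_deriveD. Qed.
Lemma der_opp f x a : der x f a -> der x (fun y => - f y) (- a).
Proof. exact: is_deriveN. Qed.
Lemma der_mul f g x a b : der x f a -> der x g b ->
  der x (fun y => f y * g y) (a * g x + f x * b).
Proof.
move=> fa gb; apply: (der_eq (is_deriveM fa gb)).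
by rewrite /GRing.scale/= addrC; congr (_ + _); rewrite mulrC.
Qed.
Lemma der_inv f x a : f x != 0 -> der x f a -> der x (fun y => (f y)^-1) (- a / f x ^+ 2).
Proof.
move=> f0 fa; apply: (der_eq (is_deriveV f0 fa)).
by rewrite /GRing.scale/= mulNr mulrC mulNr.
Qed.
Lemma der_exp f n x a : der x f a -> der x (fun y => f y ^+ n) (n%:R * f x ^+ n.-1 * a).
Proof.
move=> fa; have := is_deriveX n fa; rewrite exprfctE => /der_eq; apply.
by rewrite /GRing.scale/= mulr_natl.
Qed.
Lemma der_comp f g x a b : der (f x) g b -> der x f a -> der x (fun y => g (f y)) (b * a).
Proof. by move=> gb fa; apply: (der_eq (is_derive1_comp gb fa)). Qed.
Lemma der_sin f x a : der x f a -> der x (fun y => sin (f y)) (cos (f x) * a).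
Proof. by apply: der_comp; exact: is_derive_sin. Qed.
Lemma der_cos f x a : der x f a -> der x (fun y => cos (f y)) (- sin (f x) * a).
Proof. by apply: der_comp; exact: is_derive_cos. Qed.
Lemma der_atan f x a : der x f a -> der x (fun y => atan (f y)) ((1 + f x ^+ 2)^-1 * a).
Proof. by apply: der_comp; exact: is_derive1_atan. Qed.
Lemma der_ln f x a : 0 < f x -> der x f a -> der x (fun y => ln (f y)) ((f x)^-1 * a).
Proof. by move=> f0; apply: der_comp; exact: is_derive1_ln. Qed.
Lemma der_sqrt f x a : 0 < f x -> der x f a ->
  der x (fun y => Num.sqrt (f y)) ((2 * Num.sqrt (f x))^-1 * a).
Proof. by move=> f0; apply: der_comp; exact: is_derive1_sqrt. Qed.
Lemma der_asin f x a : -1 < f x < 1 -> der x f a ->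
  der x (fun y => asin (f y)) ((Num.sqrt (1 - f x ^+ 2))^-1 * a).
Proof. by move=> f0; apply: der_comp; exact: is_derive1_asin. Qed.

Lemma der_ext f g x a : f =1 g -> der x g a -> der x f a.
Proof. by move=> /funext ->. Qed.

End RealDerivatives.

(** The rules go by the outermost operation; an atomic function is closed by a derivative found
    among the hypotheses. [derive] leaves the derivative as an existential variable, so that the
    side conditions and an equation with the announced value remain. *)
Ltac der_step :=
  lazymatch goal with
  | |- is_derive _ _ (fun y => y) _ => exact: der_id
  | |- is_derive _ _ (fun _ => ?c) _ => exact: der_cst
  | |- is_derive _ _ (fun y => @?f y + @?g y) _ => simple notypeclasses refine (der_add (f := f) (g := g) _ _); cbv beta
  | |- is_derive _ _ (fun y => - @?f y) _ => simple notypeclasses refine (der_opp (f := f) _); cbv beta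
  | |- is_derive _ _ (fun y => @?f y * @?g y) _ => simple notypeclasses refine (der_mul (f := f) (g := g) _ _); cbv beta
  | |- is_derive _ _ (fun y => (@?f y)^-1) _ => simple notypeclasses refine (der_inv (f := f) _ _); cbv beta
  | |- is_derive _ _ (fun y => (@?f y) ^+ ?n) _ => simple notypeclasses refine (der_exp (f := f) n _); cbv beta
  | |- is_derive _ _ (fun y => sin (@?f y)) _ => simple notypeclasses refine (der_sin (f := f) _); cbv beta
  | |- is_derive _ _ (fun y => cos (@?f y)) _ => simple notypeclasses refine (der_cos (f := f) _); cbv beta
  | |- is_derive _ _ (fun y => atan (@?f y)) _ => simple notypeclasses refine (der_atan (f := f) _); cbv beta
  | |- is_derive _ _ (fun y => asin (@?f y)) _ => simple notypeclasses refine (der_asin (f := f) _ _); cbv beta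
  | |- is_derive _ _ (fun y => ln (@?f y)) _ => simple notypeclasses refine (der_ln (f := f) _ _); cbv beta
  | |- is_derive _ _ (fun y => Num.sqrt (@?f y)) _ => simple notypeclasses refine (der_sqrt (f := f) _ _); cbv beta
  | |- is_derive _ _ _ _ => solve [eauto]
  end.
Ltac derive := simple notypeclasses refine (der_eq _ _); [shelve | repeat der_step | cbv beta].

Section OneVariable.
Context {R : realType}.
Implicit Types (f g F : R -> R) (a b x : R).
Notation mu := (@lebesgue_measure R).

Lemma der_continuous f x a : der x f a -> {for x, continuous f}.
Proof.
by move=> [fx _]; apply: differentiable_continuous; apply/derivable1_diffP.
Qed.

Lemma der_near f g x (a : R) : (\forall y \near x, g y = f y) -> der x g a -> der x f a.
Proof. by move=> gf; exact: near_eq_is_derive. Qed.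

Lemma der_lim f x (a : R) : h^-1 * (f (h + x) - f x) @[h --> 0^'] --> a -> der x f a.
Proof.
move=> fa; have fa' : h^-1 *: (f (h *: (1 : R) + x) - f x) @[h --> 0^'] --> a.
  by under eq_fun do rewrite /GRing.scale/= mulr1.
by apply: DeriveDef; [apply/cvg_ex; exists a|exact/cvg_lim].
Qed.

Lemma continuous_within f (A : set R) :
  (forall x, A x -> {for x, continuous f}) -> {within A, continuous f}.
Proof.
move=> cf; apply/continuous_in_subspaceT => x; rewrite inE; exact: cf.
Qed.

Lemma continuous_integrable f a b : {within `[a, b], continuous f} ->
  mu.-integrable `[a, b] (EFin \o f).
Proof. by move=> cf; apply: continuous_compact_integrable => //; exact: segment_compact. Qed.

Lemma ftc2 f F a b : a <= b ->
  {within `[a, b], continuous F} ->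
  (forall x, a < x < b -> der x F (f x)) ->
  {within `[a, b], continuous f} ->
  \int[mu]_(x in `[a, b]) f x = F b - F a.
Proof.
rewrite le_eqVlt => /predU1P[-> _ _ _|ab cF dF cf].
  by rewrite set_itv1 Rintegral_set1 subrr.
rewrite /Rintegral (@continuous_FTC2 _ f F)//.
- have [cFi cFa cFb] := (continuous_within_itvP F ab).1 cF.
  by split => // x; rewrite in_itv/= => /dF dFx; exact: ex_derive.
- move=> x; rewrite in_itv/= => /dF dFx.
  by rewrite derive1E; exact: derive_val.
Qed.

Lemma der_le f f' a b : a <= b -> {within `[a, b], continuous f} ->
  (forall x, a < x < b -> der x f (f' x)) ->
  (forall x, a < x < b -> 0 <= f' x) -> f a <= f b.
Proof.
rewrite le_eqVlt => /predU1P[->//|ab] cf df f'0.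
have df' x : x \in `]a, b[ -> der x f (f' x) by rewrite in_itv; exact: df.
have [c cab fE] := MVT ab df' cf.
by rewrite -subr_ge0 fE mulr_ge0 ?subr_ge0 ?(ltW ab)// f'0.
Qed.

Lemma der_lt f f' a b : a < b -> {within `[a, b], continuous f} ->
  (forall x, a < x < b -> der x f (f' x)) ->
  (forall x, a < x < b -> 0 < f' x) -> f a < f b.
Proof.
move=> ab cf df f'0.
have df' x : x \in `]a, b[ -> der x f (f' x) by rewrite in_itv; exact: df.
have [c cab fE] := MVT ab df' cf.
by rewrite -subr_gt0 fE mulr_gt0 ?subr_gt0// f'0.
Qed.

Lemma der_eq0_cst f a b : a <= b -> {within `[a, b], continuous f} ->
  (forall x, a < x < b -> der x f (0 : R)) -> f b = f a.
Proof.
rewrite le_eqVlt => /predU1P[->//|ab] cf df.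
have df' x : x \in `]a, b[ -> der x f ((fun=> 0) x) by rewrite in_itv; exact: df.
have [c cab fE] := MVT ab df' cf.
by apply/eqP; rewrite -subr_eq0 fE mul0r.
Qed.

(* At a critical point where the second derivative is positive, [f] increases
   strictly to the right. *)
Lemma second_derivative_test f f' (x m e : R) : 0 < e ->
  (forall y : R, x - e < y < x + e -> der y f (f' y)) ->
  der x f' m -> (forall y : R, x - e < y < x + e -> f y <= f x) -> m <= 0.
Proof.
move=> e0 df d2f maxf; rewrite leNgt; apply/negP => m0.
have xI : x - e < x < x + e by apply/andP; split; lra.
have f'x0 : f' x = 0.
  have : der x f 0.
    apply: (@derive1_at_max _ f (x - e) (x + e)) => //; first by lra.
      by move=> t; rewrite in_itv/= => /df dft; exact: ex_derive.
  by have [_ <-] := df x xI => -[_ ->].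
have cf'm : h^-1 * (f' (h + x) - f' x) @[h --> 0^'] --> m.
  have [/cvg_ex[l fl] f'E] := d2f.
  have lm : l = m by rewrite -f'E; symmetry; exact/cvg_lim.
  by move: fl; rewrite lm; under eq_fun do rewrite scaler1.
have [d /= d0 Hd] : \forall h \near 0^', 0 < h^-1 * (f' (h + x) - f' x).
  exact: (cvgr_gt m).
pose k := Num.min d e / 2.
have k0 : 0 < k by rewrite /k divr_gt0// lt_min d0.
have [kd ke] : k < d /\ k < e.
  have : k < Num.min d e by rewrite /k ltr_pdivrMr// ltr_pMr ?ltr1n// lt_min d0.
  by rewrite lt_min => /andP.
have f'gt0 y : x < y < x + k -> 0 < f' y.
  move=> /andP[xy yk]; have := Hd (y - x).
  rewrite /= sub0r normrN gtr0_norm ?subr_gt0// subrK f'x0 subr0.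
  have -> : y - x < d by lra.
  rewrite subr_eq0 gt_eqF// => /(_ isT isT).
  by rewrite pmulr_rgt0// invr_gt0 subr_gt0.
have dfI y : x - k <= y <= x + k -> der y f (f' y).
  by move=> /andP[? ?]; apply: df; apply/andP; split; lra.
have : f x < f (x + k).
  apply: (@der_lt f f'); first by lra.
  - apply: continuous_within => y /=; rewrite in_itv/= => /andP[y1 y2].
    by apply: (@der_continuous _ _ (f' y)); apply: dfI; apply/andP; split; lra.
  - by move=> y /andP[y1 y2]; apply: dfI; apply/andP; split; lra.
  - by move=> y /f'gt0.
rewrite ltNge => /negP; apply; apply: maxf; apply/andP; split; lra.
Qed.

End OneVariable.

Ltac der_cont := simple notypeclasses refine (@der_continuous _ _ _ _ _); [shelve | repeat der_step; cbv beta].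

Section Measurability.
Context {R : realType} d (T : measurableType d).
Implicit Types (f g : T -> R).
Notation meas f := (measurable_fun [set: T] f).

(** The inverse is continuous off 0; the point 0, where it has the conventional value 0, is split
    off by a test. *)
Lemma measurable_inv_real : measurable_fun [set: R] (fun x : R => x^-1).
Proof.
rewrite (_ : (fun x : R => x^-1) = fun x : R => if x == 0 then 0 else x^-1); last first.
  by apply/funext => x; case: eqP => // ->; rewrite invr0.
apply: measurable_fun_if => //.
- apply: (measurable_fun_bool true) => //=; rewrite setTI.
  rewrite (_ : _ @^-1` _ = [set 0]); first exact: measurable_set1.
  by apply/seteqP; split => x /=; [move/eqP|move=> ->; rewrite eqxx].
- apply: open_continuous_measurable_fun.
    rewrite setTI (_ : _ @^-1` _ = ~` [set 0]).
      by apply: closed_openC; exact: closed_eq.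
    by apply/seteqP; split => x /=; [move=> xE /eqP|move/eqP/negbTE]; rewrite ?xE.
  by move=> x /[!inE] -[_ /= /negbT x0]; exact: inv_continuous.
Qed.

Lemma meas_cst (a : R) : meas (fun=> a). Proof. exact: measurable_cst. Qed.
Lemma meas_add f g : meas f -> meas g -> meas (fun x => f x + g x).
Proof. exact: measurable_funD. Qed.
Lemma meas_opp f : meas f -> meas (fun x => - f x).
Proof. by move=> mf; exact: measurableT_comp. Qed.
Lemma meas_mul f g : meas f -> meas g -> meas (fun x => f x * g x).
Proof. exact: measurable_funM. Qed.
Lemma meas_exp f n : meas f -> meas (fun x => f x ^+ n).
Proof. exact: measurable_funX. Qed.
Lemma meas_inv f : meas f -> meas (fun x => (f x)^-1).
Proof. by move=> mf; exact: (measurableT_comp measurable_inv_real). Qed.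
Lemma meas_norm f : meas f -> meas (fun x => `|f x|).
Proof. by move=> mf; exact: measurableT_comp. Qed.
Lemma meas_cos f : meas f -> meas (fun x => cos (f x)).
Proof.
by move=> mf; apply: (measurableT_comp (f := cos)) => //; apply: continuous_measurable_fun; exact: continuous_cos.
Qed.
Lemma meas_sin f : meas f -> meas (fun x => sin (f x)).
Proof.
by move=> mf; apply: (measurableT_comp (f := sin)) => //; apply: continuous_measurable_fun; exact: continuous_sin.
Qed.
Lemma meas_sqrt f : meas f -> meas (fun x => Num.sqrt (f x)).
Proof.
move=> mf; have ms : measurable_fun [set: R] (@Num.sqrt R).
  by apply: continuous_measurable_fun; exact: sqrt_continuous.
exact: measurableT_comp ms mf.
Qed.
Lemma meas_max f g : meas f -> meas g -> meas (fun x => Num.max (f x) (g x)).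
Proof. exact: measurable_maxr. Qed.
Lemma meas_if (b : T -> bool) f g : meas b -> meas f -> meas g ->
  meas (fun x => if b x then f x else g x).
Proof. exact: measurable_fun_ifT. Qed.
Lemma meas_le f g : meas f -> meas g -> meas (fun x => f x <= g x).
Proof. exact: measurable_fun_ler. Qed.
Lemma meas_lt f g : meas f -> meas g -> meas (fun x => f x < g x).
Proof. exact: measurable_fun_ltr. Qed.
Lemma meas_and (b c : T -> bool) : meas b -> meas c -> meas (fun x => b x && c x).
Proof. exact: measurable_and. Qed.

End Measurability.

Ltac meas_step :=
  lazymatch goal with
  | |- measurable_fun _ (fun y => fst (@?f y)) => simple notypeclasses refine (measurableT_comp (f := fst) measurable_fst _)
  | |- measurable_fun _ (fun y => snd (@?f y)) => simple notypeclasses refine (measurableT_comp (f := snd) measurable_snd _)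
  | |- measurable_fun _ (fun _ => ?c) => exact: meas_cst
  | |- measurable_fun _ (fun y => @?f y + @?g y) => simple notypeclasses refine (meas_add (f := f) (g := g) _ _); cbv beta
  | |- measurable_fun _ (fun y => - @?f y) => simple notypeclasses refine (meas_opp (f := f) _); cbv beta
  | |- measurable_fun _ (fun y => @?f y * @?g y) => simple notypeclasses refine (meas_mul (f := f) (g := g) _ _); cbv beta
  | |- measurable_fun _ (fun y => (@?f y)^-1) => simple notypeclasses refine (meas_inv (f := f) _); cbv beta
  | |- measurable_fun _ (fun y => (@?f y) ^+ ?n) => simple notypeclasses refine (meas_exp (f := f) n _); cbv beta
  | |- measurable_fun _ (fun y => `|@?f y|) => simple notypeclasses refine (meas_norm (f := f) _); cbv beta
  | |- measurable_fun _ (fun y => sin (@?f y)) => simple notypeclasses refine (meas_sin (f := f) _); cbv beta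
  | |- measurable_fun _ (fun y => cos (@?f y)) => simple notypeclasses refine (meas_cos (f := f) _); cbv beta
  | |- measurable_fun _ (fun y => Num.sqrt (@?f y)) => simple notypeclasses refine (meas_sqrt (f := f) _); cbv beta
  | |- measurable_fun _ (fun y => Num.max (@?f y) (@?g y)) => simple notypeclasses refine (meas_max (f := f) (g := g) _ _); cbv beta
  | |- measurable_fun _ (fun y => @?f y <= @?g y) => simple notypeclasses refine (meas_le (f := f) (g := g) _ _); cbv beta
  | |- measurable_fun _ (fun y => @?f y < @?g y) => simple notypeclasses refine (meas_lt (f := f) (g := g) _ _); cbv beta
  | |- measurable_fun _ (fun y => @?f y && @?g y) => simple notypeclasses refine (meas_and (b := f) (c := g) _ _); cbv beta
  | |- measurable_fun _ _ => first [exact: measurable_id | exact: measurable_fst | exact: measurable_snd | solve [by [] | eauto] | simple notypeclasses refine (meas_if _ _ _); cbv beta]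
  end.
Ltac meas := repeat meas_step.

(** * The extremal direction is radial *)

Section ChordMoment.
Context {R : realType}.
Implicit Types k l : R.
Variable s : R.
Hypothesis s01 : 0 < s < 1.

Definition half_chord (k : R) := Num.sqrt (1 - s / 4 + k ^+ 2 / 4).
Local Notation h := half_chord.

Lemma half_chord_gt0 k : 0 < h k.
Proof. by rewrite sqrtr_gt0; move: s01 => /andP[? ?]; have := sqr_ge0 k; lra. Qed.

Lemma half_chord_sqr k : h k ^+ 2 = 1 - s / 4 + k ^+ 2 / 4.
Proof. by rewrite sqr_sqrtr//; move: s01 => /andP[? ?]; have := sqr_ge0 k; lra. Qed.

Lemma der_half_chord k : der k h (k / (4 * h k)).
Proof.
rewrite /h; derive.
  by have := half_chord_gt0 k; rewrite sqrtr_gt0.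
by rewrite -/(h k); field; rewrite gt_eqF ?half_chord_gt0.
Qed.

(** The two factors are [1 - 2 k q] at the ends [q = - k/2 - h k] and [q = - k/2 + h k] of the
    chord. For [k >= 0] the first is visibly positive, so the sign of the second is that of the
    product. *)
Lemma half_chord_disc k : (1 + k ^+ 2 + 2 * k * h k) * (1 + k ^+ 2 - 2 * k * h k) =
  1 - 2 * k ^+ 2 + k ^+ 2 * s.
Proof.
have -> : (1 + k ^+ 2 + 2 * k * h k) * (1 + k ^+ 2 - 2 * k * h k) =
  (1 + k ^+ 2) ^+ 2 - 4 * k ^+ 2 * h k ^+ 2 by ring.
by rewrite half_chord_sqr; field.
Qed.

Lemma half_chord_disc_gt0 k : k ^+ 2 <= s -> 0 < 1 - 2 * k ^+ 2 + k ^+ 2 * s.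
Proof.
move=> ks; move: s01 => /andP[s0 s1].
(* The quantity equals [(1 - s)^2 + (2 - s) (s - k^2)]. *)
have : 0 < (1 - s) ^+ 2 by rewrite exprn_gt0// subr_gt0.
have : 0 <= (2 - s) * (s - k ^+ 2) by rewrite mulr_ge0// ?subr_ge0//; lra.
lra.
Qed.

Lemma half_chord_factors_gt0 k : 0 <= k -> k ^+ 2 <= s ->
  0 < 1 + k ^+ 2 + 2 * k * h k /\ 0 < 1 + k ^+ 2 - 2 * k * h k.
Proof.
move=> k0 ks; have hk := half_chord_gt0 k.
have p : 0 < 1 + k ^+ 2 + 2 * k * h k.
  have := sqr_ge0 k; have : 0 <= k * h k by rewrite mulr_ge0// ltW.
  lra.
split => //; have := half_chord_disc_gt0 ks.
by rewrite -half_chord_disc pmulr_rgt0.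
Qed.

Definition chord_log (k : R) :=
  ln (1 + k ^+ 2 + 2 * k * h k) - ln (1 + k ^+ 2 - 2 * k * h k).

Lemma der_chord_log k : 0 <= k -> k ^+ 2 <= s ->
  der k chord_log ((h k)^-1 * (1 + (3 - s) / (1 - 2 * k ^+ 2 + k ^+ 2 * s))).
Proof.
move=> k0 ks; have [p q] := half_chord_factors_gt0 k0 ks.
have hk := half_chord_gt0 k; have dh := der_half_chord k.
(* Eliminating [s] by the defining relation of the square root turns the goal into a rational
   identity in [k] and [h k]. *)
have sE : s = 4 + k ^+ 2 - 4 * h k ^+ 2 by rewrite half_chord_sqr; lra.
have pq : 1 - 2 * k ^+ 2 + k ^+ 2 * s != 0.
  by rewrite gt_eqF// half_chord_disc_gt0.
rewrite /chord_log; derive => //.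
rewrite -half_chord_disc.
move: sE; set t := h k => sE.
rewrite {}sE; rewrite -/t in p q hk *.
by field; rewrite !gt_eqF.
Qed.

(* [int q^2 / (1 - 2 k q) dq] over the chord cut by the disc of radius 1 centred
   at [(- sqrt s / 2, 0)] on the line through the origin on which the first
   coordinate is [k / sqrt s] times the signed distance. *)
Definition chord_moment (k : R) :=
  h k * (k ^+ 2 - 1) / (2 * k ^+ 2) + chord_log k / (8 * k ^+ 3).

(** This is [8 k^4] times the derivative of [chord_moment]. The logarithm occurs in it with the
    constant coefficient -3, so one more differentiation removes it. *)
Definition chord_moment_num (k : R) :=
  k ^+ 3 * (k ^+ 2 - 1) / h k + 8 * k * h k +
  k * ((h k)^-1 * (1 + (3 - s) / (1 - 2 * k ^+ 2 + k ^+ 2 * s))) - 3 * chord_log k.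

Lemma der_chord_moment k : 0 < k -> k ^+ 2 <= s ->
  der k chord_moment (chord_moment_num k / (8 * k ^+ 4)).
Proof.
move=> k0 ks.
have hk := half_chord_gt0 k; have dh := der_half_chord k.
have dl := der_chord_log (ltW k0) ks.
have pq : 1 - 2 * k ^+ 2 + k ^+ 2 * s != 0.
  by rewrite gt_eqF// half_chord_disc_gt0.
rewrite /chord_moment; derive.
- by rewrite mulf_neq0// ?expf_neq0 ?gt_eqF.
- by rewrite mulf_neq0// ?expf_neq0 ?gt_eqF.
- by rewrite /chord_moment_num /=; field; rewrite pq !gt_eqF.
Qed.

Lemma der_chord_moment_num k : 0 <= k -> k ^+ 2 <= s ->
  exists2 d, 0 <= d & der k chord_moment_num d.
Proof.
move=> k0 ks; move: (s01) => /andP[s0 s1].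
have hk := half_chord_gt0 k; have dh := der_half_chord k.
have dl := der_chord_log k0 ks.
have D0 := half_chord_disc_gt0 ks.
have pq : 1 - 2 * k ^+ 2 + k ^+ 2 * s != 0 by rewrite gt_eqF.
have sE : s = 4 + k ^+ 2 - 4 * h k ^+ 2 by rewrite half_chord_sqr; lra.
(* The exact derivative, grouped so that each term is nonnegative: [s < 1] gives [2 - s > 1], hence
   [2 (2 - s)^2 + 4 (2 - s) - 1 > 0]. *)
exists ((4 * k ^+ 6 + (22 - 5 * s) * k ^+ 4 + (3 - s) * (2 - s) * k ^+ 4 *
   (2 * (2 - s) ^+ 2 + 4 * (2 - s) - 1 + 3 * (2 - s) * k ^+ 2) /
   (1 - 2 * k ^+ 2 + k ^+ 2 * s) ^+ 2) / (4 * h k ^+ 3)).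
  have k2 : 0 <= k ^+ 2 := sqr_ge0 k.
  rewrite mulr_ge0 ?invr_ge0 ?mulr_ge0 ?exprn_ge0 ?(ltW hk)//.
  have a1 : 1 < 2 - s by lra.
  have a2 : 0 <= 3 * (2 - s) * k ^+ 2 by rewrite !mulr_ge0//; lra.
  have a3 : 0 <= (2 - s) ^+ 2 by exact: sqr_ge0.
  rewrite !addr_ge0// ?mulr_ge0 ?exprn_ge0 ?invr_ge0 ?exprn_ge0 ?(ltW D0)//; lra.
rewrite /chord_moment_num; derive => //.
- by rewrite gt_eqF.
- by rewrite gt_eqF.
- rewrite /=; move: sE; set t := h k => sE.
  rewrite -/t in hk *; move: pq; rewrite sE => pq.
  by field; rewrite pq gt_eqF.
Qed.

(** It vanishes at 0 and its derivative is nonnegative. *)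
Lemma chord_moment_num_ge0 k : 0 <= k -> k ^+ 2 <= s -> 0 <= chord_moment_num k.
Proof.
move=> k0 ks.
have -> : 0 = chord_moment_num 0.
  by rewrite /chord_moment_num /chord_log !expr0n/= !(mulr0, mul0r, addr0, subr0) subrr mulr0 subr0.
have ik x : 0 <= x <= k -> 0 <= x /\ x ^+ 2 <= s.
  move=> /andP[x0 xk]; split=> //; apply: le_trans ks.
  by rewrite ler_pXn2r.
have dP x (xk : 0 <= x <= k) :
    exists d, 0 <= d /\ der x chord_moment_num d.
  by have [x0 xs] := ik _ xk; have [d] := der_chord_moment_num x0 xs; exists d.
(* The derivative is known point by point; [der_le] wants it as one function. *)
have [f' f'P] : exists f' : R -> R, forall x, 0 <= x <= k ->
    0 <= f' x /\ der x chord_moment_num (f' x).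
  exists (fun x => if pselect (0 <= x <= k) is left xk then sval (cid (dP x xk)) else 0).
  by move=> x xk; case: pselect => // xk'; case: cid.
have sub x : 0 < x < k -> 0 <= x <= k by move=> /andP[/ltW -> /ltW ->].
apply: (@der_le _ _ f') => //.
- apply: continuous_within => x /=; rewrite in_itv/= => /f'P[_].
  exact: der_continuous.
- by move=> x /sub/f'P[].
- by move=> x /sub/f'P[].
Qed.

Lemma chord_moment_nd k l : 0 < k -> k <= l -> l ^+ 2 <= s ->
  chord_moment k <= chord_moment l.
Proof.
move=> k0 kl ls.
have ik x : k <= x <= l -> 0 < x /\ x ^+ 2 <= s.
  move=> /andP[kx xl]; have x0 := lt_le_trans k0 kx; split => //.
  by apply: le_trans ls; rewrite ler_pXn2r// ?nnegrE ltW// (lt_le_trans x0).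
have sub x : k < x < l -> k <= x <= l by move=> /andP[/ltW -> /ltW ->].
apply: (@der_le _ _ (fun x => chord_moment_num x / (8 * x ^+ 4))) => //.
- apply: continuous_within => x /=; rewrite in_itv/= => /ik[x0 xs].
  exact: der_continuous (der_chord_moment x0 xs).
- by move=> x /sub/ik[x0 xs]; exact: der_chord_moment.
- move=> x /sub/ik[x0 xs]; rewrite mulr_ge0 ?chord_moment_num_ge0 ?(ltW x0)//.
  by rewrite invr_ge0 mulr_ge0// exprn_ge0// ltW.
Qed.

End ChordMoment.

(** * The moment as an integral over a chord *)

Section ChordIntegral.
Context {R : realType}.
Notation mu := (@lebesgue_measure R).
Variable r : R.
Hypothesis r01 : 0 < r < 1.
Implicit Types t x : R.

Let r0 : 0 < r. Proof. by case/andP: r01. Qed.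
Let r1 : r < 1. Proof. by case/andP: r01. Qed.
Let s01 : 0 < r ^+ 2 < 1.
Proof. by rewrite exprn_gt0//= expr_lt1// ltW. Qed.

(** Both partial integrals matter. Over [x] it gives [(t - r/2)^2 / (1 + r^2 - 2 r t)] times the
    length of the layer [[0, sqrt (1 - t^2) / |t - r/2|]]; over [t] it gives the moment of a chord.
    Tonelli's theorem connects the two. *)
Definition chord_kernel (t x : R) :=
  if (0 <= x) && (x ^+ 2 * (t - r / 2) ^+ 2 <= 1 - t ^+ 2)
  then (t - r / 2) ^+ 2 / (1 + r ^+ 2 - 2 * r * t) else 0.

Lemma kernel_den_gt0 t : t <= 1 -> 0 < 1 + r ^+ 2 - 2 * r * t.
Proof.
move=> t1; have : 0 < (1 - r) ^+ 2 by rewrite exprn_gt0// subr_gt0.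
have : 0 <= r * (1 - t) by rewrite mulr_ge0 ?subr_ge0// ltW.
lra.
Qed.

Lemma chord_kernel_ge0 t x : 0 <= chord_kernel t x.
Proof.
rewrite /chord_kernel; case: ifPn => // /andP[x0 xt].
have t1 : t <= 1.
  have : 0 <= 1 - t ^+ 2 by apply: le_trans xt; rewrite mulr_ge0 ?sqr_ge0.
  by rewrite subr_ge0 => t1; apply: le_trans (ler_norm _) _; rewrite -sqrtr_sqr -sqrtr1 ler_wsqrtr.
by rewrite mulr_ge0 ?sqr_ge0// invr_ge0 ltW// kernel_den_gt0.
Qed.

Lemma measurable_chord_kernel : measurable_fun [set: R * R] (fun p : R * R => chord_kernel p.1 p.2).
Proof. rewrite /chord_kernel; meas. Qed.

(** The cosine of [atan x]; the sine is [x * slope x]. *)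
Definition slope (x : R) := (Num.sqrt (1 + x ^+ 2))^-1.

Lemma slope_arg_gt0 x : 0 < 1 + x ^+ 2.
Proof. by have := sqr_ge0 x; lra. Qed.

Lemma slope_gt0 x : 0 < slope x.
Proof. by rewrite invr_gt0 sqrtr_gt0 slope_arg_gt0. Qed.

Lemma slope_sqr x : slope x ^+ 2 = (1 + x ^+ 2)^-1.
Proof. by rewrite exprVn sqr_sqrtr// ltW// slope_arg_gt0. Qed.

Lemma slope_le1 x : slope x <= 1.
Proof.
rewrite invf_le1 ?sqrtr_gt0 ?slope_arg_gt0//.
by rewrite -[leLHS]sqrtr1 ler_wsqrtr// lerDl sqr_ge0.
Qed.

Definition kernel_antiderivative (y : R) :=
  - y ^+ 2 / (4 * r) - y / (4 * r ^+ 2) - ln (1 - 2 * r * y) / (8 * r ^+ 3).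

Lemma der_kernel_antiderivative y : 0 < 1 - 2 * r * y ->
  der y kernel_antiderivative (y ^+ 2 / (1 - 2 * r * y)).
Proof.
move=> y0; rewrite /kernel_antiderivative; derive => //.
by rewrite /=; field; rewrite !gt_eqF.
Qed.

(** Put [t - r/2 = slope x * q]. The condition becomes [q^2 + r (slope x) q + r^2 / 4 <= 1], a chord
    of the disc, and the denominator becomes [1 - 2 r (slope x) q]; the square and [dt] release
    three factors [slope x]. *)
Lemma integral_chord_kernel x : 0 <= x ->
  (\int[mu]_t (chord_kernel t x)%:E =
   (slope x ^+ 3 * chord_moment (r ^+ 2) (r * slope x))%:E)%E.
Proof.
move=> x0; set k := slope x; set h := half_chord (r ^+ 2) (r * k).
have k0 : 0 < k := slope_gt0 x.
have hs := half_chord_sqr s01 (r * k); rewrite -/h in hs.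
have h0 : 0 < h := half_chord_gt0 s01 (r * k).
have k2 : k ^+ 2 * (1 + x ^+ 2) = 1.
  by rewrite slope_sqr mulVf// gt_eqF// slope_arg_gt0.
(* The roots in [t] of [x^2 (t - r/2)^2 = 1 - t^2]. *)
pose a := r / 2 + k * (- (r * k) / 2 - h).
pose b := r / 2 + k * (- (r * k) / 2 + h).
have ab : a < b by rewrite /a /b; have := mulr_gt0 k0 h0; lra.
have memE t : (x ^+ 2 * (t - r / 2) ^+ 2 <= 1 - t ^+ 2) = (a <= t <= b).
  have -> : (x ^+ 2 * (t - r / 2) ^+ 2 <= 1 - t ^+ 2) = (0 <= (t - a) * (b - t)).
    have -> : (t - a) * (b - t) = k ^+ 2 * (1 - t ^+ 2 - x ^+ 2 * (t - r / 2) ^+ 2).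
      have -> : k ^+ 2 * (1 - t ^+ 2 - x ^+ 2 * (t - r / 2) ^+ 2) =
         k ^+ 2 * (1 - t ^+ 2 + (t - r / 2) ^+ 2) - (k ^+ 2 * (1 + x ^+ 2)) * (t - r / 2) ^+ 2 by ring.
      rewrite k2; have -> : (t - a) * (b - t) = k ^+ 2 * h ^+ 2 - (t - r / 2 + k * (r * k) / 2) ^+ 2.
        by rewrite /a /b; ring.
      by rewrite hs; field.
    by rewrite pmulr_rge0 ?exprn_gt0// subr_ge0.
  have [ta|at_] := leP a t; have [tb|bt] := leP t b => /=.
  - by rewrite mulr_ge0// subr_ge0.
  - by apply/negbTE; rewrite -ltNge pmulr_rlt0 ?subr_lt0// subr_gt0 (lt_trans ab).
  - by apply/negbTE; rewrite -ltNge nmulr_rlt0 ?subr_lt0// subr_gt0 (lt_trans _ ab).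
  - by move: (lt_trans at_ ab); rewrite ltNge (ltW bt).
have kE : (fun t => (chord_kernel t x)%:E) =
    (fun t => ((t - r / 2) ^+ 2 / (1 + r ^+ 2 - 2 * r * t))%:E) \_ `[a, b].
  apply/funext => t; rewrite patchE /chord_kernel x0/= memE.
  by rewrite mem_setE in_itv/=; case: ifP.
have den t : a <= t <= b -> 0 < 1 + r ^+ 2 - 2 * r * t.
  rewrite -memE => xt; apply: kernel_den_gt0.
  have : 0 <= 1 - t ^+ 2 by apply: le_trans xt; rewrite mulr_ge0 ?sqr_ge0.
  by rewrite subr_ge0 => t1; apply: le_trans (ler_norm _) _; rewrite -sqrtr_sqr -sqrtr1 ler_wsqrtr.
have denE t : 1 + r ^+ 2 - 2 * r * t = 1 - 2 * r * (t - r / 2) by field.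
rewrite kE -integral_mkcond.
have cg : {within `[a, b], continuous (fun t => (t - r / 2) ^+ 2 / (1 + r ^+ 2 - 2 * r * t))}.
  apply: continuous_within => t /=; rewrite in_itv/= => /den dt.
  by der_cont; rewrite gt_eqF.
have dF t : a <= t <= b -> der t (fun t => kernel_antiderivative (t - r / 2))
    ((t - r / 2) ^+ 2 / (1 + r ^+ 2 - 2 * r * t)).
  move=> /den; rewrite denE => dt.
  have dI : der t (fun t : R => t - r / 2) (1 : R) by derive; rewrite addr0.
  by have := der_comp (f := fun t : R => t - r / 2) (der_kernel_antiderivative dt) dI; rewrite mulr1.
have := @ftc2 _ _ (fun t => kernel_antiderivative (t - r / 2)) a b (ltW ab).
move=> /(_ (fun t => (t - r / 2) ^+ 2 / (1 + r ^+ 2 - 2 * r * t))) => FTC.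
have : \int[mu]_(t in `[a, b]) ((t - r / 2) ^+ 2 / (1 + r ^+ 2 - 2 * r * t)) =
  slope x ^+ 3 * chord_moment (r ^+ 2) (r * slope x).
  have cF : {within `[a, b], continuous (fun t => kernel_antiderivative (t - r / 2))}.
    apply: continuous_within => t /=; rewrite in_itv/= => /dF.
    exact: der_continuous.
  have dF' t : a < t < b -> der t (fun t => kernel_antiderivative (t - r / 2))
    ((t - r / 2) ^+ 2 / (1 + r ^+ 2 - 2 * r * t)).
    by move=> /andP[ta tb]; apply: dF; rewrite !ltW.
  rewrite (FTC cF dF' cg).
  rewrite /kernel_antiderivative /chord_moment /chord_log -/k -/h.
  have -> : 1 - 2 * r * (b - r / 2) = 1 + (r * k) ^+ 2 - 2 * (r * k) * h by rewrite /b; field.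
  have -> : 1 - 2 * r * (a - r / 2) = 1 + (r * k) ^+ 2 + 2 * (r * k) * h by rewrite /a; field.
  move: (ln _) (ln _) => l1 l2; rewrite /a /b.
  by field; rewrite !gt_eqF.
move=> <-; rewrite /Rintegral fineK//; apply: integrable_fin_num => //.
exact: continuous_integrable.
Qed.

End ChordIntegral.

(** * Integrals against the weight [slope ^ 3] *)

Section SlopeIntegrals.
Context {R : realType}.
Notation mu := (@lebesgue_measure R).
Implicit Types x T : R.

Lemma slope_mul x : slope x ^+ 2 * (1 + x ^+ 2) = 1.
Proof. by rewrite slope_sqr mulVf// gt_eqF// slope_arg_gt0. Qed.

Lemma slope_cube x : slope x = slope x ^+ 3 + x ^+ 2 * slope x ^+ 3.
Proof. by rewrite -[LHS]mulr1 -(slope_mul x); ring. Qed.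

Lemma der_slope x : der x slope (- x * slope x ^+ 3).
Proof.
rewrite /slope; derive.
- by rewrite sqrtr_eq0 -ltNge slope_arg_gt0.
- exact: slope_arg_gt0.
- have : Num.sqrt (1 + x ^+ 2) != 0 by rewrite sqrtr_eq0 -ltNge slope_arg_gt0.
  by move: (Num.sqrt _) => t t0 /=; field.
Qed.

Lemma slope_mulx_le1 x : x * slope x <= 1.
Proof.
apply: le_trans (ler_norm _) _; rewrite -sqrtr_sqr -[leRHS]sqrtr1 ler_wsqrtr// exprMn.
have := slope_mul x; have := sqr_ge0 (slope x); lra.
Qed.

Lemma cvg_slope : slope x @[x --> +oo] --> (0 : R).
Proof.
apply/cvgrPdist_le => /= e e0; near=> x.
have x0 : 0 < x by near: x; apply: nbhs_pinfty_gt; exact: num_real.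
rewrite sub0r normrN gtr0_norm ?slope_gt0//.
have ex : e^-1 <= x by near: x; apply: nbhs_pinfty_ge; exact: num_real.
have : x^-1 <= e by rewrite -[e]invrK lef_pV2// posrE invr_gt0.
apply: le_trans; rewrite -(ler_pM2l x0) mulfV ?gt_eqF//.
exact: slope_mulx_le1.
Unshelve. all: by end_near. Qed.

Lemma cvg_slope_mulx : x * slope x @[x --> +oo] --> (1 : R).
Proof.
apply: (@squeeze_cvgr _ _ _ _ (fun x => 1 - slope x) (fun=> 1)).
- near=> x.
  have x0 : 0 < x by near: x; apply: nbhs_pinfty_gt; exact: num_real.
  rewrite slope_mulx_le1 andbT.
  have a : 0 <= x * slope x by rewrite mulr_ge0 ?ltW ?slope_gt0.
  have b := slope_mulx_le1 x.
  have c : slope x <= 1 by exact: slope_le1.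
  have d := slope_gt0 x; have e := slope_mul x.
  have : 0 <= x * slope x * (1 - x * slope x) by rewrite mulr_ge0 ?subr_ge0.
  have : 0 <= slope x * (1 - slope x) by rewrite mulr_ge0 ?subr_ge0// ltW.
  lra.
- by rewrite -[X in _ --> X]subr0; apply: cvgB; [exact: cvg_cst|exact: cvg_slope].
- exact: cvg_cst.
Unshelve. all: by end_near. Qed.

(** The sine [x * slope x] is an antiderivative, so [slope ^ 3] is a probability density on the
    half-line. *)
Lemma integral_slope3 :
  (\int[mu]_(x in `[0%R, +oo[) (slope x ^+ 3)%:E = 1%E)%E.
Proof.
have dF x : der x (fun x => x * slope x) (slope x ^+ 3).
  have dx := der_slope x; derive.
  by have := slope_cube x; lra.
rewrite (@ge0_continuous_FTC2y _ _ (fun x => x * slope x) _ 1).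
- by rewrite mul0r sube0.
- by move=> x _; rewrite exprn_ge0// ltW// slope_gt0.
- apply: continuous_within => x _.
  by have dx := der_slope x; der_cont.
- exact: cvg_slope_mulx.
- by move=> x _; have dx := dF x; exact: ex_derive.
- by apply: cvg_at_right_filter; exact: der_continuous (dF 0).
- by move=> x _; rewrite derive1E; have [_ ->] := dF x.
Qed.

(** For [T = l1 / l2] with [l1^2 + l2^2 = 1] the value is [(1 - l1) / l2]; this is the equality of
    means behind the association inequality. *)
Lemma integral_max_slope3 T : 0 <= T ->
  (\int[mu]_(x in `[0%R, +oo[) (Num.max (x - T) 0 * slope x ^+ 3)%:E =
   (Num.sqrt (1 + T ^+ 2) - T)%:E)%E.
Proof.
move=> T0.
have m3 : measurable_fun [set: R] (fun x : R => Num.max (x - T) 0 * slope x ^+ 3).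
  by rewrite /slope; meas.
have ge0 x : 0 <= Num.max (x - T) 0 * slope x ^+ 3.
  by rewrite mulr_ge0// ?le_max ?lexx ?orbT// exprn_ge0// ltW// slope_gt0.
have -> : `[0%R, +oo[%classic = `[0%R, T[ `|` `[T, +oo[ :> set R.
  apply/seteqP; split => x /=; rewrite !in_itv/= !andbT.
    by move=> x0; case: (ltP x T) => xT; [left; rewrite x0|right].
  by case=> [/andP[]//|]; exact: le_trans.
rewrite ge0_integral_setU//=; last 3 first.
- by apply/measurable_EFinP; exact: measurable_funTS.
- by move=> x _; rewrite lee_fin.
- apply/disj_setPS => x [/=]; rewrite !in_itv/= => /andP[_ xT] /andP[Tx _].
  by move: xT; rewrite ltNge Tx.
rewrite (eq_integral (fun=> 0%E)); last first.
  move=> x; rewrite inE/= in_itv/= => /andP[_ xT].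
  by rewrite max_r ?mul0r// subr_le0 ltW.
rewrite integral0 add0e.
transitivity (\int[mu]_(x in `[T, +oo[) ((x - T) * slope x ^+ 3)%:E)%E.
  apply: eq_integral => x; rewrite inE/= in_itv/= => /andP[Tx _].
  by rewrite max_l ?subr_ge0.
have dF x : der x (fun x => - (slope x + T * (x * slope x))) ((x - T) * slope x ^+ 3).
  have dx := der_slope x; derive.
  have := slope_cube x => /(congr1 ( *%R T)); lra.
rewrite (@ge0_continuous_FTC2y _ _ (fun x => - (slope x + T * (x * slope x))) _ (- (0 + T * 1))).
- rewrite -EFinB; congr (_%:E).
  have -> : slope T + T * (T * slope T) = Num.sqrt (1 + T ^+ 2).
    rewrite /slope; have := slope_arg_gt0 T => T1.
    have : Num.sqrt (1 + T ^+ 2) ^+ 2 = 1 + T ^+ 2 by rewrite sqr_sqrtr// ltW.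
    have : Num.sqrt (1 + T ^+ 2) != 0 by rewrite sqrtr_eq0 -ltNge.
    move: (Num.sqrt _) => t t0 tE; have -> : T * (T / t) = (t ^+ 2 - 1) / t by rewrite tE; field.
    by field.
  by ring.
- by move=> x Tx; rewrite mulr_ge0 ?subr_ge0 ?exprn_ge0// ltW// slope_gt0.
- by apply: continuous_within => x _; have dx := der_slope x; der_cont.
- apply: cvgN; apply: cvgD; first exact: cvg_slope.
  by apply: cvgM; [exact: cvg_cst|exact: cvg_slope_mulx].
- by move=> x _; have dx := dF x; exact: ex_derive.
- by apply: cvg_at_right_filter; exact: der_continuous (dF T).
- by move=> x _; rewrite derive1E; have [_ ->] := dF x.
Qed.

End SlopeIntegrals.

Lemma le1_of_sum_sqr (R : realType) (a b : R) : 0 <= a -> a ^+ 2 + b ^+ 2 = 1 -> a <= 1.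
Proof. by move=> a0 ab; rewrite -(@expr_le1 _ 2)//; have := sqr_ge0 b; lra. Qed.

Section Chebyshev.
Context {R : realType}.
Notation mu := (@lebesgue_measure R).
Variable r : R.
Hypothesis r01 : 0 < r < 1.
Implicit Types t x T : R.

Let r0 : 0 < r. Proof. by case/andP: r01. Qed.
Let r1 : r < 1. Proof. by case/andP: r01. Qed.
Let s01 : 0 < r ^+ 2 < 1.
Proof. by rewrite exprn_gt0//= expr_lt1// ltW. Qed.

Local Notation w x := (chord_moment (r ^+ 2) (r * slope x)).

(** The sign is not visible in the closed form and is read off from the integral that it
    evaluates. *)
Lemma chord_moment_ge0 x : 0 <= x -> 0 <= w x.
Proof.
move=> x0; have : (0 <= (slope x ^+ 3 * w x)%:E)%E.
  rewrite -(integral_chord_kernel r01 x0); apply: integral_ge0 => t _.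
  by rewrite lee_fin; exact: chord_kernel_ge0.
by rewrite lee_fin pmulr_rge0// exprn_gt0// slope_gt0.
Qed.

Lemma chord_moment_slope_noninc x y : 0 <= x -> x <= y -> w y <= w x.
Proof.
move=> x0 xy; apply: chord_moment_nd => //.
- by rewrite mulr_gt0// slope_gt0.
- rewrite ler_pM2l// /slope lef_pV2 ?posrE ?sqrtr_gt0 ?slope_arg_gt0//.
  by rewrite ler_wsqrtr// lerD2l ler_pXn2r// nnegrE// (le_trans x0).
- rewrite exprMn ler_piMr ?sqr_ge0//.
  by rewrite expr_le1 ?slope_le1// ltW// slope_gt0.
Qed.

Variables l1 l2 : R.
Hypotheses (l1_ge0 : 0 <= l1) (l2_gt0 : 0 < l2) (l12 : l1 ^+ 2 + l2 ^+ 2 = 1).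

Local Notation a1 x := (l2 * Num.max (x - l1 / l2) 0).

Let l1_le1 : l1 <= 1 := le1_of_sum_sqr l1_ge0 l12.

Let a1_ge0 x : 0 <= a1 x.
Proof. by rewrite mulr_ge0 ?(ltW l2_gt0)// le_max lexx orbT. Qed.

Let C x := (\int[mu]_t (chord_kernel r t x)%:E)%E.

Let C_ge0 x : (0 <= C x)%E.
Proof. by apply: integral_ge0 => t _; rewrite lee_fin; exact: chord_kernel_ge0. Qed.

Let mC : measurable_fun [set: R] C.
Proof.
have := @measurable_fun_fubini_tonelli_G _ _ _ _ R mu
   (fun p => (chord_kernel r p.1 p.2)%:E).
apply; first by apply/measurable_EFinP; exact: measurable_chord_kernel.
by move=> p; rewrite lee_fin; exact: chord_kernel_ge0.
Qed.

(* Chebyshev's association inequality: [1 - l1 - a1] is decreasing, has mean zero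
   for the weight [slope ^ 3], and is integrated against a nonincreasing function. *)
Lemma chebyshev_chord :
  (\int[mu]_(x in `[0%R, +oo[) ((a1 x)%:E * C x) <=
   \int[mu]_(x in `[0%R, +oo[) ((1 - l1)%:E * C x))%E.
Proof.
(* The difference [1 - l1 - a1 x] changes sign at [x = l2^-1]. With the value of [w] at this point
   subtracted from [w], the product of the two differences is nonnegative on the half-line. *)
pose c := w l2^-1.
have c0 : 0 <= c by rewrite chord_moment_ge0// invr_ge0 ltW.
have l1' : 0 <= 1 - l1 by rewrite subr_ge0.
have mslope : measurable_fun [set: R] (fun x : R => slope x ^+ 3) by rewrite /slope; meas.
have ma1 : measurable_fun [set: R] (fun x : R => a1 x) by meas.
have s3 x : 0 <= slope x ^+ 3 by rewrite exprn_ge0// ltW// slope_gt0.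
have I1 : (\int[mu]_(x in `[0%R, +oo[) (c * (a1 x * slope x ^+ 3))%:E = (c * (1 - l1))%:E)%E.
  transitivity (\int[mu]_(x in `[0%R, +oo[)
      ((c * l2)%:E * (Num.max (x - l1 / l2) 0 * slope x ^+ 3)%:E))%E.
    by apply: eq_integral => x _; rewrite -EFinM; congr (_%:E); ring.
  rewrite ge0_integralZl//=; last 3 first.
  - apply/measurable_EFinP/measurable_funTS; rewrite /slope; meas.
  - by move=> x _; rewrite lee_fin mulr_ge0// le_max lexx orbT.
  - by rewrite lee_fin mulr_ge0// ltW.
  rewrite integral_max_slope3 ?divr_ge0 ?(ltW l2_gt0)// -EFinM; congr (_%:E).
  have -> : Num.sqrt (1 + (l1 / l2) ^+ 2) = l2^-1.
    have -> : 1 + (l1 / l2) ^+ 2 = l2^-1 ^+ 2.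
      rewrite expr_div_n exprVn; apply: (mulIf (x := l2 ^+ 2)).
        by rewrite expf_neq0// gt_eqF.
      by rewrite mulrDl mul1r divfK ?mulVf ?expf_neq0 ?gt_eqF// addrC.
    by rewrite sqrtr_sqr gtr0_norm// invr_gt0.
  by field; rewrite gt_eqF.
have I2 : (\int[mu]_(x in `[0%R, +oo[) (c * ((1 - l1) * slope x ^+ 3))%:E = (c * (1 - l1))%:E)%E.
  under eq_integral do rewrite mulrA EFinM.
  rewrite ge0_integralZl//=; last 3 first.
  - by apply/measurable_EFinP; exact: measurable_funTS.
  - by move=> x _; rewrite lee_fin.
  - by rewrite lee_fin mulr_ge0.
  by rewrite integral_slope3 mule1.
have mEC (f : R -> R) : measurable_fun [set: R] f -> measurable_fun (`[0%R, +oo[ : set R) (fun x => (f x)%:E * C x)%E.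
  move=> mf; apply: measurable_funTS; apply: emeasurable_funM => //.
  exact/measurable_EFinP.
have mE (f : R -> R) : measurable_fun [set: R] f -> measurable_fun (`[0%R, +oo[ : set R) (fun x => (f x)%:E).
  by move=> mf; apply: measurable_funTS; exact/measurable_EFinP.
have q1 x : (0 <= (c * (a1 x * slope x ^+ 3))%:E)%E.
  by rewrite lee_fin; exact: mulr_ge0 c0 (mulr_ge0 (a1_ge0 x) (s3 x)).
have q2 x : (0 <= (c * ((1 - l1) * slope x ^+ 3))%:E)%E.
  by rewrite lee_fin; exact: mulr_ge0 c0 (mulr_ge0 l1' (s3 x)).
have q3 x : (0 <= (a1 x)%:E * C x)%E by apply: mule_ge0 => //; rewrite lee_fin.
have q4 x : (0 <= (1 - l1)%:E * C x)%E by apply: mule_ge0 => //; rewrite lee_fin.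
have m1 := mEC _ ma1.
have m2 := mEC _ (meas_cst (1 - l1)).
have m3 : measurable_fun (`[0%R, +oo[ : set R) (fun x => (c * (a1 x * slope x ^+ 3))%:E).
  by apply: mE; apply: meas_mul; [exact: meas_cst|exact: meas_mul].
have m4 : measurable_fun (`[0%R, +oo[ : set R) (fun x => (c * ((1 - l1) * slope x ^+ 3))%:E).
  by apply: mE; apply: meas_mul; [exact: meas_cst|apply: meas_mul => //; exact: meas_cst].
(* The integrals take extended real values. Instead of subtracting the equal quantities [I1] and
   [I2], they are added on opposite sides, which keeps all integrands nonnegative. *)
rewrite -(@leeD2rE _ (c * (1 - l1))%:E)//.
rewrite -[in leLHS]I2 -I1.
rewrite -!ge0_integralD//=.
- apply: ge0_le_integral => //=.
  + move=> x _; apply: adde_ge0; [exact: q3|exact: q2].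
  + exact: emeasurable_funD m1 m4.
  + exact: emeasurable_funD m2 m3.
  move=> x /=; rewrite in_itv/= andbT => x0.
  rewrite /C (integral_chord_kernel r01 x0) -!EFinM -!EFinD lee_fin.
  rewrite -subr_ge0.
  have -> : (1 - l1) * (slope x ^+ 3 * w x) + c * (a1 x * slope x ^+ 3) -
      (a1 x * (slope x ^+ 3 * w x) + c * ((1 - l1) * slope x ^+ 3)) =
     slope x ^+ 3 * ((1 - l1 - a1 x) * (w x - c)) by ring.
  rewrite mulr_ge0//; have [xl|lx] := leP x l2^-1.
    rewrite mulr_ge0 ?subr_ge0//; last exact: chord_moment_slope_noninc.
    rewrite maxr_pMr ?(ltW l2_gt0)// mulr0 ge_max l1' andbT.
    have -> : l2 * (x - l1 / l2) = l2 * x - l1 by field; rewrite gt_eqF.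
    by rewrite lerD2r -ler_pdivlMl// mulr1.
  rewrite mulr_le0// ?subr_le0; last first.
    by apply: chord_moment_slope_noninc; rewrite ?invr_ge0 ltW.
  rewrite maxr_pMr ?(ltW l2_gt0)// mulr0 le_max; apply/orP; left.
  have -> : l2 * (x - l1 / l2) = l2 * x - l1 by field; rewrite gt_eqF.
  by rewrite lerD2r -ler_pdivrMl// mulr1 ltW.
Qed.

End Chebyshev.

Section MulNorm.
Context {R : realType}.
Notation mu := (@lebesgue_measure R).

(** Differentiability at 0 is the point: [y |y| / 2] is an antiderivative of the absolute value on
    the whole line, so integrals of absolute values of affine functions and of their positive parts
    need no splitting. *)
Lemma der_mul_norm (y : R) : der y (fun y => y * `|y|) (2 * `|y|).
Proof.
have [y0|y0|->] := ltgtP y 0.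
- have E : \forall z \near y, - (z ^+ 2) = z * `|z|.
    by near=> z; rewrite ltr0_norm ?mulrN//; near: z; exact: lt_nbhsl.
  apply: (der_near E); derive; rewrite ltr0_norm//=; ring.
- have E : \forall z \near y, z ^+ 2 = z * `|z|.
    by near=> z; rewrite gtr0_norm//; near: z; exact: lt_nbhsr.
  apply: (der_near E); derive; rewrite gtr0_norm//=; ring.
- rewrite normr0 mulr0; apply: der_lim.
  have E : \forall h \near (0 : R)^', `|h : R| = h^-1 * ((h + 0) * `|h + 0| - 0 * `|0 : R|).
    near=> h; rewrite mul0r subr0 addr0 mulrA mulVf ?mul1r//.
    by near: h; exact: nbhs_dnbhs_neq.
  have H : `|h : R| @[h --> (0 : R)^'] --> (0 : R).
    rewrite -[X in _ --> X](@normr0 R R); apply: cvg_within_filter.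
    exact: (@norm_continuous _ R).
  exact: cvg_trans (near_eq_cvg E) H.
Unshelve. all: by end_near. Qed.

End MulNorm.

Lemma one_sub_sqr_ge0 (R : realType) (t : R) : (0 <= 1 - t ^+ 2) = (-1 <= t <= 1).
Proof. by rewrite subr_ge0 -real_normK ?num_real// expr_le1// ler_norml. Qed.

(** * The layer-cake formula *)

Section InnerIntegral.
Context {R : realType}.
Notation mu := (@lebesgue_measure R).
Implicit Types b T t x : R.

Lemma integral_max b T : 0 <= b -> 0 <= T ->
  (\int[mu]_(x in `[0%R, b]) (Num.max (x - T) 0)%:E = (Num.max (b - T) 0 ^+ 2 / 2)%:E)%E.
Proof.
move=> b0 T0.
have maxE x : Num.max (x - T) 0 = ((x - T) + `|x - T|) / 2.
  by case: (lerP 0 (x - T)) => xT; [rewrite ger0_norm//; field|rewrite ltr0_norm//; field].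
have dF x : der x (fun x => ((x - T) ^+ 2 + (x - T) * `|x - T|) / 4) (Num.max (x - T) 0).
  have dI : der x (fun x : R => x - T) (1 : R) by derive; rewrite addr0.
  have dn := der_comp (f := fun x : R => x - T) (der_mul_norm (x - T)) dI.
  apply: (der_eq (der_mul (der_add (der_exp 2 dI) dn) (der_cst 4^-1 x))).
  by rewrite maxE /=; field.
have cm : continuous (fun x : R => Num.max (x - T) 0).
  move=> x; rewrite (_ : (fun x : R => _) = (fun x : R => ((x - T) + `|x - T|) / 2)).
    apply: cvgMl; apply: cvgD; [|apply: cvg_norm]; apply: cvgB; by [exact: cvg_id|exact: cvg_cst].
  by apply/funext => z; rewrite maxE.
have cmb : {within `[0, b], continuous (fun x : R => Num.max (x - T) 0)}.
  by apply: continuous_within => x _; exact: cm.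
have cF : {within `[0, b], continuous (fun x : R => ((x - T) ^+ 2 + (x - T) * `|x - T|) / 4)}.
  by apply: continuous_within => x _; exact: der_continuous (dF x).
have := ftc2 b0 cF (fun x _ => dF x) cmb.
rewrite /Rintegral => H.
rewrite -[LHS]fineK; last by apply: integrable_fin_num => //; exact: continuous_integrable.
rewrite H; congr (_%:E); rewrite sub0r normrN sqrrN (ger0_norm T0).
by case: (lerP 0 (b - T)) => xT; [rewrite ger0_norm//; field|rewrite ltr0_norm//; field].
Qed.

Variable r : R.
Hypothesis r01 : 0 < r < 1.

(** For fixed [t] the condition in [chord_kernel] reads [0 <= x <= sqrt (1 - t^2) / |t - r/2|]. At
    [t = r/2] it puts no upper bound on [x], but there the numerator vanishes; this point is left to
    [integral_kernel_slope0]. *)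
Lemma integral_kernel_slope (a : R -> R) t : measurable_fun [set: R] a ->
  (forall x, 0 <= a x) -> -1 <= t <= 1 -> t != r / 2 ->
  (\int[mu]_x (a x * chord_kernel r t x)%:E =
   ((t - r / 2) ^+ 2 / (1 + r ^+ 2 - 2 * r * t))%:E *
   \int[mu]_(x in `[0%R, (Num.sqrt (1 - t ^+ 2) / `|t - r / 2|)%R]) (a x)%:E)%E.
Proof.
move=> ma a0 t11 tr; set b := Num.sqrt _ / _.
have Y0 : 0 < `|t - r / 2| by rewrite normr_gt0 subr_eq0.
have t2 : 0 <= 1 - t ^+ 2 by rewrite one_sub_sqr_ge0.
have -> : (fun x => (a x * chord_kernel r t x)%:E) =
   (fun x => (((t - r / 2) ^+ 2 / (1 + r ^+ 2 - 2 * r * t)) * a x)%:E) \_ `[0, b].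
  apply/funext => x; rewrite patchE mem_setE in_itv/= /chord_kernel.
  have [x0|x0] /= := leP 0 x; last by rewrite mulr0.
  have -> : (x ^+ 2 * (t - r / 2) ^+ 2 <= 1 - t ^+ 2) = (x <= b).
    rewrite /b ler_pdivlMr// -exprMn -[X in _ <= X](sqr_sqrtr t2) -real_normK ?num_real//.
    by rewrite normrM (ger0_norm x0) ler_pXn2r// nnegrE ?sqrtr_ge0// mulr_ge0.
  by case: ifP => _; rewrite ?mulr0// mulrC.
rewrite -integral_mkcond.
under eq_integral do rewrite EFinM.
rewrite ge0_integralZl//=.
- by apply/measurable_EFinP; exact: measurable_funTS.
- by move=> x _; rewrite lee_fin.
- rewrite lee_fin mulr_ge0 ?sqr_ge0// invr_ge0 ltW// kernel_den_gt0//.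
  by case/andP: t11.
Qed.

Lemma integral_kernel_slope0 (a : R -> R) t : ~~ ((-1 <= t <= 1) && (t != r / 2)) ->
  (\int[mu]_x (a x * chord_kernel r t x)%:E = 0)%E.
Proof.
move=> tN; rewrite (eq_integral (fun=> 0%E)) ?integral0// => x _.
rewrite /chord_kernel; case: ifPn => [/andP[x0 xt]|]; last by rewrite mulr0.
have t11 : -1 <= t <= 1.
  by rewrite -one_sub_sqr_ge0; apply: le_trans xt; rewrite mulr_ge0 ?sqr_ge0.
move: tN; rewrite t11/= negbK => /eqP ->.
by rewrite subrr expr0n/= mul0r mulr0.
Qed.

End InnerIntegral.

Section MeanDeviation.
Context {R : realType}.
Notation mu := (@lebesgue_measure R).
Variable r : R.
Hypothesis r01 : 0 < r < 1.
Variables l1 l2 : R.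
Hypotheses (l1_ge0 : 0 <= l1) (l2_gt0 : 0 < l2) (l12 : l1 ^+ 2 + l2 ^+ 2 = 1).
Implicit Types t x : R.

Local Notation sg t := (Num.sqrt (1 - t ^+ 2)).
Local Notation D t := (1 + r ^+ 2 - 2 * r * t).

Lemma tonelli_chord (a : R -> R) : measurable_fun [set: R] a -> (forall x, 0 <= a x) ->
  (\int[mu]_(x in `[0%R, +oo[) ((a x)%:E * \int[mu]_t (chord_kernel r t x)%:E) =
   \int[mu]_(t in `[(-1)%R, 1%R] `\ (r / 2)%R)
     (((t - r / 2) ^+ 2 / D t)%:E *
      \int[mu]_(x in `[0%R, (sg t / `|t - r / 2|)%R]) (a x)%:E))%E.
Proof.
move=> ma a0.
rewrite integral_mkcond.
transitivity (\int[mu]_x \int[mu]_t (a x * chord_kernel r t x)%:E)%E.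
  apply: eq_integral => x _; rewrite patchE mem_setE in_itv/= andbT.
  case: ifPn => x0.
    rewrite -ge0_integralZl//.
    - by apply/measurable_EFinP; rewrite /chord_kernel; meas.
    - by move=> t _; rewrite lee_fin chord_kernel_ge0.
    - by rewrite lee_fin.
  rewrite (eq_integral (fun=> 0%E)) ?integral0// => t _.
  by rewrite /chord_kernel (negbTE x0) mulr0.
rewrite -(@fubini_tonelli _ _ _ _ _ mu mu (fun p => (a p.2 * chord_kernel r p.1 p.2)%:E)); last 2 first.
- apply/measurable_EFinP; apply: meas_mul; last exact: measurable_chord_kernel.
  exact: measurableT_comp ma measurable_snd.
- by move=> p; rewrite lee_fin mulr_ge0 ?chord_kernel_ge0.
rewrite [RHS]integral_mkcond; apply: eq_integral => t _; rewrite patchE /=.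
case: ifPn.
  rewrite inE => -[/=]; rewrite in_itv/= => t11 /eqP tr.
  by rewrite integral_kernel_slope.
rewrite notin_setE /= in_itv/= => tN; apply: integral_kernel_slope0.
by apply/negP => /andP[t11 /eqP tr]; exact: tN.
Qed.

(** With [S = sqrt (1 - t^2)] and [Y = |t - r/2|], the integrals of [1 - l1] and of
    [l2 max (x - l1 / l2, 0)] over the layer [[0, S / Y]], multiplied by [Y^2], are [(1 - l1) S Y]
    and [max (l2 S - l1 Y, 0)^2 / (2 l2)]. So this is [chebyshev_chord] with the order of
    integration exchanged. *)
Lemma mean_deviation_le :
  (\int[mu]_(t in `[(-1)%R, 1%R]) (Num.max (l2 * sg t - l1 * `|t - r / 2|) 0 ^+ 2 / (2 * l2 * D t))%:E <=
   \int[mu]_(t in `[(-1)%R, 1%R]) ((1 - l1) * (sg t * `|t - r / 2| / D t))%:E)%E.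
Proof.
have := chebyshev_chord r01 l1_ge0 l2_gt0 l12.
rewrite !(tonelli_chord (a := fun x => _))//; last 3 first.
- by move=> x; rewrite subr_ge0; exact: le1_of_sum_sqr l12.
- by meas.
- by move=> x; rewrite mulr_ge0 ?(ltW l2_gt0)// le_max lexx orbT.
have mD (f : R -> R) : measurable_fun [set: R] f ->
    measurable_fun (`[(-1)%R, 1%R] `\ (r / 2)%R : set R) (EFin \o f).
  by move=> mf; apply: measurable_funTS; exact/measurable_EFinP.
have mset : measurable (`[(-1)%R, 1%R] `\ (r / 2)%R : set R) by exact: measurableD.
rewrite -[X in _ -> (X <= _)%E](@integral_setD1 _ _ (r / 2))//; last by apply: mD; meas.
rewrite -[X in _ -> (_ <= X)%E](@integral_setD1 _ _ (r / 2))//; last by apply: mD; meas.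
have inP t : t \in (`[(-1)%R, 1%R] `\ (r / 2)%R : set R) ->
    [/\ 0 < `|t - r / 2|, 0 <= sg t / `|t - r / 2| & 0 < D t].
  rewrite inE => -[/=]; rewrite in_itv/= => /andP[_ t1] /eqP tr.
  have Y0 : 0 < `|t - r / 2| by rewrite normr_gt0 subr_eq0.
  by split; [exact: Y0|rewrite divr_ge0 ?sqrtr_ge0|exact: kernel_den_gt0].
move=> H; apply: le_trans (le_trans _ H) _; rewrite {H} le_eqVlt; apply/orP; left;
  apply/eqP; apply: eq_integral => t /inP[Y0 b0 D0].
  under eq_integral do rewrite EFinM.
  rewrite ge0_integralZl//=; last 3 first.
  - by apply/measurable_EFinP; apply: measurable_funTS; meas.
  - by move=> x _; rewrite lee_fin le_max lexx orbT.
  - by rewrite lee_fin ltW.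
  rewrite integral_max//; last by rewrite divr_ge0// ltW.
  rewrite -!EFinM; congr (_%:E); symmetry.
  have -> : Num.max (l2 * sg t - l1 * `|t - r / 2|) 0 =
      l2 * `|t - r / 2| * Num.max (sg t / `|t - r / 2| - l1 / l2) 0.
    rewrite maxr_pMr ?mulr_ge0 ?(ltW l2_gt0)// mulr0; congr (Num.max _ _).
    by field; rewrite !gt_eqF.
  rewrite -[(t - r / 2) ^+ 2]real_normK ?num_real//.
  by move: (Num.max _ _) => m; field; rewrite !gt_eqF.
rewrite integral_cst//= lebesgue_measure_itv/= lte_fin.
(* A layer of length 0 occurs at [t = -1] and [t = 1]; there the formula for the measure of an
   interval takes its degenerate branch. *)
move: b0; rewrite le_eqVlt => /predU1P[b0|b0].
  rewrite -b0 ltxx mule0 mule0; have -> : sg t = 0.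
    by move/eqP: b0; rewrite eq_sym mulf_eq0 invr_eq0 (gt_eqF Y0) orbF => /eqP.
  by rewrite !mul0r mulr0.
rewrite b0 -EFinD -!EFinM; congr (_%:E).
rewrite -[(t - r / 2) ^+ 2]real_normK ?num_real//.
by field; rewrite !gt_eqF.
Qed.

End MeanDeviation.

(** * Changes of variables *)

Section Substitution.
Context {R : realType}.
Notation mu := (@lebesgue_measure R).
Implicit Types a b : R.

Lemma Rintegral_split (f : R -> R) a b c : a <= b -> b <= c ->
  {within `[a, c], continuous f} ->
  \int[mu]_(x in `[a, c]) f x = \int[mu]_(x in `[a, b]) f x + \int[mu]_(x in `[b, c]) f x.
Proof.
move=> ab bc cf; have icf := continuous_integrable cf.
have := @Rintegral_itvB _ f (BLeft a) (BRight c) b icf.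
rewrite !bnd_simp => /(_ ab bc).
rewrite Rintegral_itv_obnd_cbnd; last first.
  apply: integrableS icf => //; apply: subset_trans (@subset_itv_oc_cc _ _ _ _) _.
  by apply: subset_itvr; rewrite bnd_simp.
by move/eqP; rewrite subr_eq addrC => /eqP.
Qed.

Lemma substitution_decreasing (F F' G : R -> R) a b : a <= b ->
  {in `[a, b] &, {homo F : x y /~ (x < y)%R}} ->
  (forall x, a <= x <= b -> der x F (F' x)) ->
  (forall x, a <= x <= b -> {for x, continuous F'}) ->
  {within `[F b, F a], continuous G} ->
  (\int[mu]_(x in `[F b, F a]) (G x)%:E = \int[mu]_(x in `[a, b]) (G (F x) * - F' x)%:E)%E.
Proof.
rewrite le_eqVlt => /predU1P[->|ab] Fdec dF cF' cG.
  by rewrite !set_itv1 !integral_set1.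
have F'E x : a <= x <= b -> derive1 F x = F' x.
  by move=> /dF[_ <-]; rewrite derive1E.
have sub x : a < x < b -> a <= x <= b by move=> /andP[/ltW -> /ltW ->].
have aab : a <= a <= b by rewrite lexx ltW.
have bab : a <= b <= b by rewrite lexx ltW.
rewrite (integration_by_substitution_decreasing (ltW ab) Fdec) //.
- apply: eq_integral => x; rewrite inE/= in_itv/= => xab.
  by rewrite -(F'E _ xab).
- move=> x; rewrite in_itv/= => xab.
  have E : \forall y \near x, F' y = derive1 F y.
    have xI : x \in `]a, b[ by rewrite in_itv.
    near=> y; rewrite F'E//; apply: sub.
    suff : y \in `]a, b[ by rewrite in_itv.
    by near: y; exact: near_in_itvoo.
  rewrite /continuous_at F'E ?sub//.
  exact: cvg_trans (near_eq_cvg E) (cF' x (sub _ xab)).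
- apply/cvg_ex; exists (F' a).
  have E : \forall y \near a^'+, F' y = derive1 F y.
    near=> y; rewrite F'E//; apply/andP; split; [near: y; exact: nbhs_right_ge|near: y; exact: nbhs_right_le].
  apply: cvg_trans (near_eq_cvg E) _; apply: cvg_at_right_filter; exact: cF'.
- apply/cvg_ex; exists (F' b).
  have E : \forall y \near b^'-, F' y = derive1 F y.
    near=> y; rewrite F'E//; apply/andP; split; [near: y; exact: nbhs_left_ge|near: y; exact: nbhs_left_le].
  apply: cvg_trans (near_eq_cvg E) _; apply: cvg_at_left_filter; exact: cF'.
- split.
  + by move=> x; rewrite in_itv/= => /sub/dF[].
  + by apply: cvg_at_right_filter; exact: der_continuous (dF a aab).
  + by apply: cvg_at_left_filter; exact: der_continuous (dF b bab).
Unshelve. all: by end_near. Qed.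

Lemma substitution_cos (G : R -> R) : {within `[-1, 1], continuous G} ->
  (\int[mu]_(x in `[(-1)%R, 1%R]) (G x)%:E =
   \int[mu]_(x in `[0%R, pi]) (G (cos x) * sin x)%:E)%E.
Proof.
move=> cG; have := @substitution_decreasing cos (fun x => - sin x) G 0 pi (pi_ge0 R).
rewrite cos0 cospi => -> //.
- by apply: eq_integral => x _; rewrite opprK.
- by move=> x y x0 y0; rewrite ltr_cos.
- by move=> x _; apply: cvgN; exact: continuous_sin.
Qed.

End Substitution.

Section AbsCos.
Context {R : realType}.
Notation mu := (@lebesgue_measure R).

(** If [B <= |A|], the affine function keeps its sign and the integral is [2 |A|]. A change of sign
    adds the excess [(B - |A|)^2 / B], and at [B = 0] that quotient is 0 by the convention on
    inverses. *)
Lemma integral_abs_cos (A B : R) : 0 <= B ->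
  (\int[mu]_(x in `[0%R, pi]) (`|A + B * cos x| * sin x)%:E =
  (2 * (`|A| + Num.max (B - `|A|) 0 ^+ 2 / (2 * B)))%:E)%E.
Proof.
move=> B0.
rewrite -(@substitution_cos _ (fun t => `|A + B * t|)); last first.
  apply: continuous_within => x _; apply: cvg_norm; apply: cvgD; first exact: cvg_cst.
  by apply: cvgMr; exact: cvg_id.
move: B0; rewrite le_eqVlt => /predU1P[<-|B0].
  rewrite (eq_integral (fun=> `|A|%:E)); last by move=> t _; rewrite mul0r addr0.
  rewrite integral_cst//= lebesgue_measure_itv/= lte_fin ifT; last by lra.
  by rewrite -EFinD -EFinM mulr0 invr0 mulr0 addr0 opprK mulrC.
have cf : {within `[-1, 1], continuous (fun t : R => `|A + B * t|)}.
  apply: continuous_within => x _; apply: cvg_norm; apply: cvgD; first exact: cvg_cst.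
  by apply: cvgMr; exact: cvg_id.
have dF (t : R) : der t (fun t => ((A + B * t) * `|A + B * t|) / (2 * B)) `|A + B * t|.
  have dI : der t (fun t : R => A + B * t) (0 + (0 * t + B * 1)) by derive.
  have dn := der_comp (f := fun t : R => A + B * t) (der_mul_norm (A + B * t)) dI.
  apply: (der_eq (der_mul dn (der_cst (2 * B)^-1 t))).
  by move: `|_| => m /=; field; rewrite gt_eqF.
have cF : {within `[-1, 1], continuous (fun t => ((A + B * t) * `|A + B * t|) / (2 * B))}.
  by apply: continuous_within => t _; exact: der_continuous (dF t).
have N11 : -1 <= 1 :> R by lra.
have := ftc2 N11 cF (fun t _ => dF t) cf.
rewrite /Rintegral => H.
rewrite -[LHS]fineK; last by apply: integrable_fin_num => //; exact: continuous_integrable.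
rewrite H; congr (_%:E); rewrite mulr1 mulrN1.
have [A0|A0] := leP 0 A.
  rewrite [`|A + B|]ger0_norm ?addr_ge0 ?(ltW B0)// (ger0_norm A0).
  have [AB|AB] := leP A B.
    rewrite max_l ?subr_ge0// ler0_norm ?subr_le0//.
    by field; rewrite gt_eqF.
  rewrite max_r ?subr_le0 ?(ltW AB)// ger0_norm ?subr_ge0 ?(ltW AB)//.
  by field; rewrite gt_eqF.
rewrite (ltr0_norm A0) [`|A - B|]ler0_norm; last by lra.
have [AB|AB] := leP (- A) B.
  rewrite max_l ?subr_ge0// ger0_norm; last by lra.
  by field; rewrite gt_eqF.
rewrite max_r ?subr_le0 ?(ltW AB)// ler0_norm; last by lra.
by field; rewrite gt_eqF.
Qed.

End AbsCos.

(** * The radial integral in closed form *)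

Section RadialDeviation.
Context {R : realType}.
Notation mu := (@lebesgue_measure R).
Variable r : R.
Hypothesis r01 : 0 < r < 1.

(** The arctangent is minus the argument of [1 - r e^(i x)]; differentiating it produces the
    denominator [|1 - r e^(i x)|^2 = 1 + r^2 - 2 r cos x]. *)
Definition radial_antiderivative (x : R) :=
  (r * sin x + r ^+ 2 * (sin x * cos x) - (1 - r ^+ 2) * atan (r * sin x / (1 - r * cos x)))
    / (4 * r ^+ 3).

Lemma cos_den_gt0 (x : R) : 0 < 1 + r ^+ 2 - 2 * r * cos x.
Proof. by apply: kernel_den_gt0 => //; exact: cos_le1. Qed.

Lemma der_radial_antiderivative (x : R) : der x radial_antiderivative
  ((cos x - r / 2) * sin x ^+ 2 / (1 + r ^+ 2 - 2 * r * cos x)).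
Proof.
have [r0 r1] := andP r01; have c1 := cos_le1 x.
have d0 : 0 < 1 - r * cos x.
  have : 0 <= r * (1 - cos x) by rewrite mulr_ge0 ?subr_ge0// ltW.
  lra.
have D0 := cos_den_gt0 x.
have s2 : sin x ^+ 2 = 1 - cos x ^+ 2 by rewrite sin2cos2.
rewrite /radial_antiderivative; derive; first by rewrite gt_eqF.
have -> : 1 + (r * sin x / (1 - r * cos x)) ^+ 2 =
    (1 + r ^+ 2 - 2 * r * cos x) / (1 - r * cos x) ^+ 2.
  rewrite exprMn exprVn exprMn s2; field; by rewrite gt_eqF.
have s3 : sin x * sin x = 1 - cos x ^+ 2 by rewrite -s2.
move: (atan _) => at_ /=.
transitivity ((r * cos x + r ^+ 2 * (cos x ^+ 2 - sin x ^+ 2) -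
   (1 - r ^+ 2) * ((1 - r * cos x) ^+ 2 / (1 + r ^+ 2 - 2 * r * cos x) *
    ((r * cos x * (1 - r * cos x) - r ^+ 2 * sin x ^+ 2) / (1 - r * cos x) ^+ 2))) / (4 * r ^+ 3)).
  by field; rewrite !gt_eqF.
rewrite s2; field; by rewrite !gt_eqF.
Qed.

Lemma continuous_radial : {within `[-1, 1],
  continuous (fun t : R => Num.sqrt (1 - t ^+ 2) * `|t - r / 2| / (1 + r ^+ 2 - 2 * r * t))}.
Proof.
apply: continuous_within => t /=; rewrite in_itv/= => /andP[_ t1].
have D0 : 1 + r ^+ 2 - 2 * r * t != 0 by rewrite gt_eqF// kernel_den_gt0.
have c1 : {for t, continuous (fun t : R => (1 + r ^+ 2 - 2 * r * t)^-1)} by der_cont.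
have c2 : {for t, continuous (fun t : R => 1 - t ^+ 2)} by der_cont.
apply: cvgM; [apply: cvgM|exact: c1].
- exact: continuous_comp c2 (@sqrt_continuous _ _).
- apply: cvg_norm; apply: cvgB; [exact: cvg_id|exact: cvg_cst].
Qed.

Lemma integral_radial_deviation :
  (\int[mu]_(t in `[(-1)%R, 1%R])
     (Num.sqrt (1 - t ^+ 2) * `|t - r / 2| / (1 + r ^+ 2 - 2 * r * t))%:E =
   (pi / 8 * frakC_formula r)%:E)%E.
Proof.
have [r0 r1] := andP r01.
rewrite (substitution_cos continuous_radial).
pose g x := (cos x - r / 2) * sin x ^+ 2 / (1 + r ^+ 2 - 2 * r * cos x).
have cg : continuous g.
  move=> x; have D0 : 1 + r ^+ 2 - 2 * r * cos x != 0 by rewrite gt_eqF// cos_den_gt0.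
  by rewrite /g; der_cont.
have cag : continuous (fun x => `|g x|) by move=> x; apply: cvg_norm; exact: cg.
have iag (a b : R) : mu.-integrable `[a, b] (EFin \o (fun x => `|g x|)).
  by apply: continuous_integrable; apply: continuous_within => x _; exact: cag.
have -> : (\int[mu]_(x in `[0%R, pi])
   (Num.sqrt (1 - cos x ^+ 2) * `|cos x - r / 2| / (1 + r ^+ 2 - 2 * r * cos x) * sin x)%:E =
   \int[mu]_(x in `[0%R, pi]) (`|g x|)%:E)%E.
  apply: eq_integral => x; rewrite inE/= in_itv/= => xpi.
  have s0 : 0 <= sin x by exact: sin_ge0_pi.
  rewrite -sin2cos2 sqrtr_sqr (ger0_norm s0) /g !normrM normfV.
  rewrite (gtr0_norm (cos_den_gt0 x)) (ger0_norm s0).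
  by congr (_%:E); ring.
rewrite -[LHS]fineK; last by apply: integrable_fin_num => //; exact: iag.
rewrite -/(Rintegral mu `[0, pi] (fun x => `|g x|)); congr (_%:E).
have r2 : -1 <= r / 2 <= 1 by apply/andP; split; lra.
(* The integrand changes sign at [f0]. The antiderivative vanishes at 0 and at [pi], so the integral
   of the absolute value is twice its value at [f0], where [r sin x / (1 - r cos x)] is minus the
   argument of the arctangent in [frakC_formula]. *)
pose f0 := acos (r / 2).
have f00 : 0 <= f0 by exact: acos_ge0.
have f0pi : f0 <= pi by exact: acos_lepi.
have cf0 : cos f0 = r / 2 by rewrite acosK// in_itv.
rewrite (Rintegral_split f00 f0pi); last by apply: continuous_within => x _; exact: cag.
have Dx x : 0 < 1 + r ^+ 2 - 2 * r * cos x := cos_den_gt0 x.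
have cQ a b : {within `[a, b], continuous radial_antiderivative}.
  by apply: continuous_within => x _; exact: der_continuous (der_radial_antiderivative x).
have cg' a b : {within `[a, b], continuous g} by apply: continuous_within => x _; exact: cg.
have cNg a b : {within `[a, b], continuous (fun x => - g x)}.
  by apply: continuous_within => x _; apply: cvgN; exact: cg.
have mono x : 0 <= x <= pi -> (cos x <= r / 2) = (f0 <= x).
  move=> x0; rewrite -cf0 !leNgt ltr_cos//; by [rewrite in_itv|rewrite in_itv/= f00].
have -> : \int[mu]_(x in `[0, f0]) `|g x| = \int[mu]_(x in `[0, f0]) g x.
  apply: eq_Rintegral => x; rewrite inE/= in_itv/= => /andP[x0 xf].
  rewrite ger0_norm// mulr_ge0 ?invr_ge0 ?(ltW (Dx x))// mulr_ge0 ?sqr_ge0//.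
  rewrite subr_ge0 leNgt; apply/negP => xr.
  have := mono x; rewrite x0 (le_trans xf f0pi) (ltW xr) => /(_ isT)/esym fx.
  have xE : x = f0 by apply/le_anti; rewrite xf fx.
  by move: xr; rewrite xE cf0 ltxx.
have -> : \int[mu]_(x in `[f0, pi]) `|g x| = \int[mu]_(x in `[f0, pi]) (- g x).
  apply: eq_Rintegral => x; rewrite inE/= in_itv/= => /andP[fx xpi].
  rewrite ler0_norm// mulr_le0_ge0 ?invr_ge0 ?(ltW (Dx x))// mulr_le0_ge0 ?sqr_ge0//.
  by rewrite subr_le0 mono// (le_trans f00 fx).
have dN (x : R) : der x (fun x => - radial_antiderivative x) (- g x).
  exact: der_opp (der_radial_antiderivative x).
have cNQ a b : {within `[a, b], continuous (fun x => - radial_antiderivative x)}.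
  by apply: continuous_within => x _; exact: der_continuous (dN x).
rewrite (ftc2 f00 (cQ 0 f0) (fun x _ => der_radial_antiderivative x) (cg' 0 f0)).
rewrite (ftc2 f0pi (cNQ f0 pi) (fun x _ => dN x) (cNg f0 pi)).
have sf0 : sin f0 = Num.sqrt (4 - r ^+ 2) / 2.
  rewrite sin_acos//.
  have -> : 1 - (r / 2) ^+ 2 = (4 - r ^+ 2) / 2 ^+ 2 by field.
  have p4 : 0 <= 4 - r ^+ 2 by have : r ^+ 2 < 1 by [rewrite expr_lt1// ltW]; lra.
  by rewrite sqrtrM// sqrtrV// sqrtr_sqr ger0_norm.
rewrite /radial_antiderivative sin0 sinpi !(mulr0, mul0r, atan0, subr0, addr0, subrr).
rewrite cf0 sf0 /frakC_formula.
have -> : r * (Num.sqrt (4 - r ^+ 2) / 2) / (1 - r * (r / 2)) =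
   - (r * Num.sqrt (4 - r ^+ 2) / (- 2 + r ^+ 2)).
  have r1' : r ^+ 2 < 1 by rewrite expr_lt1// ltW.
  by field; rewrite -expr2 lt_eqF ?gt_eqF//; lra.
rewrite atanN; set q := Num.sqrt _; move: (atan _) => at_; move: q => q.
move: (pi_gt0 R); move: (@pi R) => p p0.
by field; rewrite !gt_eqF.
Qed.

End RadialDeviation.

(** * The integral over the polar angle and the Moebius substitution *)

Section DirectionalIntegral.
Context {R : realType}.
Notation mu := (@lebesgue_measure R).
Implicit Types r l t x : R.

(** What remains of [|l . grad P|] times the density of the sphere after averaging over the two
    other angles, up to the factor [4 / pi] of [frame_kernel_expectation]. The number
    [r (3 - r^2) / 2] is the cosine of the angle at which the radial derivative of the Poisson
    kernel changes sign. *)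
Definition polar_density r l1 l2 x :=
  sin x ^+ 2 / (1 + r ^+ 2 - 2 * r * cos x) ^+ 3 *
  (2 * (`|l1 * (cos x - r * (3 - r ^+ 2) / 2)| +
    Num.max ((1 - r ^+ 2) * l2 * sin x - `|l1 * (cos x - r * (3 - r ^+ 2) / 2)|) 0 ^+ 2 /
      (2 * ((1 - r ^+ 2) * l2 * sin x)))).

(** The same integrand in the variable [t = cos x]. One factor [sin x] is spent on [dt]; in the
    second term the other one cancels against the denominator. *)
Definition height_density r l1 l2 t :=
  (1 + r ^+ 2 - 2 * r * t)^-1 ^+ 3 *
  (2 * (Num.sqrt (1 - t ^+ 2) * `|l1 * (t - r * (3 - r ^+ 2) / 2)| +
    Num.max ((1 - r ^+ 2) * l2 * Num.sqrt (1 - t ^+ 2) - `|l1 * (t - r * (3 - r ^+ 2) / 2)|) 0 ^+ 2 /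
      (2 * ((1 - r ^+ 2) * l2)))).

Lemma continuous_height_density r l1 l2 : 0 < r < 1 ->
  {within `[-1, 1], continuous (height_density r l1 l2)}.
Proof.
move=> r01; apply: continuous_within => t /=; rewrite in_itv/= => /andP[_ t1].
have D0 : 1 + r ^+ 2 - 2 * r * t != 0 by rewrite gt_eqF// kernel_den_gt0.
have c1 : {for t, continuous (fun t : R => (1 + r ^+ 2 - 2 * r * t)^-1 ^+ 3)} by der_cont.
have c2 : {for t, continuous (fun t : R => 1 - t ^+ 2)} by der_cont.
have c3 : {for t, continuous (fun t : R => Num.sqrt (1 - t ^+ 2))}.
  exact: continuous_comp c2 (@sqrt_continuous _ _).
have c4 : {for t, continuous (fun t : R => `|l1 * (t - r * (3 - r ^+ 2) / 2)|)}.
  have c : {for t, continuous (fun t : R => l1 * (t - r * (3 - r ^+ 2) / 2))} by der_cont.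
  exact: cvg_norm.
have maxE (x : R) : Num.max x 0 = (x + `|x|) / 2.
  by case: (leP 0 x) => x0; [rewrite ger0_norm//|rewrite ltr0_norm//]; field.
pose f t := (1 - r ^+ 2) * l2 * Num.sqrt (1 - t ^+ 2) - `|l1 * (t - r * (3 - r ^+ 2) / 2)|.
have cf : {for t, continuous f} by apply: cvgB => //; exact: cvgMr.
have c5 : {for t, continuous (fun t : R => Num.max (f t) 0)}.
  rewrite (_ : (fun t => Num.max (f t) 0) = fun t => (f t + `|f t|) / 2).
    by apply: cvgMl; apply: cvgD => //; exact: cvg_norm.
  by apply/funext => z; rewrite maxE.
have c6 : {for t, continuous (fun t : R => Num.max (f t) 0 ^+ 2)}.
  exact: continuous_comp c5 (@exprn_continuous R 2 _).
apply: cvgM; first exact: c1.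
by apply: cvgMr; apply: cvgD; [exact: cvgM c3 c4|exact: cvgMl].
Qed.

Lemma integral_polar_density r l1 l2 : 0 < r < 1 ->
  (\int[mu]_(x in `[0%R, pi]) (polar_density r l1 l2 x)%:E =
   \int[mu]_(t in `[(-1)%R, 1%R]) (height_density r l1 l2 t)%:E)%E.
Proof.
move=> r01; rewrite (substitution_cos (@continuous_height_density r l1 l2 r01)).
apply: eq_integral => x; rewrite inE/= in_itv/= => xpi; congr (_%:E).
have s0 : 0 <= sin x by exact: sin_ge0_pi.
rewrite /height_density /polar_density -sin2cos2 sqrtr_sqr (ger0_norm s0) exprVn.
move: (`|l1 * _|) (_ ^+ 3) => A D.
move: s0; rewrite le_eqVlt => /predU1P[<-|s0]; first by rewrite expr0n/= !mul0r mulr0.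
(* In the degenerate case both quotients are 0 by the convention on inverses. *)
have [->|l0] := eqVneq ((1 - r ^+ 2) * l2) 0.
  by rewrite !(mul0r, mulr0, invr0, addr0); ring.
have -> : 2 * ((1 - r ^+ 2) * l2 * sin x) = (2 * ((1 - r ^+ 2) * l2)) * sin x by ring.
by rewrite invfM; move: (_ * l2) l0 => L L0; move: (Num.max _ _) => m; move: D^-1 => d; field; rewrite L0 gt_eqF.
Qed.

(** With [D t = 1 + r^2 - 2 r t] this is the solution of [D t * D (mobius r t) = (1 - r^2)^2], hence
    an involution; since [D] is [(1 + r)^2] at -1 and [(1 - r)^2] at 1, the end points are
    exchanged. *)
Definition mobius r t := (1 + r ^+ 2 - (1 - r ^+ 2) ^+ 2 / (1 + r ^+ 2 - 2 * r * t)) / (2 * r).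

Section Mobius.
Variable r : R.
Hypothesis r01 : 0 < r < 1.
Let r0 : 0 < r. Proof. by case/andP: r01. Qed.
Let r1 : r < 1. Proof. by case/andP: r01. Qed.
Local Notation D t := (1 + r ^+ 2 - 2 * r * t).

Let r2 : 0 < 1 - r ^+ 2.
Proof. by rewrite subr_gt0 expr_lt1// ltW. Qed.

Lemma der_mobius t : t <= 1 -> der t (mobius r) (- ((1 - r ^+ 2) ^+ 2 / D t ^+ 2)).
Proof.
move=> t1; have D0 := kernel_den_gt0 r01 t1.
rewrite /mobius; derive; first by rewrite gt_eqF.
by rewrite /=; field; rewrite (gt_eqF D0) (gt_eqF r0).
Qed.

Lemma mobius_decreasing : {in `[-1, 1] &, {homo mobius r : x y /~ (x < y)%R}}.
Proof.
move=> x y; rewrite !in_itv/= => /andP[x0 x1] /andP[y0 y1] yx.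
have Dx := kernel_den_gt0 r01 x1; have Dy := kernel_den_gt0 r01 y1.
rewrite /mobius ltr_pM2r ?invr_gt0 ?mulr_gt0// ltrD2l ltrN2 ltr_pM2l ?exprn_gt0//.
by rewrite ltf_pV2 ?posrE// ltrD2l ltrN2 ltr_pM2l ?mulr_gt0.
Qed.

Lemma mobiusN1 : mobius r (-1) = 1.
Proof.
rewrite /mobius; have p : 0 < 1 + r by rewrite addr_gt0.
have -> : D (-1) = (1 + r) ^+ 2 by ring.
by field; rewrite (gt_eqF p) (gt_eqF r0).
Qed.

Lemma mobius1 : mobius r 1 = -1.
Proof.
rewrite /mobius; have p : 0 < 1 - r by rewrite subr_gt0.
have -> : D 1 = (1 - r) ^+ 2 by ring.
by field; rewrite (gt_eqF p) (gt_eqF r0).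
Qed.

(** Up to powers of [1 - r^2], the factor [D^-3] turns into [D^3], each of the two terms contributes
    [D^-2] and the Jacobian another [D^-2]. A single [D^-1] is left, and the zero [r (3 - r^2) / 2]
    moves to [r / 2]. *)
Lemma height_density_mobius l1 l2 t : 0 <= l1 -> -1 <= t <= 1 ->
  height_density r l1 l2 (mobius r t) * ((1 - r ^+ 2) ^+ 2 / D t ^+ 2) =
  2 / (1 - r ^+ 2) * (l1 * (Num.sqrt (1 - t ^+ 2) * `|t - r / 2| / D t) +
    Num.max (l2 * Num.sqrt (1 - t ^+ 2) - l1 * `|t - r / 2|) 0 ^+ 2 / (2 * l2 * D t)).
Proof.
move=> l10 t11; have [_ t1] := andP t11; have D0 := kernel_den_gt0 r01 t1.
have t2 : 0 <= 1 - t ^+ 2 by rewrite one_sub_sqr_ge0.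
have DM : 1 + r ^+ 2 - 2 * r * mobius r t = (1 - r ^+ 2) ^+ 2 / D t.
  by rewrite /mobius; field; rewrite (gt_eqF D0) (gt_eqF r0).
have dM : mobius r t - r * (3 - r ^+ 2) / 2 = - ((1 - r ^+ 2) ^+ 2 / D t) * (t - r / 2).
  by rewrite /mobius; field; rewrite (gt_eqF D0) (gt_eqF r0).
have sM : Num.sqrt (1 - mobius r t ^+ 2) = (1 - r ^+ 2) / D t * Num.sqrt (1 - t ^+ 2).
  have -> : 1 - mobius r t ^+ 2 = ((1 - r ^+ 2) / D t) ^+ 2 * (1 - t ^+ 2).
    by rewrite /mobius; field; rewrite (gt_eqF D0) (gt_eqF r0).
  by rewrite sqrtrM ?sqr_ge0// sqrtr_sqr ger0_norm// divr_ge0// ltW.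
have q0 : 0 <= (1 - r ^+ 2) ^+ 2 / D t by rewrite divr_ge0 ?sqr_ge0// ltW.
rewrite /height_density DM dM sM.
rewrite !normrM normrN (ger0_norm q0) (ger0_norm l10).
set Y := `|t - r / 2|; set S := Num.sqrt (1 - t ^+ 2).
have -> : (1 - r ^+ 2) * l2 * ((1 - r ^+ 2) / D t * S) - l1 * ((1 - r ^+ 2) ^+ 2 / D t * Y) =
   (1 - r ^+ 2) ^+ 2 / D t * (l2 * S - l1 * Y) by ring.
rewrite -[X in Num.max _ X](mulr0 ((1 - r ^+ 2) ^+ 2 / D t)) -maxr_pMr//.
move: (Num.max _ 0) => m.
have [->|l20] := eqVneq l2 0.
  rewrite !(mul0r, mulr0, invr0, addr0).
  by field; rewrite (gt_eqF D0) (gt_eqF r2).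
by field; rewrite (gt_eqF D0) (gt_eqF r2) l20.
Qed.

Lemma integral_height_density l1 l2 : 0 <= l1 -> 0 <= l2 ->
  (\int[mu]_(t in `[(-1)%R, 1%R]) (height_density r l1 l2 t)%:E =
   (2 / (1 - r ^+ 2))%:E * (l1%:E * (pi / 8 * frakC_formula r)%:E +
   \int[mu]_(t in `[(-1)%R, 1%R]) (Num.max (l2 * Num.sqrt (1 - t ^+ 2) - l1 * `|t - r / 2|) 0 ^+ 2 / (2 * l2 * D t))%:E))%E.
Proof.
move=> l10 l2_ge0.
have N11 : -1 <= 1 :> R by lra.
have dM t : -1 <= t <= 1 -> der t (mobius r) (- ((1 - r ^+ 2) ^+ 2 / D t ^+ 2)).
  by move=> /andP[_]; exact: der_mobius.
have cM t : -1 <= t <= 1 -> {for t, continuous (fun t => - ((1 - r ^+ 2) ^+ 2 / D t ^+ 2))}.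
  move=> /andP[_ t1]; have D0 := kernel_den_gt0 r01 t1.
  by der_cont; rewrite expf_neq0// gt_eqF.
have cG : {within `[mobius r 1, mobius r (-1)], continuous (height_density r l1 l2)}.
  by rewrite mobius1 mobiusN1; exact: continuous_height_density.
have := substitution_decreasing N11 mobius_decreasing dM cM cG.
rewrite mobius1 mobiusN1 => ->.
have l20 t : -1 <= t <= 1 -> 0 < D t by case/andP => _; exact: kernel_den_gt0.
have i1 : (l1%:E * (pi / 8 * frakC_formula r)%:E = \int[mu]_(t in `[(-1)%R, 1%R])
    (l1 * (Num.sqrt (1 - t ^+ 2) * `|t - r / 2| / D t))%:E)%E.
  rewrite -(integral_radial_deviation r01) -ge0_integralZl//=.
  - by apply/measurable_EFinP; apply: measurable_funTS; meas.
  - by move=> t /=; rewrite in_itv/= => /l20 D0; rewrite lee_fin !mulr_ge0 ?sqrtr_ge0// invr_ge0 ltW.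
rewrite {}i1 -ge0_integralD//=.
- rewrite -ge0_integralZl//=.
  + apply: eq_integral => t; rewrite inE/= in_itv/= => t11.
    by rewrite opprK height_density_mobius// -EFinD -EFinM.
  + by apply/measurable_EFinP; apply: measurable_funTS; meas.
  + move=> t /=; rewrite in_itv/= => /l20 D0; rewrite -EFinD lee_fin addr_ge0//.
      by rewrite !mulr_ge0 ?sqrtr_ge0// invr_ge0 ltW.
    by rewrite divr_ge0 ?sqr_ge0// !mulr_ge0// ltW.
  + by rewrite lee_fin divr_ge0// ltW.
- by move=> t /=; rewrite in_itv/= => /l20 D0; rewrite lee_fin !mulr_ge0 ?sqrtr_ge0// invr_ge0 ltW.
- by apply/measurable_EFinP; apply: measurable_funTS; meas.
- move=> t /=; rewrite in_itv/= => /l20 D0; by rewrite lee_fin divr_ge0 ?sqr_ge0// !mulr_ge0// ltW.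
- by apply/measurable_EFinP; apply: measurable_funTS; meas.
Qed.

End Mobius.

(** After the substitution the radial integral enters with the weight [l1], and [mean_deviation_le]
    bounds the remaining term by [1 - l1] times the radial integral. *)
Lemma polar_density_le r l1 l2 : 0 < r < 1 -> 0 <= l1 -> 0 <= l2 -> l1 ^+ 2 + l2 ^+ 2 = 1 ->
  (\int[mu]_(x in `[0%R, pi]) (polar_density r l1 l2 x)%:E <=
   (pi / 4 * (frakC_formula r / (1 - r ^+ 2)))%:E)%E.
Proof.
move=> r01 l10 l20 l12; have [r0 r1] := andP r01.
have r2 : 0 < 1 - r ^+ 2 by rewrite subr_gt0 expr_lt1// ltW.
rewrite integral_polar_density// integral_height_density//.
have -> : pi / 4 * (frakC_formula r / (1 - r ^+ 2)) = 2 / (1 - r ^+ 2) * (pi / 8 * frakC_formula r).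
  by move: (@pi R) (frakC_formula r) => p c; field; rewrite gt_eqF.
rewrite [in leRHS]EFinM; apply: lee_wpmul2l; first by rewrite lee_fin divr_ge0// ltW.
have cE : (pi / 8 * frakC_formula r)%:E = (l1%:E * (pi / 8 * frakC_formula r)%:E + (1 - l1)%:E * (pi / 8 * frakC_formula r)%:E)%E.
  by rewrite -!EFinM -EFinD -mulrDl; congr (_%:E); ring.
rewrite [leRHS]cE; apply: leeD2l.
(* For [l2 = 0] the integrand has denominator 0 and vanishes by convention, while [l1 = 1] makes the
   right-hand side 0. *)
move: l20; rewrite le_eqVlt => /predU1P[l20|l20].
  rewrite -l20; under eq_integral do rewrite mulr0 mul0r invr0 mulr0.
  have l11 : l1 = 1.
    by apply/eqP; rewrite -(@eqrXn2 _ 2)//; move: l12; rewrite -l20 expr0n/= addr0 expr1n => ->.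
  by rewrite integral0 l11 subrr mul0e.
apply: le_trans (mean_deviation_le r01 l10 l20 l12) _.
rewrite -(integral_radial_deviation r01) -ge0_integralZl//=.
- by apply/measurable_EFinP; apply: measurable_funTS; meas.
- move=> t /=; rewrite in_itv/= => /andP[_ t1]; have D0 := kernel_den_gt0 r01 t1.
  by rewrite lee_fin !mulr_ge0 ?sqrtr_ge0// invr_ge0 ltW.
- rewrite lee_fin subr_ge0 -(@expr_le1 _ 2)//; have := sqr_ge0 l2; lra.
Qed.

Lemma polar_density_radial r : 0 < r < 1 ->
  (\int[mu]_(x in `[0%R, pi]) (polar_density r 1 0 x)%:E =
   (pi / 4 * (frakC_formula r / (1 - r ^+ 2)))%:E)%E.
Proof.
move=> r01; have [r0 r1] := andP r01.
have r2 : 0 < 1 - r ^+ 2 by rewrite subr_gt0 expr_lt1// ltW.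
rewrite integral_polar_density// integral_height_density//.
under eq_integral do rewrite mulr0 mul0r invr0 mulr0.
rewrite integral0 adde0 mul1e -EFinM; congr (_%:E).
by move: (@pi R) (frakC_formula r) => p c; field; rewrite gt_eqF.
Qed.

Lemma polar_density_center :
  (\int[mu]_(x in `[0%R, pi]) (polar_density 0 1 0 x)%:E = (4 / 3)%:E)%E.
Proof.
transitivity (\int[mu]_(x in `[0%R, pi]) (2 * (`|cos x| * sin x ^+ 2))%:E)%E.
  apply: eq_integral => x _; rewrite /polar_density; congr (_%:E).
  by rewrite !(mulr0, mul0r, invr0, addr0, expr0n, subr0, mul1r)/= ?(addr0, subr0, expr1n, invr1, mul1r, mulr1); ring.
have cc (a b : R) : {within `[a, b], continuous (fun x : R => 2 * (`|cos x| * sin x ^+ 2))}.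
  apply: continuous_within => x _; apply: cvgMr; apply: cvgM.
    by apply: cvg_norm; exact: continuous_cos.
  exact: continuous_comp (@continuous_sin _ x) (@exprn_continuous R 2 _).
rewrite -[LHS]fineK; last by apply: integrable_fin_num => //; exact: continuous_integrable.
rewrite -/(Rintegral mu `[0, pi] (fun x => 2 * (`|cos x| * sin x ^+ 2))); congr (_%:E).
have p2 : 0 <= pi / 2 :> R by rewrite divr_ge0// pi_ge0.
have p2' : pi / 2 <= pi :> R by have := pi_ge0 R; lra.
rewrite (Rintegral_split p2 p2')//.
have d1 (x : R) : der x (fun x => 2 / 3 * sin x ^+ 3) (2 * (cos x * sin x ^+ 2)).
  by derive; rewrite /=; field.
have d2 (x : R) : der x (fun x => - (2 / 3 * sin x ^+ 3)) (2 * (- cos x * sin x ^+ 2)).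
  by derive; rewrite /=; field.
have -> : \int[mu]_(x in `[0, pi / 2]) (2 * (`|cos x| * sin x ^+ 2)) =
   \int[mu]_(x in `[0, pi / 2]) (2 * (cos x * sin x ^+ 2)).
  apply: eq_Rintegral => x; rewrite inE/= in_itv/= => /andP[x0 xp].
  by rewrite ger0_norm// cos_ge0_pihalf// xp andbT; have := pi_ge0 R; lra.
have -> : \int[mu]_(x in `[pi / 2, pi]) (2 * (`|cos x| * sin x ^+ 2)) =
   \int[mu]_(x in `[pi / 2, pi]) (2 * (- cos x * sin x ^+ 2)).
  apply: eq_Rintegral => x; rewrite inE/= in_itv/= => /andP[x0 xp].
  rewrite ler0_norm// -oppr_ge0 -[x](subrK pi) cosDpi opprK cos_ge0_pihalf//.
  by have p0 := pi_ge0 R; apply/andP; split; lra.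
have c1 (a b : R) : {within `[a, b], continuous (fun x => 2 * (cos x * sin x ^+ 2))}.
  by apply: continuous_within => x _; der_cont.
have c2 (a b : R) : {within `[a, b], continuous (fun x => 2 * (- cos x * sin x ^+ 2))}.
  by apply: continuous_within => x _; der_cont.
have c3 (a b : R) : {within `[a, b], continuous (fun x => 2 / 3 * sin x ^+ 3)}.
  by apply: continuous_within => x _; exact: der_continuous (d1 x).
have c4 (a b : R) : {within `[a, b], continuous (fun x => - (2 / 3 * sin x ^+ 3))}.
  by apply: continuous_within => x _; exact: der_continuous (d2 x).
rewrite (ftc2 p2 (c3 _ _) (fun x _ => d1 x) (c1 _ _)).
rewrite (ftc2 p2' (c4 _ _) (fun x _ => d2 x) (c2 _ _)).
by rewrite sin0 sinpi sin_pihalf expr0n/= expr1n; field.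
Qed.

End DirectionalIntegral.

(** * The Poisson integral *)

Section Directional.
Context {R : realType} {V : normedModType R}.
Implicit Types (f : V -> R) (y v : V) (t a : R).

Lemma directional_quotient f y v t : 
  (fun h : R => h^-1 *: (f (h *: v + (t *: v + y)) - f (t *: v + y))) =
  (fun h : R => h^-1 *: (f ((h *: (1 : R) + t) *: v + y) - f (t *: v + y))).
Proof.
apply/funext => h; have -> : h *: (1 : R) = h by exact: mulr1.
by rewrite scalerDl addrA.
Qed.

Lemma is_derive_line f y v t a :
  is_derive (t *: v + y) v f a <-> der t (fun s => f (s *: v + y)) a.
Proof.
split=> -[fd fa].
- apply: DeriveDef; first by rewrite /derivable /= -directional_quotient; exact: fd.
  by rewrite -fa /derive /= -directional_quotient.
- apply: DeriveDef; first by move: fd; rewrite /derivable /= -directional_quotient.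
  by rewrite -fa /derive /= -directional_quotient.
Qed.

Lemma is_derive_line0 f y v a : is_derive y v f a <-> der (0 : R) (fun s => f (s *: v + y)) a.
Proof. by rewrite -is_derive_line scale0r add0r. Qed.

(** Dominated convergence speaks of sequences; this is the passage from it to continuity at a
    point. *)
Lemma seq_continuous f y : (forall u : nat -> V, u n @[n --> \oo] --> y ->
  f (u n) @[n --> \oo] --> f y) -> {for y, continuous f}.
Proof.
move=> H; apply/cvgrPdist_lt => e e0; apply: contrapT => Hn.
have P n : exists z, `|y - z| < n.+1%:R^-1 /\ e <= `|f y - f z|.
  apply: contrapT => Hz; apply: Hn.
  apply/nbhs_normP; exists n.+1%:R^-1; first by rewrite /= invr_gt0.
  move=> z yz; rewrite /= ltNge; apply/negP => fz; apply: Hz; by exists z.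
have [u uP] := choice P.
have uy : u n @[n --> \oo] --> y.
  apply/cvgrPdist_lt => d d0; near=> n; apply: lt_trans (proj1 (uP n)) _.
  by near: n; exact: near_infty_natSinv_lt (PosNum d0).
have /cvgrPdist_lt/(_ _ e0)[N _ HN] := H u uy.
by have := HN N (leqnn N); rewrite ltNge (proj2 (uP N)).
Unshelve. all: by end_near. Qed.

End Directional.

(** * Continuity and differentiation under the integral sign *)

Section Expectation.
Context {R : realType} d (T : measurableType d) (P : probability T R) {V : normedModType R}.
Local Notation E f := (\int[P]_w f w).
Implicit Types (f g : T -> R) (k dk : V -> T -> R) (y v z : V) (e M t : R) (w : T).

Lemma bounded_integrable f M : measurable_fun [set: T] f -> (forall w, `|f w| <= M) ->
  P.-integrable [set: T] (EFin \o f).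
Proof.
move=> mf fM; apply: measurable_bounded_integrable => //.
  by apply: le_lt_trans (probability_le1 P _) _ => //; exact: ltry.
exists M; split; first exact: num_real.
by move=> x Mx w _; apply: le_trans (fM w) _; exact: ltW.
Qed.

Lemma expectation_cst (a : R) : E (fun=> a) = a.
Proof.
rewrite Rintegral_cst//; have P1 : P [set: T] = 1%E := probability_setT P.
by transitivity (a * fine (1%E : \bar R)); [rewrite -P1|rewrite /= mulr1].
Qed.

Lemma continuous_expectation k y e M : 0 < e ->
  (forall z, `|z - y| < e -> measurable_fun [set: T] (k z)) ->
  (forall z w, `|z - y| < e -> `|k z w| <= M) ->
  (forall w, {for y, continuous (fun z => k z w)}) ->
  {for y, continuous (fun z => E (k z))}.
Proof.
move=> e0 mk kM ck; apply: seq_continuous => u uy.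
have [N _ HN] : \forall n \near \oo, `|u n - y| < e.
  by move/cvgrPdist_lt : uy => /(_ _ e0); apply: filterS => n; rewrite distrC.
(* Only from the index [N] on does the sequence stay in the ball where the bounds hold. *)
rewrite -(cvg_shiftn N); apply: fine_cvg.
rewrite fineK; last first.
  apply: integrable_fin_num => //; apply: (@bounded_integrable _ M).
    by apply: mk; rewrite subrr normr0.
  by move=> w; apply: kM; rewrite subrr normr0.
have uN n : `|u (n + N)%N - y| < e by apply: HN; exact: leq_addl.
apply: (@dominated_cvg _ _ _ P _ _ (fun n w => (k (u (n + N)%N) w)%:E) (fun w => (k y w)%:E) (cst M%:E)) => //.
- by move=> n; apply/measurable_EFinP; exact: mk.
- move=> w _; apply: cvg_EFin; first exact: nearW.
  rewrite (cvg_shiftn N (fun n => k (u n) w)).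
  exact: (cvg_comp _ _ uy (ck w)).
- exact: finite_measure_integrable_cst.
- by move=> n w _; rewrite lee_fin; exact: kM.
Qed.

(** On the line through [y] in the direction [v] this is differentiation under the integral with
    respect to one real parameter, dominated by a constant. *)
Lemma derive_expectation k dk y v e M : 0 < e ->
  (forall t, `|t| < e -> measurable_fun [set: T] (k (t *: v + y))) ->
  (forall t w, `|t| < e -> `|k (t *: v + y) w| <= M) ->
  (forall t w, `|t| < e -> is_derive (t *: v + y) v (fun z => k z w) (dk (t *: v + y) w)) ->
  (forall t w, `|t| < e -> `|dk (t *: v + y) w| <= M) ->
  is_derive y v (fun z => E (k z)) (E (dk y)).
Proof.
move=> e0 mk kM kd dkM.
apply/is_derive_line0.
pose f t w := k (t *: v + y) w.
have Ie t : t \in `]- e, e[ -> `|t| < e by rewrite in_itv/= ltr_norml.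
have I0 : `]- e, e[%classic (0 : R) by rewrite /= in_itv/= oppr_lt0 e0.
have intf t : `]- e, e[%classic t -> P.-integrable [set: T] (EFin \o f t).
  by move=> /Ie te; apply: (@bounded_integrable _ M); [exact: mk|move=> w; exact: kM].
have df t w : `|t| < e -> der t (f^~ w) (dk (t *: v + y) w).
  by move=> te; exact: (is_derive_line (fun z => k z w) y v t _).1 (kd t w te).
have derf1 t w : `]- e, e[%classic t -> [set: T] w -> derivable (f^~ w) t 1.
  by move=> /Ie te _; have [] := df t w te.
have pE t w : `|t| < e -> partial1of2 f t w = dk (t *: v + y) w.
  by move=> te; rewrite partial1of2E; have [_ ->] := df t w te.
have G_ub t w : `]- e, e[%classic t -> [set: T] w -> `|partial1of2 f t w| <= `|M|.
  by move=> /Ie te _; rewrite pE//; apply: le_trans (dkM _ _ te) (ler_norm M).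
have iM : P.-integrable [set: T] (EFin \o cst `|M|) by exact: finite_measure_integrable_cst.
have := @cvg_differentiation_under_integral R d T P f setT measurableT 0 (- e) e I0
  intf derf1 (cst `|M|) (fun=> normr_ge0 M) iM G_ub.
move=> H; apply: der_lim.
have -> : E (dk y) = \int[P]_w partial1of2 f 0 w.
  by apply: eq_Rintegral => w _; rewrite pE ?normr0// scale0r add0r.
exact: H.
Qed.

End Expectation.

Section Continuity.
Context {R : realType} {X : topologicalType}.
Implicit Types (f g : X -> R) (x : X).

Lemma cont_cst (a : R) x : {for x, continuous (fun _ : X => a)}.
Proof. exact: cvg_cst. Qed.
Lemma cont_add f g x : {for x, continuous f} -> {for x, continuous g} ->
  {for x, continuous (fun z => f z + g z)}.
Proof. by move=> cf cg; exact: cvgD. Qed.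
Lemma cont_opp f x : {for x, continuous f} -> {for x, continuous (fun z => - f z)}.
Proof. by move=> cf; exact: cvgN. Qed.
Lemma cont_mul f g x : {for x, continuous f} -> {for x, continuous g} ->
  {for x, continuous (fun z => f z * g z)}.
Proof. by move=> cf cg; exact: cvgM. Qed.
Lemma cont_inv f x : f x != 0 -> {for x, continuous f} ->
  {for x, continuous (fun z => (f z)^-1)}.
Proof. by move=> f0 cf; exact: cvgV. Qed.
Lemma cont_exp f n x : {for x, continuous f} -> {for x, continuous (fun z => f z ^+ n)}.
Proof. by move=> cf; exact: continuous_comp cf (@exprn_continuous R n _). Qed.
Lemma cont_norm f x : {for x, continuous f} -> {for x, continuous (fun z => `|f z|)}.
Proof. by move=> cf; exact: cvg_norm. Qed.
Lemma cont_sqrt f x : {for x, continuous f} -> {for x, continuous (fun z => Num.sqrt (f z))}.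
Proof. by move=> cf; exact: continuous_comp cf (@sqrt_continuous _ _). Qed.

Lemma cont_sum I (s : seq I) (F : I -> X -> R) x :
  (forall i, {for x, continuous (F i)}) -> {for x, continuous (fun z => \sum_(i <- s) F i z)}.
Proof.
move=> cF; elim: s => [|i s IH].
  by rewrite (_ : (fun z => _) = fun=> 0); [exact: cvg_cst|apply/funext => z; rewrite big_nil].
rewrite (_ : (fun z => _) = fun z => F i z + \sum_(j <- s) F j z).
  exact: cont_add.
by apply/funext => z; rewrite big_cons.
Qed.

Lemma continuous_near_eq g h (y : X) : (\forall z \near y, g z = h z) ->
  {for y, continuous g} -> {for y, continuous h}.
Proof.
move=> gh cg; have gy : h y = g y by rewrite (nbhs_singleton gh).
suff : h z @[z --> y] --> g y by rewrite -gy.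
exact: cvg_trans (near_eq_cvg gh) cg.
Qed.

End Continuity.

Ltac cont_step :=
  lazymatch goal with
  | |- {for _, continuous (fun _ => ?c)} => exact: cont_cst
  | |- {for _, continuous (fun y => @?f y + @?g y)} => simple notypeclasses refine (cont_add (f := f) (g := g) _ _); cbv beta
  | |- {for _, continuous (fun y => - @?f y)} => simple notypeclasses refine (cont_opp (f := f) _); cbv beta
  | |- {for _, continuous (fun y => @?f y * @?g y)} => simple notypeclasses refine (cont_mul (f := f) (g := g) _ _); cbv beta
  | |- {for _, continuous (fun y => (@?f y)^-1)} => simple notypeclasses refine (cont_inv (f := f) _ _); cbv beta
  | |- {for _, continuous (fun y => (@?f y) ^+ ?n)} => simple notypeclasses refine (cont_exp (f := f) (n := n) _); cbv beta
  | |- {for _, continuous (fun y => `|@?f y|)} => simple notypeclasses refine (cont_norm (f := f) _); cbv beta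
  | |- {for _, continuous (fun y => Num.sqrt (@?f y))} => simple notypeclasses refine (cont_sqrt (f := f) _); cbv beta
  | |- {for _, continuous _} => solve [eauto]
  end.
Ltac cont := repeat cont_step.

Section Bounded.
Context {R : realType} {X : Type} (A : set X).
Implicit Types f g : X -> R.

Definition bounded_fun f := exists M, forall x, A x -> `|f x| <= M.

Lemma bd_cst (a : R) : bounded_fun (fun=> a).
Proof. by exists `|a|. Qed.
Lemma bd_add f g : bounded_fun f -> bounded_fun g -> bounded_fun (fun x => f x + g x).
Proof.
move=> [M fM] [N gN]; exists (M + N) => x Ax.
by apply: le_trans (ler_normD _ _) _; rewrite lerD ?fM ?gN.
Qed.
Lemma bd_opp f : bounded_fun f -> bounded_fun (fun x => - f x).
Proof. by move=> [M fM]; exists M => x Ax; rewrite normrN fM. Qed.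
Lemma bd_mul f g : bounded_fun f -> bounded_fun g -> bounded_fun (fun x => f x * g x).
Proof.
move=> [M fM] [N gN]; exists (M * N) => x Ax.
by rewrite normrM ler_pM ?fM ?gN.
Qed.
Lemma bd_exp f n : bounded_fun f -> bounded_fun (fun x => f x ^+ n).
Proof.
move=> fb; elim: n => [|n IH]; first exact: bd_cst.
rewrite (_ : (fun x => _) = fun x => f x * f x ^+ n); first exact: bd_mul.
by apply/funext => x; rewrite exprS.
Qed.

End Bounded.

Ltac bd_step :=
  lazymatch goal with
  | |- bounded_fun _ (fun _ => ?c) => exact: bd_cst
  | |- bounded_fun _ (fun y => @?f y + @?g y) => simple notypeclasses refine (bd_add (f := f) (g := g) _ _); cbv beta
  | |- bounded_fun _ (fun y => - @?f y) => simple notypeclasses refine (bd_opp (f := f) _); cbv beta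
  | |- bounded_fun _ (fun y => @?f y * @?g y) => simple notypeclasses refine (bd_mul (f := f) (g := g) _ _); cbv beta
  | |- bounded_fun _ (fun y => (@?f y) ^+ ?n) => simple notypeclasses refine (bd_exp (f := f) n _); cbv beta
  | |- bounded_fun _ _ => solve [eauto]
  end.
Ltac bd := repeat bd_step.

Section Euclidean.
Context {R : realType} {n : nat}.
Local Notation V := ('rV[R]_n.+1).
Implicit Types x y z u : V.

Definition dot x y : R := \sum_i x 0 i * y 0 i.
Local Notation sqn y := (dot y y).

Lemma dotC x y : dot x y = dot y x.
Proof. by apply: eq_bigr => i _; rewrite mulrC. Qed.
Lemma dotDl x y z : dot (x + y) z = dot x z + dot y z.
Proof. by rewrite -big_split; apply: eq_bigr => i _; rewrite !mxE mulrDl. Qed.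
Lemma dotDr x y z : dot x (y + z) = dot x y + dot x z.
Proof. by rewrite dotC dotDl !(dotC x). Qed.
Lemma dotZl a x y : dot (a *: x) y = a * dot x y.
Proof. by rewrite mulr_sumr; apply: eq_bigr => i _; rewrite !mxE mulrA. Qed.
Lemma dotZr a x y : dot x (a *: y) = a * dot x y.
Proof. by rewrite dotC dotZl dotC. Qed.
Lemma dotNl x y : dot (- x) y = - dot x y.
Proof. by rewrite -scaleN1r dotZl mulN1r. Qed.
Lemma dotNr x y : dot x (- y) = - dot x y.
Proof. by rewrite dotC dotNl dotC. Qed.
Lemma dot0l x : dot 0 x = 0.
Proof. by rewrite -(scale0r x) dotZl mul0r. Qed.
Lemma sqn_ge0 x : 0 <= sqn x.
Proof. by apply: sumr_ge0 => i _; rewrite -expr2 sqr_ge0. Qed.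
Lemma sqn_eq0 x : (sqn x == 0) = (x == 0).
Proof.
apply/eqP/eqP => [x0|->]; last exact: dot0l.
apply/rowP => i; rewrite mxE; apply/eqP; rewrite -sqrf_eq0 expr2; apply/eqP.
by move/eqP: x0; rewrite psumr_eq0 => [/allP/(_ i)|j _]; [rewrite mem_index_enum => /(_ isT)/eqP|rewrite -expr2 sqr_ge0].
Qed.
Lemma euclidean_normE x : euclidean_norm x = Num.sqrt (sqn x).
Proof. by congr Num.sqrt; apply: eq_bigr => i _; rewrite expr2. Qed.
Lemma euclidean_norm_sqr x : euclidean_norm x ^+ 2 = sqn x.
Proof. by rewrite euclidean_normE sqr_sqrtr// sqn_ge0. Qed.
Lemma euclidean_norm_ge0 x : 0 <= euclidean_norm x.
Proof. exact: sqrtr_ge0. Qed.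
Lemma unit_ballE x : unit_ball x <-> sqn x < 1.
Proof.
rewrite /unit_ball /= -euclidean_norm_sqr; split => h.
  by rewrite expr_lt1// euclidean_norm_ge0.
by rewrite -(@expr_lt1 _ 2)// euclidean_norm_ge0.
Qed.

Lemma sqnB x y : sqn (x - y) = sqn x + sqn y - 2 * dot x y.
Proof. by rewrite dotDl !dotDr !dotNl !dotNr (dotC y x); ring. Qed.

Lemma cauchy_schwarz x y : dot x y ^+ 2 <= sqn x * sqn y.
Proof.
have [->|y0] := eqVneq y 0; first by rewrite dotC dot0l expr0n/= dot0l mulr0.
have sy : 0 < sqn y by rewrite lt_neqAle sqn_ge0 eq_sym sqn_eq0 y0.
have := sqn_ge0 (sqn y *: x - dot x y *: y).
rewrite sqnB !(dotZl, dotZr).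
have -> : sqn y * (sqn y * sqn x) + dot x y * (dot x y * sqn y) -
  2 * (sqn y * (dot x y * dot x y)) = sqn y * (sqn x * sqn y - dot x y ^+ 2) by ring.
by rewrite pmulr_rge0// subr_ge0.
Qed.

Lemma coord_sqr_le x i : x 0 i ^+ 2 <= sqn x.
Proof.
rewrite /dot (bigD1 i)//= -expr2 lerDl; apply: sumr_ge0 => j _.
by rewrite -expr2 sqr_ge0.
Qed.

Lemma continuous_coord i x : {for x, continuous (fun y : V => y 0 i)}.
Proof. exact: coord_continuous. Qed.

Lemma continuous_dot u x : {for x, continuous (fun y => dot y u)}.
Proof.
apply: cont_sum => i; have c := @continuous_coord i x; cont.
Qed.

Lemma continuous_sqn x : {for x, continuous (fun y => sqn y)}.
Proof.
apply: cont_sum => i; have c := @continuous_coord i x; cont.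
Qed.

Lemma near_sqn_lt x b : sqn x < b -> \forall y \near x, sqn y < b.
Proof. move=> xb; have := @continuous_sqn x; by move/cvgr_lt; apply. Qed.

Lemma continuous_line v x t : {for t, continuous (fun s : R => s *: v + x)}.
Proof. by apply: cvgD; [apply: cvgZr_tmp; exact: cvg_id|exact: cvg_cst]. Qed.

Lemma near_line v x (P : V -> Prop) : (\forall y \near x, P y) ->
  exists2 e, 0 < e & forall t : R, `|t| < e -> P (t *: v + x).
Proof.
move=> nP; have : \forall t \near (0 : R), P (t *: v + x).
  by apply: (@continuous_line v x 0); rewrite scale0r add0r.
move=> /nbhs_ballP[e /= e0 He]; exists e => // t te; apply: He.
by rewrite /ball/= sub0r normrN.
Qed.

Lemma der_coord i j x : der (0 : R) (fun s => (s *: delta_mx 0 i + x) 0 j) ((i == j)%:R : R).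
Proof.
rewrite (_ : (fun s => _) = fun s => s * (i == j)%:R + x 0 j).
  by derive; rewrite mul1r mulr0 !addr0.
by apply/funext => s; rewrite !mxE eqxx/= eq_sym.
Qed.

Lemma der_dot i u x : der (0 : R) (fun s => dot (s *: delta_mx 0 i + x) u) (u 0 i).
Proof.
rewrite (_ : (fun s => _) = fun s => s * u 0 i + dot x u).
  by derive; rewrite mul1r mulr0 !addr0.
apply/funext => s; rewrite dotDl dotZl; congr (_ * _ + _).
rewrite /dot (bigD1 i)//= !mxE !eqxx mul1r big1 ?addr0// => j ji.
by rewrite mxE (negbTE ji) andbF mul0r.
Qed.

Lemma der_sqn i x : der (0 : R) (fun s => sqn (s *: delta_mx 0 i + x)) (2 * x 0 i).
Proof.
have E : dot (delta_mx 0 i) (delta_mx 0 i : V) = 1.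
  rewrite /dot (bigD1 i)//= !mxE !eqxx mul1r big1 ?addr0// => j ji.
  by rewrite mxE (negbTE ji) andbF mul0r.
have F : dot (delta_mx 0 i) x = x 0 i.
  rewrite /dot (bigD1 i)//= !mxE !eqxx mul1r big1 ?addr0// => j ji.
  by rewrite mxE (negbTE ji) andbF mul0r.
rewrite (_ : (fun s => _) = fun s => s ^+ 2 + 2 * s * x 0 i + sqn x).
  by derive; rewrite /=; ring.
apply/funext => s; rewrite !(dotDl, dotDr, dotZl, dotZr) E F (dotC x) F; ring.
Qed.

End Euclidean.

(** * The Poisson kernel of the ball and its derivatives *)

Section PoissonKernel.
Context {R : realType}.
Local Notation V := ('rV[R]_4).
Implicit Types (y u : V) (i j : 'I_4).
Local Notation sqn y := (dot y y).
Local Notation den y u := (1 + dot y y - 2 * dot y u).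

Definition poisson y u : R := (1 - sqn y) / den y u ^+ 2.

(** Writing everything with powers of [(den y u)^-1] lets [bd] reduce the bounds on derivatives to a
    bound on this one factor. *)
Definition poisson1 i y u : R :=
  - 2 * y 0 i * (den y u)^-1 ^+ 2 -
  4 * (1 - sqn y) * (y 0 i - u 0 i) * (den y u)^-1 ^+ 3.

Definition poisson2 i j y u : R :=
  - 2 * (i == j)%:R * (den y u)^-1 ^+ 2 +
  8 * y 0 i * (y 0 j - u 0 j) * (den y u)^-1 ^+ 3 +
  8 * y 0 j * (y 0 i - u 0 i) * (den y u)^-1 ^+ 3 -
  4 * (1 - sqn y) * (i == j)%:R * (den y u)^-1 ^+ 3 +
  24 * (1 - sqn y) * (y 0 i - u 0 i) * (y 0 j - u 0 j) * (den y u)^-1 ^+ 4.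

Lemma den_ge y u : sqn y < 1 -> sqn u = 1 -> (1 - euclidean_norm y) ^+ 2 <= den y u.
Proof.
move=> y1 u1.
have : dot y u <= euclidean_norm y.
  apply: le_trans (ler_norm _) _; rewrite -sqrtr_sqr euclidean_normE ler_wsqrtr//.
  by have := cauchy_schwarz y u; rewrite u1 mulr1.
rewrite -(euclidean_norm_sqr y); lra.
Qed.

Lemma den_dist y u : sqn u = 1 -> den y u = sqn (y - u).
Proof. by move=> u1; rewrite sqnB u1; ring. Qed.

Lemma den_gt0 y u : sqn y < 1 -> sqn u = 1 -> 0 < den y u.
Proof.
move=> y1 u1; apply: lt_le_trans (den_ge y1 u1); rewrite exprn_gt0// subr_gt0.
by rewrite -(@expr_lt1 _ 2)// ?euclidean_norm_ge0// euclidean_norm_sqr.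
Qed.

Lemma poisson_gt0 y u : sqn y < 1 -> sqn u = 1 -> 0 < poisson y u.
Proof. by move=> y1 u1; rewrite divr_gt0 ?subr_gt0// exprn_gt0// den_gt0. Qed.

Lemma is_derive_poisson i y u : sqn y < 1 -> sqn u = 1 ->
  is_derive y (delta_mx 0 i) (fun z => poisson z u) (poisson1 i y u).
Proof.
move=> y1 u1; apply/is_derive_line0; have h0 := den_gt0 y1 u1.
have d1 := der_dot i u y; have d2 := der_sqn i y.
rewrite /poisson; derive.
  by rewrite !scale0r !add0r expf_neq0// gt_eqF.
by rewrite !scale0r !add0r /poisson1 /=; field; rewrite gt_eqF.
Qed.

Lemma is_derive_poisson1 i j y u : sqn y < 1 -> sqn u = 1 ->
  is_derive y (delta_mx 0 j) (fun z => poisson1 i z u) (poisson2 i j y u).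
Proof.
move=> y1 u1; apply/is_derive_line0; have h0 := den_gt0 y1 u1.
have d1 := der_dot j u y; have d2 := der_sqn j y; have d3 := der_coord j i y.
rewrite /poisson1; derive.
- by rewrite !scale0r !add0r gt_eqF.
- by rewrite !scale0r !add0r gt_eqF.
rewrite !scale0r !add0r /poisson2 (eq_sym i j) /=; move: ((j == i)%:R) => e.
by field; rewrite gt_eqF.
Qed.

(** Only two sums occur, [den y u = sum (y_i - u_i)^2] and [|y|^2 - y . u = sum y_i (y_i - u_i)],
    besides the sum of the constants. The latter is where the number 4 of coordinates enters, and it
    matches the exponent 2 of the kernel. *)
Lemma poisson_harmonic y u : sqn y < 1 -> sqn u = 1 -> \sum_i poisson2 i i y u = 0.
Proof.
move=> y1 u1; have h0 := den_gt0 y1 u1.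
have E : \sum_i (y 0 i - u 0 i) ^+ 2 = den y u.
  rewrite den_dist//; apply: eq_bigr => i _; by rewrite !mxE expr2.
have F : \sum_i y 0 i * (y 0 i - u 0 i) = sqn y - dot y u.
  by rewrite /dot -sumrB; apply: eq_bigr => i _; rewrite mulrBr.
pose c0 := - 2 * (den y u)^-1 ^+ 2 - 4 * (1 - sqn y) * (den y u)^-1 ^+ 3.
pose c1 := 16 * (den y u)^-1 ^+ 3.
pose c2 := 24 * (1 - sqn y) * (den y u)^-1 ^+ 4.
transitivity (\sum_(i < 4) (c0 + (c1 * (y 0 i * (y 0 i - u 0 i)) + c2 * (y 0 i - u 0 i) ^+ 2))).
  by apply: eq_bigr => i _; rewrite /poisson2 eqxx/= /c0 /c1 /c2; ring.
have S (k0 k1 k2 : R) (f g : 'I_4 -> R) : \sum_i (k0 + (k1 * f i + k2 * g i)) =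
    4 * k0 + (k1 * (\sum_i f i) + k2 * (\sum_i g i)).
  by rewrite !mulr_sumr !big_split/= sumr_const card_ord mulr_natl.
rewrite S E F.
rewrite /c0 /c1 /c2.
move: h0; set v := dot y u; set s := sqn y => h0.
by field; rewrite gt_eqF.
Qed.

Lemma continuous_poisson y u : sqn y < 1 -> sqn u = 1 ->
  {for y, continuous (fun z => poisson z u)}.
Proof.
move=> y1 u1; have h0 := den_gt0 y1 u1.
have c1 := @continuous_sqn _ _ y; have c2 := @continuous_dot _ _ u y.
by rewrite /poisson; cont; rewrite expf_neq0 ?gt_eqF.
Qed.

Lemma continuous_poisson1 i y u : sqn y < 1 -> sqn u = 1 ->
  {for y, continuous (fun z => poisson1 i z u)}.
Proof.
move=> y1 u1; have h0 := den_gt0 y1 u1.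
have c1 := @continuous_sqn _ _ y; have c2 := @continuous_dot _ _ u y.
have c3 := @continuous_coord _ _ i y.
by rewrite /poisson1; cont; rewrite gt_eqF.
Qed.

Lemma continuous_poisson2 i j y u : sqn y < 1 -> sqn u = 1 ->
  {for y, continuous (fun z => poisson2 i j z u)}.
Proof.
move=> y1 u1; have h0 := den_gt0 y1 u1.
have c1 := @continuous_sqn _ _ y; have c2 := @continuous_dot _ _ u y.
have c3 := @continuous_coord _ _ i y; have c4 := @continuous_coord _ _ j y.
by rewrite /poisson2; cont; rewrite gt_eqF.
Qed.

(** The kernel and its derivatives are not bounded up to the sphere; on each of these sets with
    [b < 1] they are, and this supplies the dominating constants. *)
Definition ball_sphere (b : R) : set (V * V) := [set p | sqn p.1 <= b /\ sqn p.2 = 1].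

Section Bounds.
Variable b : R.
Hypothesis b1 : b < 1.

Let bd_coord1 i : bounded_fun (ball_sphere b) (fun p => p.1 0 i).
Proof.
exists 1 => -[y u] [/= y1 u1]; rewrite -(@expr_le1 _ 2)// real_normK ?num_real//.
exact: le_trans (coord_sqr_le _ _) (le_trans y1 (ltW b1)).
Qed.

Let bd_coord2 i : bounded_fun (ball_sphere b) (fun p => p.2 0 i).
Proof.
exists 1 => -[y u] [/= y1 u1]; rewrite -(@expr_le1 _ 2)// real_normK ?num_real//.
by rewrite -u1; exact: coord_sqr_le.
Qed.

Let bd_sqn : bounded_fun (ball_sphere b) (fun p => sqn p.1).
Proof.
exists 1 => -[y u] [/= y1 u1]; rewrite ger0_norm ?sqn_ge0//.
exact: le_trans y1 (ltW b1).
Qed.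

Let bd_den : bounded_fun (ball_sphere b) (fun p => (den p.1 p.2)^-1).
Proof.
exists ((1 - Num.sqrt b) ^- 2) => -[y u] [/= yb u1].
have y1 : sqn y < 1 := le_lt_trans yb b1.
have b0 : Num.sqrt b < 1 by rewrite -sqrtr1 ltr_sqrt.
rewrite normfV gtr0_norm ?den_gt0// lef_pV2 ?posrE ?den_gt0//; last first.
  by rewrite exprn_gt0// subr_gt0.
apply: le_trans (den_ge y1 u1); rewrite ler_pXn2r ?nnegrE ?subr_ge0 ?(ltW b0)//.
  by rewrite lerD2l lerN2 euclidean_normE ler_wsqrtr.
by rewrite -(@expr_le1 _ 2)// ?euclidean_norm_ge0// euclidean_norm_sqr ltW.
Qed.

Lemma bounded_poisson : bounded_fun (ball_sphere b) (fun p => poisson p.1 p.2).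
Proof.
rewrite (_ : (fun p => _) = fun p => (1 - sqn p.1) * (den p.1 p.2)^-1 ^+ 2); first by bd.
by apply/funext => p; rewrite /poisson exprVn.
Qed.

Lemma bounded_poisson1 i : bounded_fun (ball_sphere b) (fun p => poisson1 i p.1 p.2).
Proof. by rewrite /poisson1; have c1 := bd_coord1 i; have c2 := bd_coord2 i; bd. Qed.

Lemma bounded_poisson2 i j : bounded_fun (ball_sphere b) (fun p => poisson2 i j p.1 p.2).
Proof.
rewrite /poisson2; have c1 := bd_coord1 i; have c2 := bd_coord2 i.
by have c3 := bd_coord1 j; have c4 := bd_coord2 j; bd.
Qed.

End Bounds.

End PoissonKernel.

Section ExpectationSum.
Context {R : realType} d (T : measurableType d) (P : probability T R).

Lemma integrable_sum_seq (I : Type) (s : seq I) (F : I -> T -> R) :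
  (forall i, P.-integrable [set: T] (EFin \o F i)) ->
  P.-integrable [set: T] (EFin \o (fun w => \sum_(i <- s) F i w)).
Proof.
move=> iF; elim: s => [|i s IH].
  rewrite (_ : _ \o _ = cst 0%E); first exact: integrable0.
  by apply/funext => w; rewrite /= big_nil.
rewrite (_ : _ \o _ = (EFin \o F i) \+ (EFin \o (fun w => \sum_(j <- s) F j w))).
  exact: integrableD.
by apply/funext => w; rewrite /= big_cons.
Qed.

Lemma expectation_sum (I : Type) (s : seq I) (F : I -> T -> R) :
  (forall i, P.-integrable [set: T] (EFin \o F i)) ->
  \int[P]_w (\sum_(i <- s) F i w) = \sum_(i <- s) \int[P]_w F i w.
Proof.
move=> iF; elim: s => [|i s IH].
  by rewrite big_nil; under eq_Rintegral do rewrite big_nil; rewrite expectation_cst.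
rewrite big_cons -IH -RintegralD//; last exact: integrable_sum_seq.
by apply: eq_Rintegral => w _; rewrite big_cons.
Qed.

End ExpectationSum.

Section PoissonIntegral.
Context {R : realType} d (T : measurableType d) (P : probability T R).
Local Notation V := ('rV[R]_4).
Local Notation sqn y := (dot y y).
Local Notation E f := (\int[P]_w f w).
Variables (eta : T -> V) (f : T -> R) (M : R).
Hypothesis meta : forall i, measurable_fun [set: T] (fun w => eta w 0 i).
Hypothesis eta1 : forall w, sqn (eta w) = 1.
Hypothesis mf : measurable_fun [set: T] f.
Hypothesis fM : forall w, `|f w| <= M.
Implicit Types (y : V) (i j : 'I_4).

Lemma measurable_dot_eta y : measurable_fun [set: T] (fun w => dot y (eta w)).
Proof. by apply: measurable_sum => i; apply: meas_mul; [exact: meas_cst|exact: meta]. Qed.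

Lemma measurable_poisson y : measurable_fun [set: T] (fun w => poisson y (eta w)).
Proof. by rewrite /poisson; have m := measurable_dot_eta y; meas. Qed.

Lemma measurable_poisson1 i y : measurable_fun [set: T] (fun w => poisson1 i y (eta w)).
Proof. by rewrite /poisson1; have m := measurable_dot_eta y; have mi := meta i; meas. Qed.

Lemma measurable_poisson2 i j y : measurable_fun [set: T] (fun w => poisson2 i j y (eta w)).
Proof.
by rewrite /poisson2; have m := measurable_dot_eta y; have mi := meta i; have mj := meta j; meas.
Qed.

Let M_ge0 (w : T) : 0 <= M.
Proof. exact: le_trans (normr_ge0 _) (fM w). Qed.

Section Kernel.
Variables q : V -> V -> R.
Hypothesis mq : forall y, measurable_fun [set: T] (fun w => q y (eta w)).
Hypothesis bq : forall b, b < 1 -> bounded_fun (ball_sphere b) (fun p => q p.1 p.2).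

Let mqf y : measurable_fun [set: T] (fun w => q y (eta w) * f w).
Proof. exact: meas_mul. Qed.

Lemma kernel_bound (b : R) : b < 1 -> exists K, forall y w, sqn y <= b -> `|q y (eta w) * f w| <= K.
Proof.
move=> b1; have [K HK] := bq b1; exists (K * M) => y w yb.
by rewrite normrM ler_pM//; apply: (HK (y, eta w)); split => //=.
Qed.

Lemma integrable_kernel y : sqn y < 1 -> P.-integrable [set: T] (EFin \o (fun w => q y (eta w) * f w)).
Proof.
move=> y1; have [K HK] := kernel_bound y1.
by apply: (@bounded_integrable _ _ _ _ _ K) => // w; exact: HK.
Qed.

Lemma continuous_kernel_integral y : sqn y < 1 ->
  (forall u, sqn u = 1 -> {for y, continuous (fun z => q z u)}) ->
  {for y, continuous (fun z => E (fun w => q z (eta w) * f w))}.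
Proof.
move=> y1 cq; pose b := (1 + sqn y) / 2.
have b1 : b < 1 by rewrite /b; lra.
have yb : sqn y < b by rewrite /b; lra.
have [K HK] := kernel_bound b1.
have /nbhs_normP[e /= e0 He] := near_sqn_lt yb.
apply: (@continuous_expectation _ _ _ _ _ (fun z w => q z (eta w) * f w) _ e K e0).
- by move=> z _; exact: mqf.
- by move=> z w zy; apply: HK; apply/ltW/He; rewrite /= distrC.
- by move=> w; apply: cont_mul; [exact: cq|exact: cont_cst].
Qed.

Lemma derive_kernel_integral (dq : V -> V -> R) y v : sqn y < 1 ->
  (forall z u, sqn z < 1 -> sqn u = 1 -> is_derive z v (fun z => q z u) (dq z u)) ->
  (forall b, b < 1 -> bounded_fun (ball_sphere b) (fun p => dq p.1 p.2)) ->
  is_derive y v (fun z => E (fun w => q z (eta w) * f w)) (E (fun w => dq y (eta w) * f w)).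
Proof.
move=> y1 dqP bdq; pose b := (1 + sqn y) / 2.
have b1 : b < 1 by rewrite /b; lra.
have yb : sqn y < b by rewrite /b; lra.
have [K HK] := kernel_bound b1.
have [L HL] : exists L, forall y w, sqn y <= b -> `|dq y (eta w) * f w| <= L.
  have [L HL] := bdq b b1; exists (L * M) => z w zb.
  by rewrite normrM ler_pM//; apply: (HL (z, eta w)); split => //=.
have [e e0 He] := near_line v (near_sqn_lt yb).
apply: (@derive_expectation _ _ _ _ _ (fun z w => q z (eta w) * f w)
  (fun z w => dq z (eta w) * f w) _ _ e (Num.max K L) e0).
- by move=> t _; exact: mqf.
- by move=> t w /He te; rewrite le_max HK// ltW.
- move=> t w /He te.
  have z1 : sqn (t *: v + y) < 1 := lt_trans te b1.
  have := dqP _ _ z1 (eta1 w).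
  move=> /is_derive_line D; apply/is_derive_line.
  by apply: (der_eq (der_mul D (der_cst (f w) t))); rewrite mulr0 addr0.
- by move=> t w /He te; rewrite le_max (HL _ _ (ltW te)) orbT.
Qed.

End Kernel.

Definition poisson_integral y := E (fun w => poisson y (eta w) * f w).

Lemma poisson_integral_partial i y : sqn y < 1 ->
  is_derive y (delta_mx 0 i) poisson_integral (E (fun w => poisson1 i y (eta w) * f w)).
Proof.
move=> y1; apply: derive_kernel_integral => //.
- exact: measurable_poisson.
- exact: bounded_poisson.
- by move=> z u z1 u1; exact: is_derive_poisson.
- by move=> b b1; exact: bounded_poisson1.
Qed.

(** The equality holds at all points near [y], so that both sides can be differentiated once
    more. *)
Let near_partial i y : sqn y < 1 ->
  \forall z \near y, E (fun w => poisson1 i z (eta w) * f w) = partial i poisson_integral z.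
Proof.
move=> y1; apply: filterS (near_sqn_lt y1) => z z1.
by rewrite /partial; have [_ ->] := poisson_integral_partial i z1.
Qed.

Lemma poisson_integral_partial2 i j y : sqn y < 1 ->
  is_derive y (delta_mx 0 j) (partial i poisson_integral) (E (fun w => poisson2 i j y (eta w) * f w)).
Proof.
move=> y1; apply: (near_eq_is_derive (near_partial i y1)).
apply: derive_kernel_integral => //.
- exact: measurable_poisson1.
- by move=> b b1; exact: bounded_poisson1.
- by move=> z u z1 u1; exact: is_derive_poisson1.
- by move=> b b1; exact: bounded_poisson2.
Qed.

Let near_partial2 i j y : sqn y < 1 ->
  \forall z \near y, E (fun w => poisson2 i j z (eta w) * f w) = partial j (partial i poisson_integral) z.
Proof.
move=> y1; apply: filterS (near_sqn_lt y1) => z z1.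
by rewrite [RHS]/partial; have [_ ->] := poisson_integral_partial2 i j z1.
Qed.

Theorem poisson_integral_harmonic : harmonic_on (@unit_ball R 4) poisson_integral.
Proof.
have c0 y : sqn y < 1 -> {for y, continuous poisson_integral}.
  move=> y1; apply: continuous_kernel_integral => //.
  + exact: measurable_poisson.
  + exact: bounded_poisson.
  + by move=> u; exact: continuous_poisson.
have c1 i y : sqn y < 1 -> {for y, continuous (partial i poisson_integral)}.
  move=> y1; apply: (continuous_near_eq (near_partial i y1)).
  apply: continuous_kernel_integral => //.
  + exact: measurable_poisson1.
  + by move=> b b1; exact: bounded_poisson1.
  + by move=> u; exact: continuous_poisson1.
have c2 i j y : sqn y < 1 -> {for y, continuous (partial j (partial i poisson_integral))}.
  move=> y1; apply: (continuous_near_eq (near_partial2 i j y1)).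
  apply: continuous_kernel_integral => //.
  + exact: measurable_poisson2.
  + by move=> b b1; exact: bounded_poisson2.
  + by move=> u; exact: continuous_poisson2.
split; [split|].
- move=> y /unit_ballE y1; split; first exact: c0.
  move=> i; split; last exact: c1.
  by have [] := poisson_integral_partial i y1.
- move=> i y /unit_ballE y1; split; first exact: c1.
  move=> j; split; last exact: c2.
  by have [] := poisson_integral_partial2 i j y1.
- move=> y /unit_ballE y1; rewrite /laplacian.
  transitivity (\sum_i E (fun w => poisson2 i i y (eta w) * f w)).
    by apply: eq_bigr => i _; have [_ <-] := poisson_integral_partial2 i i y1.
  have I i : P.-integrable [set: T] (EFin \o (fun w => poisson2 i i y (eta w) * f w)).
    apply: integrable_kernel => //; first exact: measurable_poisson2.
    by move=> b b1; exact: bounded_poisson2.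
  have -> : \sum_i E (fun w => poisson2 i i y (eta w) * f w) =
      E (fun w => (\sum_i poisson2 i i y (eta w)) * f w).
    by rewrite -expectation_sum//; apply: eq_Rintegral => w _; rewrite mulr_suml.
  transitivity (\int[P]_w (0 : R)); last by rewrite expectation_cst.
  by apply: eq_Rintegral => w _; rewrite poisson_harmonic// mul0r.
Qed.

End PoissonIntegral.

Section MaximumPrinciple.
Context {R : realType} {n : nat}.
Local Notation V := ('rV[R]_n.+1).
Implicit Types (x y z : V) (b : R).
Local Notation sqn y := (dot y y).

Lemma compact_ball b : b <= 1 -> compact [set y : V | sqn y <= b].
Proof.
move=> b1; apply: (@subclosed_compact _ _ [set y : V | forall i, `[-1, 1]%classic (y ord0 i)]).
- rewrite (_ : [set y : V | _] = (fun y : V => sqn y) @^-1` [set t | t <= b])//.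
  apply: preimage_closed; last exact: closed_le.
  by move=> y _; exact: continuous_sqn.
- by apply: (@rV_compact R n.+1 (fun=> `[-1, 1]%classic)) => i; exact: segment_compact.
- move=> y /= yb i; rewrite in_itv/= -ler_norml -(@expr_le1 _ 2)// real_normK ?num_real//.
  exact: le_trans (coord_sqr_le y i) (le_trans yb b1).
Qed.

Lemma nbhs_sqn z (A : set V) : nbhs z A ->
  exists2 d, 0 < d & forall y, sqn (y - z) < d -> A y.
Proof.
move=> /nbhs_ballP[e /= e0 He]; exists (e ^+ 2); first by rewrite exprn_gt0.
move=> y yz; apply: He; split => // i j; rewrite (ord1 i) /ball/= distrC.
rewrite -(@ltr_pXn2r _ 2)// ?nnegrE ?(ltW e0)// real_normK ?num_real//.
by apply: le_lt_trans yz; have := coord_sqr_le (y - z) j; rewrite !mxE.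
Qed.

Lemma sqn_nbhs z d : 0 < d -> \forall y \near z, sqn (y - z) < d.
Proof.
move=> d0; have c : {for z, continuous (fun y : V => sqn y - 2 * dot y z + sqn z)}.
  by have c1 := @continuous_sqn _ _ z; have c2 := @continuous_dot _ _ z z; cont.
have /cvgr_lt/(_ d) := c.
have -> : sqn z - 2 * sqn z + sqn z = 0 by ring.
by move=> /(_ d0); apply: filterS => y; rewrite sqnB; lra.
Qed.

(** Adding a small positive multiple of [|y|^2] makes the Laplacian positive, which excludes an
    interior maximum by the second derivative test on each axis. The boundary condition is a limit
    from inside, because the formula of the Poisson integral gives 0 on the sphere itself. *)
Lemma maximum_principle (w : V -> R) :
  (forall y, sqn y < 1 -> {for y, continuous w}) ->
  (forall y i, sqn y < 1 -> derivable w y (delta_mx 0 i)) ->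
  (forall y i, sqn y < 1 -> derivable (partial i w) y (delta_mx 0 i)) ->
  (forall y, sqn y < 1 -> laplacian w y = 0) ->
  (forall z e, sqn z = 1 -> 0 < e -> exists2 d, 0 < d &
     forall y, sqn y < 1 -> sqn (y - z) < d -> w y <= e) ->
  forall y, sqn y < 1 -> w y <= 0.
Proof.
move=> cw d1w d2w lw bw y0 y01; rewrite leNgt; apply/negP => w0.
(* The positive part of [w], extended by 0, is continuous on the closed ball, so that after adding
   [c |y|^2] it attains its maximum there. *)
pose w1 y := if sqn y < 1 then Num.max (w y) 0 else 0.
have w1_ge0 y : 0 <= w1 y by rewrite /w1; case: ifP; rewrite ?le_max ?lexx ?orbT.
pose c := w y0 / 2.
have c0 : 0 < c by rewrite divr_gt0.
pose g1 y := w1 y + c * sqn y.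
pose g y := w y + c * sqn y.
have cw1 : {within [set y : V | sqn y <= 1], continuous w1}.
  apply/subspace_continuousP => z /= z1.
  move: z1; rewrite le_eqVlt => /predU1P[z1|z1].
    have w1z : w1 z = 0 by rewrite /w1 z1 ltxx.
    suff S a : a = 0 -> w1 y @[y --> within [set y : V | sqn y <= 1] (nbhs z)] --> a by exact: S.
    move=> -> {a}; apply/cvgrPdist_le => /= e e0.
    have [d d0 Hd] := bw z e z1 e0.
    rewrite near_withinE; apply: filterS (sqn_nbhs z d0) => y yz y1.
    rewrite sub0r normrN ger0_norm// /w1; case: ifPn => [y1'|]; last by rewrite ltW.
    by rewrite ge_max Hd//= ltW.
  apply: cvg_within_filter; suff : {for z, continuous w1} by [].
  apply: (@continuous_near_eq _ _ (fun y => (w y + `|w y|) / 2) w1).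
    apply: filterS (near_sqn_lt z1) => y y1; rewrite /w1 y1.
    by case: (leP 0 (w y)) => wy; [rewrite ger0_norm//|rewrite ltr0_norm//]; field.
  by have c1 := cw z z1; cont.
have cg : {within [set y : V | sqn y <= 1], continuous g1}.
  have cs : {within [set y : V | sqn y <= 1], continuous (fun y : V => c * sqn y)}.
    apply/continuous_in_subspaceT => y _.
    suff : {for y, continuous (fun y : V => c * sqn y)} by [].
    by have c1 := @continuous_sqn _ _ y; cont.
  by move=> y; apply: cvgD; [exact: cw1|exact: cs].
have A0 : [set y : V | sqn y <= 1] !=set0 by exists y0; exact: ltW.
have [z zb gz] := compact_EVT_max A0 (compact_ball (lexx 1)) cg.
move: zb; rewrite inE/= => zb.
have gy0 : g y0 <= g1 z.
  have : g1 y0 <= g1 z by apply: gz; rewrite inE/= ltW.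
  by apply: le_trans; rewrite lerD2r /w1 y01 le_max lexx.
have sy0 : 0 <= c * sqn y0 by rewrite mulr_ge0 ?sqn_ge0// ltW.
(* On the sphere [g1] has the value [c], which is half of [w y0 <= g y0]. *)
have z1 : sqn z < 1.
  rewrite ltNge; apply/negP => z1; move: gy0.
  have -> : g1 z = c by rewrite /g1 /w1 ltNge z1/= add0r (@le_anti _ _ (sqn z) 1) ?mulr1// zb.
  by rewrite /g; move: sy0 w0; rewrite /c; lra.
have w1z : w1 z = w z.
  have : 0 < w1 z.
    have : c * sqn z < c by rewrite gtr_pMr.
    by move: gy0 sy0 w0; rewrite /g /g1 /c; lra.
  by rewrite /w1 z1; case: (leP 0 (w z)) => // _; rewrite ltxx.
have {}gz y : sqn y < 1 -> g y <= g z.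
  move=> y1; have : g1 y <= g1 z by apply: gz; rewrite inE/= ltW.
  by rewrite /g1 w1z; apply: le_trans; rewrite lerD2r /w1 y1 le_max lexx.
have L i : 'D_(delta_mx 0 i) (partial i w) z + 2 * c <= 0.
  have [e e0 He] := near_line (delta_mx 0 i) (near_sqn_lt z1).
  pose v : V := delta_mx 0 i.
  have q1 t : `|t| < e -> sqn (t *: v + z) < 1.
    exact: He.
  have dsq (t : R) : der t (fun s => sqn (s *: v + z)) (2 * (t *: v + z) 0 i).
    exact: (is_derive_line (fun y : V => sqn y) z v t _).1
      ((is_derive_line0 (fun y : V => sqn y) (t *: v + z) v _).2 (der_sqn i (t *: v + z))).
  have dco (t : R) : der t (fun s : R => (s *: v + z) 0 i) (1 : R).
    have := der_coord i i (t *: v + z); rewrite eqxx => D.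
    exact: (is_derive_line (fun y : V => y 0 i) z v t _).1
      ((is_derive_line0 (fun y : V => y 0 i) (t *: v + z) v _).2 D).
  have dw (t : R) : `|t| < e -> der t (fun s => w (s *: v + z)) (partial i w (t *: v + z)).
    move=> te; have /derivableP D := d1w _ i (q1 t te).
    exact: (is_derive_line w z v t _).1 D.
  have ddw : der (0 : R) (fun s => partial i w (s *: v + z)) ('D_v (partial i w) z).
    have /derivableP D := d2w _ i z1.
    exact: (is_derive_line0 (partial i w) z v _).1 D.
  have H1 (t : R) : 0 - e < t < 0 + e -> der t (fun t => g (t *: v + z))
      (partial i w (t *: v + z) + 2 * c * (t *: v + z) 0 i).
    rewrite sub0r add0r -ltr_norml => te.
    have D1 := dw t te; have D2 := dsq t.
    have D3 := der_add D1 (der_mul (der_cst c t) D2).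
    by apply: (der_eq D3); ring.
  have H2 : der (0 : R) (fun t => partial i w (t *: v + z) + 2 * c * (t *: v + z) 0 i)
      ('D_v (partial i w) z + 2 * c).
    have D3 := der_add ddw (der_mul (der_cst (2 * c) 0) (dco 0)).
    by apply: (der_eq D3); ring.
  have H3 (t : R) : 0 - e < t < 0 + e -> g (t *: v + z) <= g (0 *: v + z).
    rewrite sub0r add0r -ltr_norml => te.
    by rewrite scale0r add0r; apply: gz; exact: q1.
  exact: second_derivative_test e0 H1 H2 H3.
have : \sum_i ('D_(delta_mx 0 i) (partial i w) z + 2 * c) <= 0.
  by apply: sumr_le0 => i _; exact: L.
rewrite big_split/= -/(laplacian w z) lw// add0r sumr_const card_ord.
by rewrite leNgt pmulrn_lgt0// mulr_gt0.
Qed.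

End MaximumPrinciple.

Section MeasurableComposition.
Context {R : realType} d (T : measurableType d) {n : nat}.
Local Notation V := ('rV[R]_n.+1).

Lemma measurable_countable (K : countType) (g : T -> K) (h : K -> R) :
  (forall k, measurable (g @^-1` [set k])) -> measurable_fun [set: T] (fun w => h (g w)).
Proof.
move=> mg _ B mB; rewrite setTI.
rewrite (_ : _ @^-1` B = \bigcup_m (if unpickle m is Some k then
    (if `[< B (h k) >] then g @^-1` [set k] else set0) else set0)).
  by apply: bigcupT_measurable => m; case: unpickle => [k|//]; case: ifP.
apply/seteqP; split => w /=.
  by move=> Bw; exists (pickle (g w)) => //; rewrite pickleK; case: ifPn => [//|/asboolPn].
by move=> [m _]; case: unpickle => [k|//]; case: ifPn => [/asboolP Bk /= ->|].
Qed.

(** Measurability of [eta] is given by coordinates. Rounding the coordinates down to multiples of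
    [1 / m.+1] makes the composition factor through a countable set, and continuity of [u] at the
    points [eta w] gives pointwise convergence of these step functions. *)
Lemma measurable_comp_continuous (u : V -> R) (eta : T -> V) :
  (forall i, measurable_fun [set: T] (fun w => eta w 0 i)) ->
  (forall w, {for eta w, continuous u}) ->
  measurable_fun [set: T] (fun w => u (eta w)).
Proof.
move=> meta cu.
pose g m w : {ffun 'I_n.+1 -> int} := [ffun i => Num.floor (m.+1%:R * eta w 0 i)].
pose h m (k : {ffun 'I_n.+1 -> int}) : V := \row_i ((k i)%:~R / m.+1%:R).
apply: (@measurable_fun_cvg _ _ _ _ (fun m w => u (h m (g m w)))).
- move=> m; apply: (measurable_countable (fun k => u (h m k))) => k.
  rewrite (_ : _ @^-1` _ = \bigcap_(i in [set: 'I_n.+1])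
    [set w | ((k i)%:~R <= m.+1%:R * eta w 0 i) && (m.+1%:R * eta w 0 i < (k i + 1)%:~R)]).
    apply: fin_bigcap_measurable => // i _.
    have mi := meta i.
    have mb : measurable_fun [set: T] (fun w => ((k i)%:~R <= m.+1%:R * eta w 0 i) && (m.+1%:R * eta w 0 i < (k i + 1)%:~R)).
      by meas.
    by have := mb measurableT [set true] I; rewrite setTI.
  apply/seteqP; split => w /=.
    move=> <- i _ /=; rewrite ffunE; exact: floor_itv.
  move=> H; apply/ffunP => i; rewrite ffunE; apply/floor_def; exact: H.
- move=> w _; suff H : h m (g m w) @[m --> \oo] --> eta w by exact: (cvg_comp _ _ H (cu w)).
  apply/cvg_ballP => e e0; near=> m; split => // i j; rewrite (ord1 i) /ball/= !mxE ffunE.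
  have m0 : 0 < m.+1%:R :> R by [].
  have /andP[f1 f2] := floor_itv (m.+1%:R * eta w 0 j).
  rewrite ltr_distl; set k := Num.floor _ in f1 f2 *.
  have me : m.+1%:R^-1 < e by near: m; exact: near_infty_natSinv_lt (PosNum e0).
  have kE : k%:~R / m.+1%:R <= eta w 0 j by rewrite ler_pdivrMr// mulrC.
  have kE' : eta w 0 j < k%:~R / m.+1%:R + m.+1%:R^-1.
    by rewrite -[X in _ + X]mul1r -mulrDl ltr_pdivlMr// mulrC -intrD1.
  by rewrite ltrBlDr (le_lt_trans kE) ?ltrDl//= (lt_trans kE')// ltrD2l.
Unshelve. all: by end_near. Qed.

End MeasurableComposition.

Lemma integrable_scale {R : realType} d (T : measurableType d) (m : {measure set T -> \bar R})
    (D : set T) (a : R) (f : T -> R) : measurable D ->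
  m.-integrable D (EFin \o f) -> m.-integrable D (EFin \o (fun w => a * f w)).
Proof. by move=> mD /(integrableZl mD a). Qed.

(** * Boundary values of Poisson integrals *)

Section PoissonRepresentation.
Context {R : realType} d (T : measurableType d) (P : probability T R).
Local Notation V := ('rV[R]_4).
Local Notation sqn y := (dot y y).
Local Notation E f := (\int[P]_w f w).
Variables (eta : T -> V) (W : T -> R) (MW : R).
Hypothesis meta : forall i, measurable_fun [set: T] (fun w => eta w 0 i).
Hypothesis eta1 : forall w, sqn (eta w) = 1.
Hypothesis mW : measurable_fun [set: T] W.
Hypothesis W0 : forall w, 0 <= W w.
Hypothesis WM : forall w, W w <= MW.
Hypothesis normW : forall y, sqn y < 1 -> E (fun w => poisson y (eta w) * W w) = 1.
Implicit Types (y z : V) (v : V -> R).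

Lemma continuous_ball_bounded v : (forall y, sqn y <= 1 -> {for y, continuous v}) ->
  exists M : R, forall y, sqn y <= 1 -> `|v y| <= M.
Proof.
move=> cv; have A0 : [set y : V | sqn y <= 1] !=set0 by exists 0; rewrite /= dot0l.
have cn : {within [set y : V | sqn y <= 1], continuous (fun y => `|v y|)}.
  apply/continuous_in_subspaceT => y; rewrite inE/= => /cv c.
  by have : {for y, continuous (fun y => `|v y|)} by cont.
have [z _ Hz] := compact_EVT_max A0 (compact_ball (lexx 1)) cn.
by exists `|v z| => y y1; apply: Hz; rewrite inE.
Qed.

(** The weighted kernel is an approximate identity: it has mass 1, and at sphere points away from
    [z] it is at most a constant times [1 - |y|^2] when [y] is near [z]. *)
Lemma poisson_integral_boundary v z (e : R) : (forall y, sqn y <= 1 -> {for y, continuous v}) ->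
  measurable_fun [set: T] (fun w => v (eta w)) ->
  sqn z = 1 -> 0 < e -> exists2 d, 0 < d &
  forall y, sqn y < 1 -> sqn (y - z) < d ->
  `|poisson_integral P eta (fun w => v (eta w) * W w) y - v y| <= e.
Proof.
move=> cv mv z1 e0; have [M HM] := continuous_ball_bounded cv.
have z1' : sqn z <= 1 by rewrite z1.
have M0 : 0 <= M by apply: le_trans (HM z _); rewrite ?z1 ?normr_ge0.
have e3 : 0 < e / 3 by rewrite divr_gt0.
have [d1 d10 Hd1] : exists2 d, 0 < d & forall y, sqn (y - z) < d -> `|v y - v z| <= e / 3.
  apply: (nbhs_sqn (z := z)); have /cvgrPdist_le/(_ _ e3) := cv z z1'.
  by apply: filterS => y; rewrite distrC.
(* All radii are squared distances. If [sqn (eta w - z) >= d1] and [sqn (y - z) < d1 / 4], the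
   denominator of the kernel is at least [(d1 / 4)^2], whence [16 / d1^2]. The factor [2 M] bounds
   the variation of [v], and the summand 1 makes [K] positive. *)
pose K := 16 / d1 ^+ 2 * (2 * M) * `|MW| + 1.
have K0 : 0 < K.
  by rewrite /K ltr_wpDl// !mulr_ge0// invr_ge0 sqr_ge0.
have [d2 d20 Hd2] : exists2 d, 0 < d & forall y, sqn (y - z) < d -> (1 - sqn y) * K < e / 3.
  apply: (nbhs_sqn (z := z)).
  have c : {for z, continuous (fun y : V => (1 - sqn y) * K)}.
    by have c1 := @continuous_sqn _ _ z; cont.
  by have /cvgr_lt := c; rewrite z1 subrr mul0r; apply.
exists (Num.min (d1 / 4) d2); first by rewrite lt_min divr_gt0.
move=> y y1; rewrite lt_min => /andP[yz1 yz2].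
have yz : sqn (y - z) < d1 by lra.
pose F w := poisson y (eta w) * W w.
have mF : measurable_fun [set: T] F.
  by apply: meas_mul => //; exact: measurable_poisson.
have [C HC] : exists C : R, forall w, `|poisson y (eta w)| <= C.
  have [C HC] := bounded_poisson y1; exists C => w.
  by apply: (HC (y, eta w)); split => /=.
have WM' w : `|W w| <= MW by rewrite ger0_norm.
have FC w : `|F w| <= C * MW by rewrite normrM ler_pM.
have iF : P.-integrable [set: T] (EFin \o F).
  exact: (@bounded_integrable _ _ _ _ _ (C * MW)).
have iFv : P.-integrable [set: T] (EFin \o (fun w => F w * v (eta w))).
  apply: (@bounded_integrable _ _ _ _ _ (C * MW * M)) => [|w]; first exact: meas_mul.
  by rewrite normrM ler_pM// HM// eta1.
have iFd : P.-integrable [set: T] (EFin \o (fun w => F w * (v (eta w) - v y))).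
  apply: (@bounded_integrable _ _ _ _ _ (C * MW * (M + M))) => [|w].
    by apply: meas_mul => //; apply: meas_add => //; exact: meas_cst.
  rewrite normrM ler_pM//.
  by apply: le_trans (ler_normB _ _) _; rewrite lerD ?HM ?eta1// ltW.
have -> : poisson_integral P eta (fun w => v (eta w) * W w) y - v y =
    E (fun w => F w * (v (eta w) - v y)).
  transitivity (E (fun w => F w * v (eta w)) - v y * E F).
    rewrite normW// mulr1; congr (_ - _).
    by apply: eq_Rintegral => w _; rewrite /F; ring.
  rewrite -RintegralZl// -RintegralB//; last exact: integrable_scale.
  by apply: eq_Rintegral => w _; ring.
apply: le_trans (le_normr_Rintegral _ iFd) _ => //.
have F0 w : 0 <= F w by rewrite mulr_ge0// ltW// poisson_gt0.
have iG : P.-integrable [set: T] (EFin \o (fun w => 2 * e / 3 * F w + (1 - sqn y) * K)).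
  rewrite (_ : _ \o _ = (EFin \o (fun w => 2 * e / 3 * F w)) \+ (EFin \o cst ((1 - sqn y) * K)))//.
  apply: integrableD => //; first exact: integrable_scale.
  exact: finite_measure_integrable_cst.
(* The majorant is the sum of the bounds for the two regions: near [z] the kernel times [2 e / 3],
   of total mass [2 e / 3], and away from [z] a constant below [e / 3]. *)
apply: (@le_trans _ _ (E (fun w => 2 * e / 3 * F w + (1 - sqn y) * K))).
  apply: le_Rintegral => //; first exact: integrable_norm.
  move=> w _; rewrite normrM ger0_norm//.
  have [wz|wz] := ltP (sqn (eta w - z)) d1.
    rewrite -[leLHS]addr0 lerD//; last by rewrite mulr_ge0// ?ltW// subr_gt0.
    rewrite mulrC ler_wpM2r//.
    have := Hd1 _ wz; have := Hd1 _ yz; rewrite (distrC (v y)).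
    by have := ler_distD (v z) (v (eta w)) (v y); lra.
  rewrite -[leLHS]add0r lerD//; first by rewrite mulr_ge0// divr_ge0// mulr_ge0// ltW.
  have hd : d1 / 4 <= 1 + sqn y - 2 * dot y (eta w).
    rewrite den_dist//.
    (* Parallelogram law for [eta w - y] and [y - z]: the sum has square at least [d1] and the
       second vector less than [d1 / 4], so the first has at least [d1 / 4]. *)
    have := sqn_ge0 ((eta w - y) - (y - z)); rewrite sqnB.
    move: wz yz1; have -> : eta w - z = (eta w - y) + (y - z) by rewrite addrA subrK.
    move: (eta w) (y - z) => u x; have -> : sqn (y - u) = sqn (u - y).
      by rewrite !sqnB (dotC y); ring.
    move: (u - y) => t; rewrite !dotDl !dotDr (dotC x t); lra.
  have P1 : poisson y (eta w) <= (1 - sqn y) * (16 / d1 ^+ 2).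
    rewrite /poisson ler_wpM2l ?subr_ge0 ?(ltW y1)//.
    have -> : 16 / d1 ^+ 2 = (d1 / 4) ^- 2 by field; rewrite gt_eqF.
    have d14 : 0 < d1 / 4 by rewrite divr_gt0.
    rewrite lef_pV2 ?posrE ?exprn_gt0// ?(lt_le_trans d14)//.
    by rewrite ler_pXn2r ?nnegrE ?(ltW d14)// (le_trans (ltW d14)).
  apply: (@le_trans _ _ ((1 - sqn y) * (16 / d1 ^+ 2) * `|MW| * (2 * M))); last first.
    have -> : (1 - sqn y) * K = (1 - sqn y) * (16 / d1 ^+ 2) * `|MW| * (2 * M) + (1 - sqn y).
      by rewrite /K; ring.
    by rewrite lerDl subr_ge0 ltW.
  rewrite ler_pM//; last first.
    apply: le_trans (ler_normB _ _) _; rewrite mulr2n mulrDl mul1r lerD ?HM ?eta1// ltW//.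
  by rewrite ler_pM ?(ltW (poisson_gt0 _ _))// (le_trans (WM w))// ler_norm.
rewrite RintegralD//; last 2 first.
- exact: integrable_scale.
- exact: finite_measure_integrable_cst.
rewrite expectation_cst RintegralZl// normW//; have := Hd2 _ yz2; lra.
Qed.

End PoissonRepresentation.

Section HarmonicDifference.
Context {R : realType} {n : nat}.
Local Notation V := ('rV[R]_n.+1).
Local Notation sqn y := (dot y y).
Variables u v : V -> R.
Hypotheses (hu : harmonic_on (@unit_ball R n.+1) u) (hv : harmonic_on (@unit_ball R n.+1) v).
Implicit Types (y : V) (i : 'I_n.+1).

Local Notation w := (fun y => u y - v y).

Lemma partial_sub i y : sqn y < 1 -> is_derive y (delta_mx 0 i) w (partial i u y - partial i v y).
Proof.
move=> /unit_ballE y1.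
have [_ /(_ i) [du _]] := hu.1.1 y y1; have [_ /(_ i) [dv _]] := hv.1.1 y y1.
by apply: is_deriveB; apply/derivableP.
Qed.

Lemma partial_partial_sub i y : sqn y < 1 ->
  is_derive y (delta_mx 0 i) (partial i w) (partial i (partial i u) y - partial i (partial i v) y).
Proof.
move=> y1; have /unit_ballE y1' := y1.
apply: (near_eq_is_derive (f := fun y => partial i u y - partial i v y)).
  by apply: filterS (near_sqn_lt y1) => z /(partial_sub i) [_ <-].
have [_ /(_ i) [du _]] := hu.1.2 i y y1'; have [_ /(_ i) [dv _]] := hv.1.2 i y y1'.
by apply: is_deriveB; apply/derivableP.
Qed.

Lemma harmonic_le :
  (forall z e, sqn z = 1 -> 0 < e -> exists2 d, 0 < d &
     forall y, sqn y < 1 -> sqn (y - z) < d -> w y <= e) ->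
  forall y, sqn y < 1 -> u y <= v y.
Proof.
move=> bw y y1; rewrite -subr_le0; move: y y1; apply: maximum_principle => //.
- move=> y /unit_ballE y1; have [cu _] := hu.1.1 y y1; have [cv _] := hv.1.1 y y1.
  by apply: cont_add => //; exact: cont_opp.
- by move=> y i y1; have [] := partial_sub i y1.
- by move=> y i y1; have [] := partial_partial_sub i y1.
- move=> y y1; rewrite /laplacian.
  transitivity (\sum_i (partial i (partial i u) y - partial i (partial i v) y)).
    by apply: eq_bigr => i _; have [_ <-] := partial_partial_sub i y1.
  move/unit_ballE : y1 => y1; have Lu := hu.2 y y1; have Lv := hv.2 y y1.
  by transitivity (laplacian u y - laplacian v y); [exact: sumrB|rewrite Lu Lv subrr].
Qed.

End HarmonicDifference.

Section PoissonRepresentationTheorem.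
Context {R : realType} d (T : measurableType d) (P : probability T R).
Local Notation V := ('rV[R]_4).
Local Notation sqn y := (dot y y).
Local Notation E f := (\int[P]_w f w).

(** Both functions are harmonic and have the same boundary limits, so the maximum principle applies
    to their difference in both orders. The parametrization and its weight stay general in order to
    cover rotated spherical coordinates. *)
Lemma poisson_representation (eta : T -> V) (W : T -> R) (MW : R) (v : V -> R) :
  (forall i, measurable_fun [set: T] (fun w => eta w 0 i)) ->
  (forall w, sqn (eta w) = 1) -> measurable_fun [set: T] W ->
  (forall w, 0 <= W w) -> (forall w, W w <= MW) ->
  (forall y, sqn y < 1 -> E (fun w => poisson y (eta w) * W w) = 1) ->
  harmonic_on (@unit_ball R 4) v -> (forall y, sqn y <= 1 -> {for y, continuous v}) ->
  forall y, sqn y < 1 -> v y = poisson_integral P eta (fun w => v (eta w) * W w) y.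
Proof.
move=> meta eta1 mW W0 WM normW hv cv.
have mv : measurable_fun [set: T] (fun w => v (eta w)).
  by apply: measurable_comp_continuous => // w; apply: cv; rewrite eta1.
have [M HM] := continuous_ball_bounded cv.
have hP : harmonic_on (@unit_ball R 4) (poisson_integral P eta (fun w => v (eta w) * W w)).
  apply: (@poisson_integral_harmonic _ _ _ _ _ _ (M * MW)) => // [|w]; first exact: meas_mul.
  by rewrite normrM ler_pM ?HM ?eta1// ger0_norm.
have B := poisson_integral_boundary meta eta1 mW W0 WM normW cv mv.
move=> y y1; apply/le_anti/andP; split; move: y y1; apply: harmonic_le => // z e z1 e0;
  have [d' d0 Hd] := B z e z1 e0; exists d' => // y y1 yz.
- by apply: le_trans (Hd y y1 yz); rewrite distrC ler_norm.
- by apply: le_trans (Hd y y1 yz); rewrite ler_norm.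
Qed.

End PoissonRepresentationTheorem.

(** * Spherical coordinates *)

Section ProductExpectation.
Context {R : realType} d1 d2 (T1 : measurableType d1) (T2 : measurableType d2).
Variables (P1 : probability T1 R) (P2 : probability T2 R) (f : T1 * T2 -> R) (M : R).
Hypotheses (mf : measurable_fun [set: T1 * T2] f) (fM : forall w, `|f w| <= M).

Let fI : (P1 \x P2)%E.-integrable [set: T1 * T2] (EFin \o f).
Proof. exact: (@bounded_integrable _ _ _ (P1 \x P2)%E _ M). Qed.

Let f1 x : measurable_fun [set: T2] (fun y => f (x, y)).
Proof. exact: measurableT_comp. Qed.

Let f2 y : measurable_fun [set: T1] (fun x => f (x, y)).
Proof. exact: measurableT_comp. Qed.

Lemma expectation_prod12 : \int[(P1 \x P2)%E]_w f w = \int[P1]_x \int[P2]_y f (x, y).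
Proof.
rewrite /Rintegral -(integral12_prod_meas1 fI)/=; congr fine.
apply: eq_integral => x _; rewrite /fubini_F fineK//.
by apply: integrable_fin_num => //; apply: (@bounded_integrable _ _ _ P2 _ M).
Qed.

Lemma expectation_prod21 : \int[(P1 \x P2)%E]_w f w = \int[P2]_y \int[P1]_x f (x, y).
Proof.
rewrite /Rintegral -(integral21_prod_meas1 fI)/=; congr fine.
apply: eq_integral => y _; rewrite /fubini_G fineK//.
by apply: integrable_fin_num => //; apply: (@bounded_integrable _ _ _ P1 _ M).
Qed.

End ProductExpectation.

Section UniformExpectation.
Context {R : realType} (a b : R) (ab : a < b).
Notation mu := (@lebesgue_measure R).
Local Notation U := (uniform_prob ab).
Implicit Types f g : R -> R.

Lemma uniform_expectation f M : measurable_fun [set: R] f -> (forall x, `|f x| <= M) ->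
  \int[U]_x f x = (b - a)^-1 * \int[mu]_(x in `[a, b]) f x.
Proof.
move=> mf fM; have M0 : 0 <= M := le_trans (normr_ge0 _) (fM 0).
have ba : b - a != 0 by rewrite gt_eqF// subr_gt0.
have fI : U.-integrable [set: R] (EFin \o f) by exact: (@bounded_integrable _ _ _ U _ M).
have fL : mu.-integrable `[a, b] (EFin \o f).
  apply: measurable_bounded_integrable => //=.
  - by rewrite lebesgue_measure_itv/=; case: ifP => _; rewrite ?ltry// -EFinB ltry.
  - exact: measurable_funTS.
  - exists M; split; first exact: num_real.
    by move=> x Mx w _; apply: le_trans (fM w) _; exact: ltW.
(* The formula [integral_uniform] is for nonnegative integrands, so [f] is shifted by its bound. *)
have E : \int[U]_x (f x + M) = (b - a)^-1 * \int[mu]_(x in `[a, b]) (f x + M).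
  rewrite /Rintegral integral_uniform; last 2 first.
  - by apply/measurable_EFinP; apply: meas_add => //; exact: meas_cst.
  - by move=> x; rewrite lee_fin -lerBlDr sub0r; have := fM x; rewrite ler_norml => /andP[].
  rewrite fineM//; apply: integrable_fin_num => //=.
  rewrite (_ : (fun x => _) = (EFin \o f) \+ cst M%:E)//; apply: integrableD => //.
  by apply: continuous_integrable; apply: continuous_within => x _; exact: cvg_cst.
move: E; rewrite RintegralD//; last exact: finite_measure_integrable_cst.
rewrite expectation_cst RintegralD//; last first.
  by apply: continuous_integrable; apply: continuous_within => x _; exact: cvg_cst.
have -> : \int[mu]_(x in `[a, b]) M = M * (b - a).
  rewrite Rintegral_cst//=; congr (_ * _).
  by rewrite lebesgue_measure_itv/= lte_fin ab.
rewrite mulrDr mulrCA mulVf// mulr1; exact: addIr.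
Qed.

Lemma uniform_expectation_eq f g M : measurable_fun [set: R] f -> measurable_fun [set: R] g ->
  (forall x, `|f x| <= M) -> (forall x, `|g x| <= M) -> {in `[a, b], f =1 g} ->
  \int[U]_x f x = \int[U]_x g x.
Proof.
move=> mf mg fM gM fg; rewrite (uniform_expectation mf fM) (uniform_expectation mg gM).
by congr (_ * _); apply: eq_Rintegral => x; rewrite inE/= => /fg.
Qed.

(** In one angle at a time, this takes the part of the divergence theorem on the sphere. *)
Lemma uniform_expectation_der (f F : R -> R) (M : R) : (forall x, `|f x| <= M) -> continuous f ->
  (forall x : R, der x F (f x)) -> F a = F b -> \int[U]_x f x = 0.
Proof.
move=> fM cf dF Fab; rewrite (uniform_expectation _ fM); last exact: continuous_measurable_fun.
rewrite (ftc2 (F := F) (ltW ab)) ?Fab ?subrr ?mulr0//.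
- by apply: continuous_within => x _; exact: der_continuous (dF x).
- by apply: continuous_within => x _; exact: cf.
Qed.

End UniformExpectation.

Section SphereParametrization.
Context {R : realType}.
Local Notation V := ('rV[R]_4).
Local Notation sqn y := (dot y y).
Local Notation T := ((measurableTypeR R * measurableTypeR R) * measurableTypeR R)%type.

Lemma two_pi_gt0 : 0 < 2 * pi :> R.
Proof. by rewrite mulr_gt0// pi_gt0. Qed.

Local Notation U1 := (uniform_prob (@pi_gt0 R)).
Local Notation U2 := (uniform_prob two_pi_gt0).

(** The uniform law on the box of angles, of density [1 / (2 pi^3)]. The unit sphere of [R^4] has
    area [2 pi^2]; the quotient [pi] is the constant in [sphere_density]. *)
Definition sphere_prob : probability T R := ((U1 \x U1) \x U2)%E.
Local Notation E f := (\int[sphere_prob]_w f w).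

(* The absolute value makes the density nonnegative off the support of
   [sphere_prob] as well. *)
Definition sphere_density (w : T) : R := pi * sin w.1.1 ^+ 2 * `|sin w.1.2|.

Definition sphere_point (w : T) : V := \row_i
  [:: cos w.1.1; sin w.1.1 * cos w.1.2; sin w.1.1 * sin w.1.2 * cos w.2;
      sin w.1.1 * sin w.1.2 * sin w.2]`_i.

Lemma dot_sphere_point (y : V) : exists y0 y1 y2 y3 : R,
  sqn y = y0 ^+ 2 + y1 ^+ 2 + y2 ^+ 2 + y3 ^+ 2 /\
  forall w, dot y (sphere_point w) =
    y0 * cos w.1.1 + sin w.1.1 * (y1 * cos w.1.2 + sin w.1.2 * (y2 * cos w.2 + y3 * sin w.2)).
Proof.
do 4 eexists; split.
  rewrite /dot !big_ord_recl big_ord0 -!expr2 addr0 !addrA; reflexivity.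
by move=> w; rewrite /dot !big_ord_recl big_ord0 !mxE/=; ring.
Qed.

Lemma sphere_point_norm w : sqn (sphere_point w) = 1.
Proof.
rewrite /dot !big_ord_recl big_ord0 !mxE/=.
have := cos2Dsin2 w.1.1; have := cos2Dsin2 w.1.2; have := cos2Dsin2 w.2.
move: (cos w.1.1) (sin w.1.1) (cos w.1.2) (sin w.1.2) (cos w.2) (sin w.2) => c s c' s' c'' s'' h'' h' h.
have <- : c ^+ 2 + s ^+ 2 * (c' ^+ 2 + s' ^+ 2 * (c'' ^+ 2 + s'' ^+ 2)) = 1.
  by rewrite h'' mulr1 h' mulr1.
by ring.
Qed.

Lemma measurable_sphere_point i : measurable_fun [set: T] (fun w => sphere_point w 0 i).
Proof.
case: i => -[|[|[|[|//]]]] i4; [pose f (w : T) := cos w.1.1|pose f (w : T) := sin w.1.1 * cos w.1.2|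
  pose f (w : T) := sin w.1.1 * sin w.1.2 * cos w.2|pose f (w : T) := sin w.1.1 * sin w.1.2 * sin w.2];
  by rewrite (_ : (fun w => _) = f); [rewrite /f; meas|apply/funext => w; rewrite mxE].
Qed.

Lemma measurable_sphere_density : measurable_fun [set: T] sphere_density.
Proof. by rewrite /sphere_density; meas. Qed.

Lemma sphere_density_ge0 w : 0 <= sphere_density w.
Proof. by rewrite mulr_ge0// mulr_ge0 ?sqr_ge0// pi_ge0. Qed.

Lemma sphere_density_le w : sphere_density w <= pi.
Proof.
have s1 : sin w.1.1 ^+ 2 <= 1 by rewrite sin2cos2 gerBl sqr_ge0.
have l1 : `|sin w.1.2| <= 1 by rewrite ler_norml sin_geN1 sin_le1.
by rewrite /sphere_density -mulrA ler_piMr ?pi_ge0// mulr_ile1 ?sqr_ge0.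
Qed.

Section Expectation.
Variables (f : T -> R) (M : R).
Hypotheses (mf : measurable_fun [set: T] f) (fM : forall w, `|f w| <= M).

Let f12 b : measurable_fun [set: measurableTypeR R * measurableTypeR R] (fun q => f (q, b)).
Proof. exact: measurableT_comp. Qed.

(** This order and the two that follow differ in the innermost angle, which is the one in which an
    exact derivative is integrated. *)
Lemma sphere_expectation123 : E f = \int[U2]_b \int[U1]_x \int[U1]_l f ((x, l), b).
Proof.
rewrite /sphere_prob (expectation_prod21 _ _ mf fM); apply: eq_Rintegral => b _.
by rewrite (expectation_prod12 _ _ (f12 b) (fun q => fM (q, b))).
Qed.

Lemma sphere_expectation132 : E f = \int[U2]_b \int[U1]_l \int[U1]_x f ((x, l), b).
Proof.
rewrite /sphere_prob (expectation_prod21 _ _ mf fM); apply: eq_Rintegral => b _.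
by rewrite (expectation_prod21 _ _ (f12 b) (fun q => fM (q, b))).
Qed.

Lemma sphere_expectation3 : E f = \int[(U1 \x U1)%E]_q \int[U2]_b f (q, b).
Proof. by rewrite /sphere_prob (expectation_prod12 _ _ mf fM). Qed.

End Expectation.

Lemma sphere_expectation_eq (f g : T -> R) (M : R) : measurable_fun [set: T] f -> measurable_fun [set: T] g ->
  (forall w, `|f w| <= M) -> (forall w, `|g w| <= M) ->
  (forall w : T, 0 <= w.1.2 <= pi -> f w = g w) -> E f = E g.
Proof.
move=> mf mg fM gM fg; rewrite (sphere_expectation123 mf fM) (sphere_expectation123 mg gM).
apply: eq_Rintegral => b _; apply: eq_Rintegral => x _.
apply: (@uniform_expectation_eq _ _ _ _ _ _ M) => //.
- by apply: (measurableT_comp (f := fun q => f (q, b))); [exact: measurableT_comp|exact: measurableT_comp].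
- by apply: (measurableT_comp (f := fun q => g (q, b))); [exact: measurableT_comp|exact: measurableT_comp].
- by move=> l; rewrite in_itv/= => lp; apply: fg.
Qed.

End SphereParametrization.

(** * The mean of a spherical Laplacian *)

Section SphereDivergence.
Context {R : realType}.
Local Notation V := ('rV[R]_4).
Local Notation sqn y := (dot y y).
Local Notation T := ((measurableTypeR R * measurableTypeR R) * measurableTypeR R)%type.
Local Notation E f := (\int[@sphere_prob R]_w f w).

Lemma bounded_fun_ex (X : Type) (f : X -> R) : bounded_fun [set: X] f ->
  exists M : R, forall x, `|f x| <= M.
Proof. by move=> [M HM]; exists M => x; exact: HM. Qed.

Lemma bounded_cos_comp (X : Type) (f : X -> R) : bounded_fun [set: X] (fun x => cos (f x)).
Proof. by exists 1 => x _; rewrite ler_norml cos_geN1 cos_le1. Qed.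

Lemma bounded_sin_comp (X : Type) (f : X -> R) : bounded_fun [set: X] (fun x => sin (f x)).
Proof. by exists 1 => x _; rewrite ler_norml sin_geN1 sin_le1. Qed.

Lemma bounded_sphere_den (y : V) : sqn y < 1 ->
  bounded_fun [set: T] (fun w => (1 + sqn y - 2 * dot y (sphere_point w))^-1).
Proof.
move=> y1; exists ((1 - euclidean_norm y) ^- 2) => w _.
have u1 := sphere_point_norm w.
rewrite normfV gtr0_norm ?den_gt0// lef_pV2 ?posrE ?den_gt0 ?den_ge//.
rewrite exprn_gt0// subr_gt0 -(@expr_lt1 _ 2)// ?euclidean_norm_ge0//.
by rewrite euclidean_norm_sqr.
Qed.

(* The spherical Laplacian of [F (y . e)], with [F u = (1 + |y|^2 - 2 u)^-1], is
   [(|y|^2 - u^2) F'' u - 3 u F' u]; multiplied by the density it is a sum of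
   three derivatives in the angles. *)
Lemma sphere_divergence (y : V) : sqn y < 1 ->
  E (fun w => (8 * (sqn y - dot y (sphere_point w) ^+ 2) * (1 + sqn y - 2 * dot y (sphere_point w))^-1 ^+ 3
    - 6 * dot y (sphere_point w) * (1 + sqn y - 2 * dot y (sphere_point w))^-1 ^+ 2) * sphere_density w) = 0.
Proof.
move=> yl1; have bden := bounded_sphere_den yl1.
have [y0 [y1 [y2 [y3 [sE uE]]]]] := dot_sphere_point y.
have D0 (x l b : R) : 0 < 1 + sqn y - 2 * (y0 * cos x + sin x * (y1 * cos l + sin l * (y2 * cos b + y3 * sin b))).
  by rewrite -(uE ((x, l), b)) den_gt0// sphere_point_norm.
move: bden D0; under [X in bounded_fun _ X]eq_fun do rewrite uE.
under eq_Rintegral do rewrite uE.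
rewrite /sphere_density; move: (sqn y) sE => s sE bden D0 {uE yl1}.
(* The inner product is nested by angles, [u = y0 cos x + sin x X] and [X = y1 cos l + sin l Y]; a
   prime denotes the derivative in the angle belonging to the level. *)
pose Y b := y2 * cos b + y3 * sin b; pose Y' b := - y2 * sin b + y3 * cos b.
pose X l b := y1 * cos l + sin l * Y b; pose X' l b := - y1 * sin l + cos l * Y b.
pose u x l b := y0 * cos x + sin x * X l b; pose u' x l b := - y0 * sin x + cos x * X l b.
pose d x l b := (1 + s - 2 * u x l b)^-1.
(* The three terms of the Laplace-Beltrami operator applied to [d], multiplied by the density:
   derivatives in [x], [l] and [b] of the weighted angular components of the gradient. The
   primitives are given in [Z1], [Z2] and [Z3]. *)
pose g1 x l b := pi * (sin l * (4 * sin x * cos x * d x l b ^+ 2 * u' x l b +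
  8 * sin x ^+ 2 * d x l b ^+ 3 * u' x l b ^+ 2 - 2 * sin x ^+ 2 * d x l b ^+ 2 * u x l b)).
pose g2 x l b := pi * (sin x * (2 * cos l * d x l b ^+ 2 * X' l b +
  8 * sin x * sin l * d x l b ^+ 3 * X' l b ^+ 2 - 2 * sin l * d x l b ^+ 2 * X l b)).
pose g3 x l b := pi * (sin x * (8 * sin x * sin l * d x l b ^+ 3 * Y' b ^+ 2 - 2 * d x l b ^+ 2 * Y b)).
pose G (g : R -> R -> R -> R) (w : T) := g w.1.1 w.1.2 w.2.
have b1 := bounded_cos_comp (fun w : T => w.1.1 : R).
have b2 := bounded_cos_comp (fun w : T => w.1.2 : R).
have b3 := bounded_cos_comp (fun w : T => w.2 : R).
have b4 := bounded_sin_comp (fun w : T => w.1.1 : R).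
have b5 := bounded_sin_comp (fun w : T => w.1.2 : R).
have b6 := bounded_sin_comp (fun w : T => w.2 : R).
have [M1 HM1] : exists M : R, forall w, `|G g1 w| <= M.
  by apply: bounded_fun_ex; rewrite /G /g1 /d /u /u' /X /Y; bd.
have [M2 HM2] : exists M : R, forall w, `|G g2 w| <= M.
  by apply: bounded_fun_ex; rewrite /G /g2 /d /u /X' /X /Y; bd.
have [M3 HM3] : exists M : R, forall w, `|G g3 w| <= M.
  by apply: bounded_fun_ex; rewrite /G /g3 /d /u /Y' /X /Y; bd.
have m1 : measurable_fun [set: T] (G g1).
  by rewrite /G /g1 /d /u /u' /X /Y; meas.
have m2 : measurable_fun [set: T] (G g2).
  by rewrite /G /g2 /d /u /X' /X /Y; meas.
have m3 : measurable_fun [set: T] (G g3).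
  by rewrite /G /g3 /d /u /Y' /X /Y; meas.
have p2 : 0 < 2 * pi :> R by exact: two_pi_gt0.
have Z1 (l b : R) : \int[uniform_prob (@pi_gt0 R)]_x g1 x l b = 0.
  refine (@uniform_expectation_der R _ _ (@pi_gt0 R) (fun x => g1 x l b) (fun x => pi * (sin l * (2 * sin x ^+ 2 * d x l b ^+ 2 * u' x l b))) M1 _ _ _ _).
  - by move=> x; exact: (HM1 ((x, l), b)).
  - move=> x; have := D0 x l b; rewrite /g1 /d /u /u' => /lt0r_neq0 h.
    by der_cont.
  - move=> x; have := D0 x l b; rewrite /g1 /d /u /u' -/(X l b) => /lt0r_neq0 h.
    derive => //; rewrite /=; field; exact: h.
  - by rewrite sin0 sinpi expr0n /= !(mulr0, mul0r).
have z1 : E (G g1) = 0.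
  rewrite (sphere_expectation132 m1 HM1).
  transitivity (\int[uniform_prob (@two_pi_gt0 R)]_b (0 : R)); last by rewrite expectation_cst.
  apply: eq_Rintegral => b _.
  transitivity (\int[uniform_prob (@pi_gt0 R)]_b (0 : R)); last by rewrite expectation_cst.
  by apply: eq_Rintegral => l _; exact: Z1.
have Z2 (x b : R) : \int[uniform_prob (@pi_gt0 R)]_l g2 x l b = 0.
  refine (@uniform_expectation_der R _ _ (@pi_gt0 R) (fun l => g2 x l b) (fun l => pi * (sin x * (2 * sin l * d x l b ^+ 2 * X' l b))) M2 _ _ _ _).
  - by move=> l; exact: (HM2 ((x, l), b)).
  - move=> l; have := D0 x l b; rewrite /g2 /d /u /X /X' => /lt0r_neq0 h.
    by der_cont.
  - move=> l; have := D0 x l b; rewrite /g2 /d /u /X /X' -/(Y b) => /lt0r_neq0 h.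
    derive => //; rewrite /=; field; exact: h.
  - by rewrite sin0 sinpi !(mulr0, mul0r).
have z2 : E (G g2) = 0.
  rewrite (sphere_expectation123 m2 HM2).
  transitivity (\int[uniform_prob (@two_pi_gt0 R)]_b (0 : R)); last by rewrite expectation_cst.
  apply: eq_Rintegral => b _.
  transitivity (\int[uniform_prob (@pi_gt0 R)]_b (0 : R)); last by rewrite expectation_cst.
  by apply: eq_Rintegral => x _; exact: Z2.
have Z3 (x l : R) : \int[uniform_prob (@two_pi_gt0 R)]_b g3 x l b = 0.
  refine (@uniform_expectation_der R _ _ (@two_pi_gt0 R) (fun b => g3 x l b) (fun b => pi * (sin x * (2 * d x l b ^+ 2 * Y' b))) M3 _ _ _ _).
  - by move=> b; exact: (HM3 ((x, l), b)).
  - move=> b; have := D0 x l b; rewrite /g3 /d /u /X /Y /Y' => /lt0r_neq0 h.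
    by der_cont.
  - move=> b; have := D0 x l b; rewrite /g3 /d /u /X /Y /Y' => /lt0r_neq0 h.
    derive => //; rewrite /=; field; exact: h.
  - have -> : 2 * pi = pi *+ 2 :> R by rewrite mulr_natl.
    by rewrite /d /Y' /u /X /Y sin0 cos0 cos2pi sin2pi.
have z3 : E (G g3) = 0.
  rewrite (sphere_expectation3 m3 HM3).
  transitivity (\int[(uniform_prob (@pi_gt0 R) \x uniform_prob (@pi_gt0 R))%E]_q (0 : R)); last first.
    by rewrite expectation_cst.
  by apply: eq_Rintegral => -[x l] _; exact: Z3.
have i1 := @bounded_integrable _ _ _ (@sphere_prob R) _ _ m1 HM1.
have i2 := @bounded_integrable _ _ _ (@sphere_prob R) _ _ m2 HM2.
have i3 := @bounded_integrable _ _ _ (@sphere_prob R) _ _ m3 HM3.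
transitivity (E (fun w => G g1 w + G g2 w + G g3 w)); last first.
  have i12 : (@sphere_prob R).-integrable [set: T] (EFin \o (fun w => G g1 w + G g2 w)).
    exact: integrableD i1 i2.
  by rewrite RintegralD// RintegralD// z1 z2 z3 !addr0.
pose L (w : T) := (8 * (s - u w.1.1 w.1.2 w.2 ^+ 2) * d w.1.1 w.1.2 w.2 ^+ 3 -
  6 * u w.1.1 w.1.2 w.2 * d w.1.1 w.1.2 w.2 ^+ 2) * (pi * sin w.1.1 ^+ 2 * `|sin w.1.2|).
have [M HM] : exists M : R, forall w, `|L w| <= M.
  have b7 : bounded_fun [set: T] (fun w => `|sin w.1.2|).
    by exists 1 => w _; rewrite normr_id ler_norml sin_geN1 sin_le1.
  by apply: bounded_fun_ex; rewrite /L /d /u /X /Y; bd.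
pose N := Num.max M (M1 + M2 + M3).
apply: (@sphere_expectation_eq _ L _ N).
- by rewrite /L /d /u /X /Y; meas.
- by apply: meas_add => //; apply: meas_add.
- by move=> w; rewrite /N le_max HM.
- move=> w; rewrite /N le_max; apply/orP; right.
  by rewrite (le_trans (ler_normD _ _))// lerD// (le_trans (ler_normD _ _))// lerD.
move=> [[x l] b] /= /sin_ge0_pi sl0.
rewrite /L /G /= ger0_norm// /g1 /g2 /g3.
have e1 : cos l * X' l b = Y b - sin l * X l b.
  rewrite /X' /X; transitivity (cos l ^+ 2 * Y b - y1 * sin l * cos l); first by ring.
  by rewrite cos2sin2; ring.
have e2 : cos x * u' x l b = X l b - sin x * u x l b.
  rewrite /u' /u; transitivity (cos x ^+ 2 * X l b - y0 * sin x * cos x); first by ring.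
  by rewrite cos2sin2; ring.
(* Both sides are the squared length of the component of [y] tangent to the sphere. *)
have e3 : s - u x l b ^+ 2 = u' x l b ^+ 2 + X' l b ^+ 2 + Y' b ^+ 2.
  have f1 : u x l b ^+ 2 + u' x l b ^+ 2 = y0 ^+ 2 + X l b ^+ 2.
    transitivity ((cos x ^+ 2 + sin x ^+ 2) * (y0 ^+ 2 + X l b ^+ 2)); first by rewrite /u /u'; ring.
    by rewrite cos2Dsin2 mul1r.
  have f2 : X l b ^+ 2 + X' l b ^+ 2 = y1 ^+ 2 + Y b ^+ 2.
    transitivity ((cos l ^+ 2 + sin l ^+ 2) * (y1 ^+ 2 + Y b ^+ 2)); first by rewrite /X /X'; ring.
    by rewrite cos2Dsin2 mul1r.
  have f3 : Y b ^+ 2 + Y' b ^+ 2 = y2 ^+ 2 + y3 ^+ 2.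
    transitivity ((cos b ^+ 2 + sin b ^+ 2) * (y2 ^+ 2 + y3 ^+ 2)); first by rewrite /Y /Y'; ring.
    by rewrite cos2Dsin2 mul1r.
  rewrite sE; lra.
rewrite e3; move: (u' x l b) (X' l b) (Y' b) (u x l b) (X l b) (Y b) (d x l b) (cos x) (cos l) (sin x) (sin l) e1 e2 => uu XX YY v Z Q dd cx cl sx sl e1 e2.
set rhs := RHS; have -> : rhs = pi * (2 * dd ^+ 2 * (sl * (2 * sx * (cx * uu) - sx ^+ 2 * v) +
   sx * (cl * XX) - sl * sx * Z - sx * Q) + 8 * dd ^+ 3 * sx ^+ 2 * sl * (uu ^+ 2 + XX ^+ 2 + YY ^+ 2)).
  by rewrite /rhs; ring.
by rewrite e1 e2; ring.
Qed.

End SphereDivergence.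

(** * The Poisson kernel has mean 1 *)

Section SphereNormalization.
Context {R : realType}.
Local Notation V := ('rV[R]_4).
Local Notation sqn y := (dot y y).
Local Notation T := ((measurableTypeR R * measurableTypeR R) * measurableTypeR R)%type.
Local Notation E f := (\int[@sphere_prob R]_w f w).
Notation mu := (@lebesgue_measure R).

Lemma sphere_density_expectation : E (@sphere_density R) = 1.
Proof.
have dM w : `|@sphere_density R w| <= pi.
  by rewrite ger0_norm ?sphere_density_ge0 ?sphere_density_le.
rewrite (sphere_expectation123 (@measurable_sphere_density R) dM).
have p0 : 0 <= pi :> R := pi_ge0 R.
have p1 : pi != 0 :> R by rewrite gt_eqF ?pi_gt0.
have Z1 (x : R) : \int[uniform_prob (@pi_gt0 R)]_l (pi * sin x ^+ 2 * `|sin l|) = 2 * sin x ^+ 2.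
  rewrite (@uniform_expectation _ _ _ _ _ pi).
  - rewrite (_ : Rintegral _ _ _ = \int[mu]_(l in `[0, pi]) (pi * sin x ^+ 2 * sin l)); last first.
      apply: eq_Rintegral => l; rewrite inE/= in_itv/= => /sin_ge0_pi sl.
      by rewrite ger0_norm.
    have c1 : {within `[0, pi], continuous (fun l : R => pi * sin x ^+ 2 * sin l)}.
      by apply: continuous_within => l _; der_cont.
    have c2 : {within `[0, pi], continuous (fun l : R => - (pi * sin x ^+ 2 * cos l))}.
      by apply: continuous_within => l _; der_cont.
    have d (l : R) : der l (fun l => - (pi * sin x ^+ 2 * cos l)) (pi * sin x ^+ 2 * sin l).
      by derive; ring.
    by rewrite (ftc2 p0 c2 (fun l _ => d l) c1) cos0 cospi subr0; move: (@pi R) p1 => p p1; field.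
  - by have m : measurable_fun [set: R] (fun l : R => pi * sin x ^+ 2 * `|sin l|) by meas.
  - by move=> l; exact: (dM ((x, l), 0)).
have Z2 : \int[uniform_prob (@pi_gt0 R)]_x (2 * sin x ^+ 2) = 1.
  rewrite (@uniform_expectation _ _ _ _ _ 2).
  - have c1 : {within `[0, pi], continuous (fun x : R => 2 * sin x ^+ 2)}.
      by apply: continuous_within => l _; der_cont.
    have c2 : {within `[0, pi], continuous (fun x : R => x - sin x * cos x)}.
      by apply: continuous_within => l _; der_cont.
    have d (x : R) : der x (fun x => x - sin x * cos x) (2 * sin x ^+ 2).
      by derive; have := cos2sin2 x; rewrite !expr2; lra.
     by rewrite (ftc2 p0 c2 (fun x _ => d x) c1) sin0 sinpi !mul0r !subr0 mulVf.
  - by have m : measurable_fun [set: R] (fun x : R => 2 * sin x ^+ 2) by meas.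
  - move=> x; have := sqr_ge0 (sin x); have := sqr_ge0 (cos x); have := cos2Dsin2 x => *.
    by rewrite ger0_norm; lra.
transitivity (\int[uniform_prob (@two_pi_gt0 R)]_b (1 : R)); last by rewrite expectation_cst.
apply: eq_Rintegral => b _; rewrite -Z2; apply: eq_Rintegral => x _; exact: Z1.
Qed.

Section Radius.
Variable a : V.
Hypothesis a1 : sqn a = 1.
Local Notation v w := (dot a (sphere_point w)).
Local Notation N r w := ((1 + r ^+ 2 - 2 * r * v w)^-1).
Local Notation W := (@sphere_density R).

Let sqn_ray (r : R) : sqn (r *: a) = r ^+ 2.
Proof. by rewrite dotZl dotZr a1 mulr1 expr2. Qed.

Let den_ray (r : R) w : 1 + r ^+ 2 - 2 * r * v w = 1 + sqn (r *: a) - 2 * dot (r *: a) (sphere_point w).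
Proof. by rewrite sqn_ray dotZl; ring. Qed.

Let sqr_lt1 (r : R) : `|r| < 1 -> r ^+ 2 < 1.
Proof. by move=> r1; rewrite -(real_normK (num_real r)) expr_lt1. Qed.

Let den_ray_gt0 (r : R) w : `|r| < 1 -> 0 < 1 + r ^+ 2 - 2 * r * v w.
Proof. by move=> r1; rewrite den_ray den_gt0 ?sphere_point_norm// sqn_ray sqr_lt1. Qed.

Let mv : measurable_fun [set: T] (fun w => v w).
Proof. exact: (measurable_dot_eta (@measurable_sphere_point R)). Qed.

Let bv (A : set (R * T)) : bounded_fun A (fun p => v p.2).
Proof.
exists 1 => p _; rewrite -(@expr_le1 _ 2)// real_normK ?num_real//.
by have := cauchy_schwarz a (sphere_point p.2); rewrite a1 sphere_point_norm mulr1.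
Qed.

Let bW (A : set (R * T)) : bounded_fun A (fun p => W p.2).
Proof. by exists pi => p _; rewrite ger0_norm ?sphere_density_ge0 ?sphere_density_le. Qed.

Let radii (b : R) : set (R * T) := [set p | `|p.1| < b].

Let br (b : R) : bounded_fun (radii b) (fun p => p.1).
Proof. by exists b => p /= /ltW. Qed.

Let bN (b : R) : b < 1 -> bounded_fun (radii b) (fun p => N p.1 p.2).
Proof.
move=> b1; exists ((1 - b) ^- 2) => -[r w] /= rb; have r1 := lt_trans rb b1.
have D0 := den_ray_gt0 w r1.
rewrite normfV gtr0_norm// lef_pV2 ?posrE//; last by rewrite exprn_gt0// subr_gt0.
have s1 : sqn (r *: a) < 1 by rewrite sqn_ray sqr_lt1.
rewrite den_ray; apply: le_trans (den_ge s1 (sphere_point_norm w)).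
have -> : euclidean_norm (r *: a) = `|r| by rewrite euclidean_normE sqn_ray sqrtr_sqr.
by rewrite ler_pXn2r ?nnegrE ?subr_ge0 ?(ltW r1) ?(ltW b1)// lerD2l lerN2 ltW.
Qed.

Let derive_radial (k dk : R -> T -> R) :
  (forall r, measurable_fun [set: T] (k r)) ->
  (forall b, b < 1 -> bounded_fun (radii b) (fun p => k p.1 p.2)) ->
  (forall b, b < 1 -> bounded_fun (radii b) (fun p => dk p.1 p.2)) ->
  (forall (r : R) w, `|r| < 1 -> der r (fun r => k r w) (dk r w)) ->
  forall r : R, `|r| < 1 -> der r (fun r => E (k r)) (E (dk r)).
Proof.
move=> mk bk bdk dkP r r1.
pose b := (1 + `|r|) / 2; have b1 : b < 1 by rewrite /b; lra.
pose e := (1 - `|r|) / 2; have e0 : 0 < e by rewrite /e; lra.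
have [M1 HM1] := bk b b1; have [M2 HM2] := bdk b b1.
have te (t : R) : `|t| < e -> `|t *: (1 : R) + r| < b.
  move=> te; apply: le_lt_trans (ler_normD _ _) _.
  by rewrite /GRing.scale/= mulr1 /b; move: te; rewrite /e; lra.
apply: (@derive_expectation _ _ _ _ _ k dk r 1 e (Num.max M1 M2) e0).
- by move=> t _; exact: mk.
- by move=> t w /te tb; rewrite le_max (HM1 (_, w)).
- by move=> t w /te tb; apply: dkP; exact: lt_trans tb b1.
- by move=> t w /te tb; rewrite le_max (HM2 (_, w)) ?orbT.
Qed.

(** The spherical mean of [|r a - e|^-2], a multiple of the fundamental solution in [R^4]. [Psi] is
    its derivative, and [kappa], which is [r^3 Psi], is up to a constant the flux through the sphere
    of radius [r]. *)
Let Phi (r : R) := E (fun w => N r w * W w).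
Let Psi (r : R) := E (fun w => - 2 * (r - v w) * N r w ^+ 2 * W w).
Let kappa (r : R) := E (fun w => - 2 * r ^+ 3 * (r - v w) * N r w ^+ 2 * W w).

Let der_Phi (r : R) : `|r| < 1 -> der r Phi (Psi r).
Proof.
move=> r1; apply: (@derive_radial (fun r w => N r w * W w) (fun r w => - 2 * (r - v w) * N r w ^+ 2 * W w)) => // [s|b b1|b b1|s w s1].
- by have mW := @measurable_sphere_density R; meas.
- by have bn := bN b1; bd.
- by have bn := bN b1; bd.
- have := den_ray_gt0 w s1 => /lt0r_neq0 h.
  by derive => //; rewrite /=; field.
Qed.

(** Harmonicity in polar coordinates: the derivative in [r] of [r^3 dN/dr] is [- r] times the
    spherical Laplacian of [N], which has mean 0 by [sphere_divergence]. *)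
Let der_kappa (r : R) : `|r| < 1 -> der r kappa (0 : R).
Proof.
move=> r1.
have s1 : sqn (r *: a) < 1 by rewrite sqn_ray sqr_lt1.
pose dk (r : R) (w : T) := (- 6 * r ^+ 2 * (r - v w) * N r w ^+ 2 - 2 * r ^+ 3 * N r w ^+ 2 +
   8 * r ^+ 3 * (r - v w) ^+ 2 * N r w ^+ 3) * W w.
have <- : E (dk r) = 0.
  pose L w := (8 * (sqn (r *: a) - dot (r *: a) (sphere_point w) ^+ 2) *
       (1 + sqn (r *: a) - 2 * dot (r *: a) (sphere_point w))^-1 ^+ 3
    - 6 * dot (r *: a) (sphere_point w) * (1 + sqn (r *: a) - 2 * dot (r *: a) (sphere_point w))^-1 ^+ 2) * W w.
  have -> : E (dk r) = E (fun w => - r * L w).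
    apply: eq_Rintegral => w _; rewrite /dk /L -den_ray sqn_ray dotZl.
    by have /lt0r_neq0 h := den_ray_gt0 w r1; move: (v w) (W w) h => c d h; field.
  have [M HM] : exists M : R, forall w, `|L w| <= M.
    have b1 := bounded_sphere_den s1.
    have b2 : bounded_fun [set: T] (fun w => dot (r *: a) (sphere_point w)).
      exists (`|r| * 1) => w _; rewrite dotZl normrM ler_wpM2l//.
      rewrite -(@expr_le1 _ 2)// real_normK ?num_real//.
      by have := cauchy_schwarz a (sphere_point w); rewrite a1 sphere_point_norm mulr1.
    have b3 : bounded_fun [set: T] (fun w => W w).
      by exists pi => w _; rewrite ger0_norm ?sphere_density_ge0 ?sphere_density_le.
    by apply: bounded_fun_ex; rewrite /L; bd.
  rewrite RintegralZl//; first by rewrite (sphere_divergence s1) mulr0.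
  apply: (@bounded_integrable _ _ _ _ _ M) => //.
  have m1 := @measurable_sphere_density R.
  have m2 := measurable_dot_eta (@measurable_sphere_point R) (r *: a).
  by rewrite /L; meas.
refine (@derive_radial (fun r w => - 2 * r ^+ 3 * (r - v w) * N r w ^+ 2 * W w) dk _ _ _ _ r r1) => [s|b b1|b b1|s w s1'].
- by have mW := @measurable_sphere_density R; meas.
- by have bn := bN b1; bd.
- by rewrite /dk; have bn := bN b1; bd.
- have := den_ray_gt0 w s1' => /lt0r_neq0 h.
  by rewrite /dk; derive => //; rewrite /=; field.
Qed.

Let Psi0 (r : R) : 0 < r < 1 -> Psi r = 0.
Proof.
move=> /andP[r0 r1].
have : kappa r = kappa 0.
  apply: (der_eq0_cst (ltW r0)).
  - apply: continuous_within => x /=; rewrite in_itv/= => /andP[x0 xr].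
    by apply: der_continuous (der_kappa _); rewrite ger0_norm// (le_lt_trans xr).
  - by move=> x /andP[x0 xr]; apply: der_kappa; rewrite gtr0_norm// (lt_trans xr).
have -> : kappa 0 = 0.
  transitivity (E (fun w : T => (0 : R))); last by rewrite expectation_cst.
  by apply: eq_Rintegral => w _; rewrite expr0n/= mulr0 !mul0r.
have -> : kappa r = r ^+ 3 * Psi r.
  rewrite -RintegralZl//; first by apply: eq_Rintegral => w _; ring.
  pose b := (1 + r) / 2; have b1 : b < 1 by rewrite /b; lra.
  have [M HM] : bounded_fun (radii b) (fun p => - 2 * (p.1 - v p.2) * N p.1 p.2 ^+ 2 * W p.2).
    by have bn := bN b1; bd.
  apply: (@bounded_integrable _ _ _ _ _ M) => [|w].
    by have mW := @measurable_sphere_density R; meas.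
  by apply: (HM (r, w)); rewrite /radii/= gtr0_norm// /b; lra.
by move/eqP; rewrite mulf_eq0 expf_eq0/= gt_eqF//= => /eqP.
Qed.

(** On the ray the Poisson kernel is [N + r dN/dr], so its mean is [Phi r + r Psi r]; here [Psi]
    vanishes and [Phi] keeps its value 1 at 0. *)
Lemma poisson_expectation_ray (r : R) : 0 < r < 1 ->
  E (fun w => poisson (r *: a) (sphere_point w) * W w) = 1.
Proof.
move=> r01; have [r0 r1] := andP r01.
have P1 : Phi r = 1.
  transitivity (Phi 0).
    apply: (der_eq0_cst (ltW r0)).
    - apply: continuous_within => x /=; rewrite in_itv/= => /andP[x0 xr].
      by apply: der_continuous (der_Phi _); rewrite ger0_norm// (le_lt_trans xr).
    - move=> x /andP[x0 xr]; rewrite -(Psi0 (r := x)) ?x0 ?(lt_trans xr)//.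
      by apply: der_Phi; rewrite gtr0_norm// (lt_trans xr).
  rewrite -sphere_density_expectation; apply: eq_Rintegral => w _.
  by rewrite expr0n/= mulr0 mul0r addr0 subr0 invr1 mul1r.
have i (f : R -> T -> R) : (forall r, measurable_fun [set: T] (f r)) ->
    (forall b, b < 1 -> bounded_fun (radii b) (fun p => f p.1 p.2)) ->
    (@sphere_prob R).-integrable [set: T] (EFin \o f r).
  move=> mf bf; pose b := (1 + r) / 2; have b1 : b < 1 by rewrite /b; lra.
  have [M HM] := bf b b1; apply: (@bounded_integrable _ _ _ _ _ M) => // w.
  by apply: (HM (r, w)); rewrite /radii/= gtr0_norm// /b; lra.
have mW := @measurable_sphere_density R.
have i1 : (@sphere_prob R).-integrable [set: T] (EFin \o (fun w => N r w * W w)).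
  by apply: (i (fun r w => N r w * W w)) => [s|b b1]; [meas|have bn := bN b1; bd].
have i2 : (@sphere_prob R).-integrable [set: T] (EFin \o (fun w => - 2 * (r - v w) * N r w ^+ 2 * W w)).
  by apply: (i (fun r w => - 2 * (r - v w) * N r w ^+ 2 * W w)) => [s|b b1]; [meas|have bn := bN b1; bd].
have -> : 1 = Phi r + r * Psi r by rewrite Psi0// mulr0 addr0.
rewrite -RintegralZl// -RintegralD//; last exact: integrable_scale.
apply: eq_Rintegral => w _; rewrite /poisson -den_ray sqn_ray.
have r1' : `|r| < 1 by rewrite gtr0_norm.
by have /lt0r_neq0 h := den_ray_gt0 w r1'; move: (v w) (W w) h => c d h; field.
Qed.

End Radius.

Lemma poisson_expectation (y : V) : sqn y < 1 ->
  E (fun w => poisson y (sphere_point w) * @sphere_density R w) = 1.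
Proof.
move=> y1; have [->|y0] := eqVneq y 0.
  rewrite -sphere_density_expectation; apply: eq_Rintegral => w _.
  by rewrite /poisson !dot0l mulr0 addr0 !subr0 expr1n invr1 !mul1r.
have s0 : 0 < sqn y by rewrite lt_def sqn_ge0 sqn_eq0 y0.
pose r := Num.sqrt (sqn y).
have r0 : 0 < r by rewrite sqrtr_gt0.
have r1 : r < 1 by rewrite -sqrtr1 ltr_sqrt.
have -> : y = r *: (r^-1 *: y) by rewrite scalerA divff ?scale1r ?gt_eqF.
apply: poisson_expectation_ray; last by rewrite r0.
have -> : dot (r^-1 *: y) (r^-1 *: y) = r^-1 * (r^-1 * r ^+ 2).
  by rewrite dotZl dotZr sqr_sqrtr ?sqn_ge0.
by field; rewrite gt_eqF.
Qed.

End SphereNormalization.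

(** * The gradient of the Poisson kernel *)

Section Reflection.
Context {R : realType} {n : nat}.
Local Notation V := ('rV[R]_n.+1).
Local Notation sqn y := (dot y y).
Implicit Types u y z p q : V.

(** For [u = 0] this is the identity, which covers the case where the two vectors to be exchanged
    already agree. *)
Definition reflection u z : V := z - (2 * dot z u / sqn u) *: u.

Lemma dot_delta (i : 'I_n.+1) z : dot (delta_mx 0 i) z = z 0 i.
Proof.
rewrite /dot (bigD1 i)//= !mxE !eqxx mul1r big1 ?addr0// => j ji.
by rewrite mxE (negbTE ji) andbF mul0r.
Qed.

Lemma reflection_adjoint u y z : dot (reflection u y) z = dot y (reflection u z).
Proof. by rewrite /reflection !(dotDl, dotDr, dotNl, dotNr, dotZl, dotZr) (dotC u z); ring. Qed.

Lemma reflection_isometry u y z : dot (reflection u y) (reflection u z) = dot y z.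
Proof.
have [->|u0] := eqVneq u 0; first by rewrite /reflection !scaler0 !subr0.
have s0 : sqn u != 0 by rewrite sqn_eq0.
rewrite /reflection !(dotDl, dotDr, dotNl, dotNr, dotZl, dotZr) (dotC u z).
by move: s0; move: (sqn u) (dot z u) (dot y u) (dot y z) => s a b c s0; field.
Qed.

Lemma reflectionD u y z : reflection u (y + z) = reflection u y + reflection u z.
Proof. by rewrite /reflection dotDl mulrDr mulrDl scalerDl opprD addrACA. Qed.

Lemma reflectionZ u a z : reflection u (a *: z) = a *: reflection u z.
Proof. by rewrite /reflection dotZl scalerBr scalerA; congr (_ - _ *: _); ring. Qed.

Lemma reflection_fixed u z : dot z u = 0 -> reflection u z = z.
Proof. by rewrite /reflection => ->; rewrite mulr0 mul0r scale0r subr0. Qed.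

Lemma reflection_swap p q : sqn p = sqn q -> reflection (p - q) p = q.
Proof.
move=> pq; have [pq0|pq0] := eqVneq (p - q) 0.
  by rewrite pq0 reflection_fixed ?(dotC p) ?dot0l//; apply/eqP; rewrite -subr_eq0 pq0.
have s0 : sqn (p - q) != 0 by rewrite sqn_eq0.
have e : 2 * dot p (p - q) = sqn (p - q) by rewrite sqnB dotDr dotNr -pq; ring.
by rewrite /reflection e divff// scale1r subKr.
Qed.

End Reflection.

Section Frame.
Context {R : realType}.
Local Notation V := ('rV[R]_4).
Local Notation sqn y := (dot y y).

(** Two reflections suffice. The first carries [y] to the polar axis; the second fixes that axis and
    takes the part of the image of [l] orthogonal to it to a nonnegative multiple of [delta_mx 0 1].
    [A] and [B] compose them in opposite orders, which makes them adjoint. *)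
Lemma frame (y l : V) : exists A B : V -> V,
  [/\ (forall z z', dot z (A z') = dot (B z) z'),
      (forall z z', dot (A z) (A z') = dot z z'),
      (forall z z', dot (B z) (B z') = dot z z'),
      B y = euclidean_norm y *: delta_mx 0 0 &
      exists2 l2 : R, 0 <= l2 & exists l1 : R, B l = l1 *: delta_mx 0 0 + l2 *: delta_mx 0 1].
Proof.
pose e0 : V := delta_mx 0 0; pose e1 : V := delta_mx 0 1.
have e00 : sqn e0 = 1 by rewrite dot_delta mxE !eqxx.
have e11 : sqn e1 = 1 by rewrite dot_delta mxE !eqxx.
have e01 : dot e0 e1 = 0 by rewrite dot_delta mxE.
pose u1 := y - euclidean_norm y *: e0.
pose m := reflection u1 l; pose m' := m - m 0 0 *: e0.
have m'0 : dot e0 m' = 0 by rewrite dotDr dotNr dotZr e00 dot_delta; ring.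
pose t := euclidean_norm m'; pose u2 := m' - t *: e1.
have t0 : 0 <= t := euclidean_norm_ge0 m'.
have H2e0 : reflection u2 e0 = e0.
  by apply: reflection_fixed; rewrite dotDr dotNr dotZr m'0 e01 mulr0 subr0.
exists (fun z => reflection u1 (reflection u2 z)), (fun z => reflection u2 (reflection u1 z)); split.
- by move=> z z'; rewrite -!reflection_adjoint.
- by move=> z z'; rewrite !reflection_isometry.
- by move=> z z'; rewrite !reflection_isometry.
- rewrite reflection_swap ?reflectionZ ?H2e0//.
  by rewrite dotZl dotZr e00 mulr1 -expr2 euclidean_norm_sqr.
- exists t => //; exists (m 0 0); rewrite -/m.
  have mE : m = m 0 0 *: e0 + m' by rewrite addrC subrK.
  rewrite {1}mE reflectionD reflectionZ H2e0 reflection_swap; last first.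
    by rewrite dotZl dotZr e11 mulr1 -expr2 euclidean_norm_sqr.
  by [].
Qed.

End Frame.

Section GradientKernel.
Context {R : realType}.
Local Notation V := ('rV[R]_4).
Local Notation sqn y := (dot y y).
Local Notation T := ((measurableTypeR R * measurableTypeR R) * measurableTypeR R)%type.
Local Notation E f := (\int[@sphere_prob R]_w f w).
Local Notation mu := (@lebesgue_measure R).

Definition directional_kernel (l y u : V) : R := \sum_i l 0 i * poisson1 i y u.

Lemma directional_kernelE (l y u : V) : sqn y < 1 -> sqn u = 1 -> directional_kernel l y u =
  (4 * (1 - sqn y) * (dot l u - dot l y) - 2 * dot l y * (1 + sqn y - 2 * dot y u)) *
  (1 + sqn y - 2 * dot y u)^-1 ^+ 3.
Proof.
move=> y1 u1; have h0 := den_gt0 y1 u1.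
set h := (1 + sqn y - 2 * dot y u)^-1.
transitivity (\sum_i (- 2 * h ^+ 2 * (l 0 i * y 0 i) + - 4 * (1 - sqn y) * h ^+ 3 *
    (l 0 i * y 0 i - l 0 i * u 0 i))).
  by apply: eq_bigr => i _; rewrite /poisson1 -/h; ring.
rewrite big_split/= -!mulr_sumr sumrB -/(dot l y) -/(dot l u) /h.
by move: h0; move: (1 + sqn y - 2 * dot y u) => k k0; field; rewrite gt_eqF.
Qed.

Definition frame_kernel (r l1 l2 : R) (w : T) : R :=
  4 * (l1 * (cos w.1.1 - r * (3 - r ^+ 2) / 2) + (1 - r ^+ 2) * l2 * sin w.1.1 * cos w.1.2) *
  (1 + r ^+ 2 - 2 * r * cos w.1.1)^-1 ^+ 3.

(** The kernel involves inner products only, and adjointness moves [A] from the point of the sphere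
    to [B] on [l] and [y]. *)
Lemma directional_kernel_frame (A B : V -> V) (l y : V) (r l1 l2 : R) w :
  (forall z z', dot z (A z') = dot (B z) z') ->
  (forall z z', dot (A z) (A z') = dot z z') ->
  (forall z z', dot (B z) (B z') = dot z z') ->
  sqn y < 1 -> B y = r *: delta_mx 0 0 -> B l = l1 *: delta_mx 0 0 + l2 *: delta_mx 0 1 ->
  directional_kernel l y (A (sphere_point w)) = frame_kernel r l1 l2 w.
Proof.
move=> AB AA BB y1 By Bl.
rewrite directional_kernelE// ?AA ?sphere_point_norm//.
have -> : sqn y = r ^+ 2.
  by rewrite -BB By dotZl dotZr dot_delta mxE !eqxx mulr1 expr2.
have -> : dot l y = l1 * r.
  rewrite -BB By Bl dotDl !dotZl !dotZr !dot_delta !mxE/=; ring.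
have -> : dot l (A (sphere_point w)) = l1 * cos w.1.1 + l2 * (sin w.1.1 * cos w.1.2).
  by rewrite AB Bl dotDl !dotZl !dot_delta !mxE.
have -> : dot y (A (sphere_point w)) = r * cos w.1.1 by rewrite AB By dotZl dot_delta mxE.
rewrite /frame_kernel; have -> : 2 * (r * cos w.1.1) = 2 * r * cos w.1.1 by ring.
by congr (_ * _); field.
Qed.

Lemma sphere_expectation_eq_polar (f g : T -> R) (M : R) :
  measurable_fun [set: T] f -> measurable_fun [set: T] g ->
  (forall w, `|f w| <= M) -> (forall w, `|g w| <= M) ->
  (forall w : T, 0 <= w.1.1 <= pi -> f w = g w) -> E f = E g.
Proof.
move=> mf mg fM gM fg; rewrite (sphere_expectation132 mf fM) (sphere_expectation132 mg gM).
apply: eq_Rintegral => b _; apply: eq_Rintegral => l _.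
apply: (@uniform_expectation_eq _ _ _ _ _ _ M) => //.
- by apply: (measurableT_comp (f := fun q => f (q, b))); [exact: measurableT_comp|exact: pair2_measurable].
- by apply: (measurableT_comp (f := fun q => g (q, b))); [exact: measurableT_comp|exact: pair2_measurable].
- by move=> x; rewrite in_itv/= => xp; apply: fg.
Qed.

(** The polar integral is an extended real number under [fine]. Its nonnegativity is recorded
    because, together with the upper bound [polar_density_le], it later gives finiteness. *)
Lemma frame_kernel_expectation (r l1 l2 : R) : 0 <= r < 1 -> 0 <= l2 ->
  (0 <= \int[mu]_(x in `[0%R, pi]) (polar_density r l1 l2 x)%:E)%E /\
  E (fun w => `|frame_kernel r l1 l2 w| * sphere_density w) =
  4 / pi * fine (\int[mu]_(x in `[0%R, pi]) (polar_density r l1 l2 x)%:E)%E.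
Proof.
move=> /andP[r0 r1] l20.
have r2 : 0 < 1 - r ^+ 2 by rewrite subr_gt0 expr_lt1.
have D0 x : 0 < 1 + r ^+ 2 - 2 * r * cos x.
  have /ler_wpM2l h := cos_le1 x; have := h r r0; have : 0 < (1 - r) ^+ 2 by rewrite exprn_gt0// subr_gt0.
  by rewrite !expr2; lra.
have d0 x : 0 <= (1 + r ^+ 2 - 2 * r * cos x)^-1 ^+ 3 by rewrite exprn_ge0// invr_ge0 ltW.
split.
  apply: integral_ge0 => x /=; rewrite in_itv/= => /sin_ge0_pi s0.
  rewrite lee_fin /polar_density mulr_ge0//.
    by rewrite divr_ge0 ?sqr_ge0// ltW// exprn_gt0.
  rewrite mulr_ge0// addr_ge0// divr_ge0 ?sqr_ge0//.
  by rewrite mulr_ge0// mulr_ge0// mulr_ge0// ltW.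
have p0 : pi != 0 :> R by rewrite gt_eqF ?pi_gt0.
have b1 := bounded_cos_comp (fun w : T => w.1.1 : R).
have b2 := bounded_cos_comp (fun w : T => w.1.2 : R).
have b3 := bounded_sin_comp (fun w : T => w.1.1 : R).
have b3' : bounded_fun [set: T] (fun w => `|sin w.1.1|).
  by exists 1 => w _; rewrite normr_id ler_norml sin_geN1 sin_le1.
have b3'' : bounded_fun [set: T] (fun w => `|sin w.1.2|).
  by exists 1 => w _; rewrite normr_id ler_norml sin_geN1 sin_le1.
have b4 : bounded_fun [set: T] (fun w => (1 + r ^+ 2 - 2 * r * cos w.1.1)^-1).
  exists ((1 - r) ^- 2) => w _; rewrite normfV gtr0_norm// lef_pV2 ?posrE//; last first.
    by rewrite exprn_gt0// subr_gt0.
  have /ler_wpM2l h := cos_le1 w.1.1; have := h r r0.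
  by rewrite !expr2; lra.
pose A x := l1 * (cos x - r * (3 - r ^+ 2) / 2).
(* The absolute value keeps [B] nonnegative at every [x], as [integral_abs_cos] requires; on
   [[0, pi]] it changes nothing. *)
pose B x := (1 - r ^+ 2) * l2 * `|sin x|.
pose c x := sin x ^+ 2 * (1 + r ^+ 2 - 2 * r * cos x)^-1 ^+ 3.
pose F w := `|frame_kernel r l1 l2 w| * sphere_density w.
pose F' (w : T) := 4 * pi * c w.1.1 * (`|A w.1.1 + B w.1.1 * cos w.1.2| * `|sin w.1.2|).
have mF : measurable_fun [set: T] F by rewrite /F /frame_kernel /sphere_density; meas.
have mF' : measurable_fun [set: T] F' by rewrite /F' /A /B /c; meas.
have [M1 HM1] : exists M : R, forall w, `|F w| <= M.
  have [M HM] : exists M : R, forall w, `|frame_kernel r l1 l2 w| <= M.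
    by apply: bounded_fun_ex; rewrite /frame_kernel; bd.
  exists (M * pi) => w; rewrite normrM normr_id ler_pM//.
  by rewrite ger0_norm ?sphere_density_ge0// sphere_density_le.
have [M2 HM2] : exists M : R, forall w, `|F' w| <= M.
  have [M HM] : bounded_fun [set: T] (fun w => A w.1.1 + B w.1.1 * cos w.1.2).
    by rewrite /A /B; bd.
  have b5 : bounded_fun [set: T] (fun w => `|A w.1.1 + B w.1.1 * cos w.1.2|).
    by exists M => w _; rewrite normr_id HM.
  by apply: bounded_fun_ex; rewrite /F' /c; bd.
have -> : E F = E F'.
  apply: (@sphere_expectation_eq_polar _ _ (Num.max M1 M2)) => //.
  - by move=> w; rewrite le_max HM1.
  - by move=> w; rewrite le_max HM2 orbT.
  move=> [[x l] b] /= /sin_ge0_pi s0; rewrite /F /F' /A /B /c /frame_kernel /sphere_density/= (ger0_norm s0).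
  by rewrite normrM (ger0_norm (d0 x)) normrM normr_nat; ring.
rewrite (sphere_expectation123 mF' HM2).
pose q x := c x * (2 * (`|A x| + Num.max (B x - `|A x|) 0 ^+ 2 / (2 * B x))).
have Z1 (x b : R) : \int[uniform_prob (@pi_gt0 R)]_l F' ((x, l), b) = 4 * q x.
  rewrite (@uniform_expectation _ _ _ _ _ M2); last 2 first.
  - by apply: (measurableT_comp (f := fun q => F' (q, b))); [exact: measurableT_comp|exact: measurableT_comp].
  - by move=> l; exact: HM2.
  rewrite subr0.
  rewrite (_ : Rintegral _ _ _ = \int[mu]_(l in `[0, pi]) ((4 * pi * c x) *
      (`|A x + B x * cos l| * sin l))); last first.
    apply: eq_Rintegral => l; rewrite inE/= in_itv/= => /sin_ge0_pi sl.
    by rewrite /F' /= (ger0_norm sl).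
  rewrite RintegralZl//; last first.
    apply: continuous_integrable; apply: continuous_within => l _.
    have c1 := @continuous_cos R l; have c2 := @continuous_sin R l; cont.
  have B0 : 0 <= B x by rewrite mulr_ge0// mulr_ge0// ltW.
  rewrite /Rintegral (integral_abs_cos _ B0) /= /q.
  by move: (2 * _) (c x) (@pi R) p0 => m n p p0; field.
have mq : measurable_fun [set: R] q.
  by rewrite /q /c /A /B; meas.
have qM x : `|q x| <= M2 / 4.
  rewrite ler_pdivlMr// mulrC -[X in X * _]normr_nat -normrM -(Z1 x 0).
  have m : measurable_fun [set: measurableTypeR R] (fun l => F' ((x, l), 0)).
    by apply: (measurableT_comp (f := fun q => F' (q, 0))); [exact: measurableT_comp|exact: measurableT_comp].
  have i := @bounded_integrable _ _ _ (uniform_prob (@pi_gt0 R)) _ M2 m (fun l => HM2 ((x, l), 0)).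
  apply: le_trans (le_normr_Rintegral _ i) _ => //.
  rewrite -[leRHS](expectation_cst (uniform_prob (@pi_gt0 R))).
  apply: le_Rintegral => //; first exact: integrable_norm.
  exact: finite_measure_integrable_cst.
have Z2 : \int[uniform_prob (@pi_gt0 R)]_x (4 * q x) =
  4 / pi * fine (\int[mu]_(x in `[0%R, pi]) (polar_density r l1 l2 x)%:E)%E.
  rewrite RintegralZl//; last exact: (@bounded_integrable _ _ _ _ _ (M2 / 4)).
  rewrite (uniform_expectation _ mq qM) subr0 mulrA; congr (_ * _).
  apply: eq_Rintegral => x; rewrite inE/= in_itv/= => /sin_ge0_pi s0.
  by rewrite /q /polar_density /A /B /c (ger0_norm s0) exprVn.
transitivity (\int[uniform_prob (@two_pi_gt0 R)]_b (4 / pi * fine (\int[mu]_(x in `[0%R, pi]) (polar_density r l1 l2 x)%:E)%E)); last by rewrite expectation_cst.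
by apply: eq_Rintegral => b _; rewrite -Z2; apply: eq_Rintegral => x _; exact: Z1.
Qed.

End GradientKernel.

(** * Smoothness and monotonicity of the constant *)

Section SmoothCalculus.
Context {R : realType}.
Implicit Types (f g h M : R -> R) (U : set R) (x y : R) (k : nat).

Definition smooth U f := forall k y, U y -> derivable (derive1n k f) y 1.

Lemma smooth_der U f y : smooth U f -> U y -> der y f ((derive1 f) y).
Proof. by move=> sf Uy; rewrite derive1E; apply/derivableP; exact: (sf 0%N). Qed.

Lemma smooth_derive1 U f : smooth U f -> smooth U (derive1 f).
Proof. by move=> sf k y Uy; have := sf k.+1 y Uy; rewrite /derive1n iterSr. Qed.

Lemma smooth_continuous U f y : smooth U f -> U y -> {for y, continuous f}.
Proof. by move=> sf Uy; exact: der_continuous (smooth_der sf Uy). Qed.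

(** By induction each iterated derivative agrees on [U] with some member of [Q]. Smoothness is thus
    proved by exhibiting a class closed under differentiation, without formulas for higher
    derivatives. *)
Lemma smooth_coind U (Q : (R -> R) -> Prop) : open U ->
  (forall f, Q f -> exists2 g, Q g & forall y : R, U y -> der y f (g y)) ->
  forall f, Q f -> smooth U f.
Proof.
move=> oU HQ f Qf.
have S k : exists2 h, Q h & forall y, U y -> derive1n k f y = h y.
  elim: k => [|k [h Qh fh]]; first by exists f.
  have [g Qg hg] := HQ h Qh; exists g => // y Uy.
  have : der y (derive1n k f) (g y).
    apply: (der_near (g := h)); last exact: hg.
    by apply: filterS (open_nbhs_nbhs (conj oU Uy)) => z /fh.
  by rewrite derive1nS derive1E => -[_ ->].
move=> k y Uy; have [h Qh fh] := S k; have [g _ hg] := HQ h Qh.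
have D : der y (derive1n k f) (g y).
  apply: (der_near (g := h)); last exact: hg.
  by apply: filterS (open_nbhs_nbhs (conj oU Uy)) => z /fh.
by case: D.
Qed.

Lemma smooth_eq U f g : open U -> (forall y, U y -> f y = g y) -> smooth U g -> smooth U f.
Proof.
move=> oU fg sg.
apply: (@smooth_coind U (fun f => exists2 g, smooth U g & forall y, U y -> f y = g y) oU); last by exists g.
move=> {fg sg}f [{}g sg fg]; exists (derive1 g).
  by exists (derive1 g); [exact: smooth_derive1|move=> y _].
move=> y Uy; apply: (der_near (g := g)); last exact: smooth_der sg Uy.
by apply: filterS (open_nbhs_nbhs (conj oU Uy)) => z /fg.
Qed.

Section Expressions.
Variable I : Type.

Inductive dexpr := Atom of I | Const of R | Plus of dexpr & dexpr | Times of dexpr & dexpr.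

Fixpoint eval (b : I -> R -> R) e x : R := match e with
  | Atom i => b i x | Const c => c
  | Plus e1 e2 => eval b e1 x + eval b e2 x | Times e1 e2 => eval b e1 x * eval b e2 x end.

Fixpoint dexpr_derivative (d : I -> dexpr) e := match e with
  | Atom i => d i | Const _ => Const 0
  | Plus e1 e2 => Plus (dexpr_derivative d e1) (dexpr_derivative d e2)
  | Times e1 e2 => Plus (Times (dexpr_derivative d e1) e2) (Times e1 (dexpr_derivative d e2)) end.

(* The functions [eval b e] form a ring with generators [b i]; it is closed under
   differentiation, so its elements are smooth. *)
Lemma smooth_dexpr U (b : I -> R -> R) (d : I -> dexpr) : open U ->
  (forall i (y : R), U y -> der y (b i) (eval b (d i) y)) -> forall e, smooth U (eval b e).
Proof.
move=> oU bd e; apply: (@smooth_coind U (fun f => exists e, f = eval b e) oU); last by exists e.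
move=> _ [{}e ->]; exists (eval b (dexpr_derivative d e)); first by eexists.
move=> y Uy; elim: e => [i|c|e1 H1 e2 H2|e1 H1 e2 H2] /=.
- exact: bd.
- exact: der_cst.
- exact: der_add.
- exact: der_mul.
Qed.

End Expressions.

Lemma smooth_scale U (c : R) f : open U -> smooth U f -> smooth U (fun x => c * f x).
Proof.
move=> oU sf; apply: (@smooth_dexpr nat U (fun k => derive1n k f) (fun k => Atom k.+1) oU _ (Times (Const _ c) (Atom 0%N))).
by move=> k y Uy /=; rewrite derive1E; apply/derivableP; exact: sf.
Qed.

(** The functions [g], [1 / f'(g)] and the [f^(k)(g)] generate a ring closed under differentiation:
    [g' = 1 / f'(g)], and the derivative of [1 / f'(g)] is [- f''(g) / f'(g)^3]. *)
Lemma smooth_inverse_function U V g f : open V -> smooth U f ->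
  (forall y, V y -> U (g y)) -> (forall y : R, V y -> (derive1 f) (g y) != 0) ->
  (forall y : R, V y -> der y g (((derive1 f) (g y))^-1)) -> smooth V g.
Proof.
move=> oV sf gU f0 dg.
pose b (o : option (option nat)) : R -> R := match o with
  None => g | Some None => fun y => ((derive1 f) (g y))^-1 | Some (Some k) => fun y => derive1n k f (g y) end.
pose d (o : option (option nat)) := match o with
  None => Atom (Some None)
 | Some None => Times (Const _ (-1)) (Times (Atom (Some (Some 2%N))) (Times (Atom (Some None)) (Times (Atom (Some None)) (Atom (Some None)))))
 | Some (Some k) => Times (Atom (Some (Some k.+1))) (Atom (Some None)) end.
apply: (@smooth_dexpr _ V b d oV _ (Atom None)).
have S k (y : R) : V y -> der y (fun y => derive1n k f (g y)) (derive1n k.+1 f (g y) * ((derive1 f) (g y))^-1).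
  move=> Vy; apply: der_comp; last exact: dg.
  by rewrite derive1nS derive1E; apply/derivableP; apply: sf; exact: gU.
case=> [[k|]|] y Vy /=.
- exact: S.
- have D1 : der y (fun y => derive1 f (g y)) _ := S 1%N y Vy.
  have D2 : der y (fun y => (derive1 f (g y))^-1) _ :=
    @der_inv R (fun y => derive1 f (g y)) y _ (f0 y Vy) D1.
  apply: (der_eq D2); rewrite /=; move: (derive1 (derive1 f) (g y)) (derive1 f (g y)) (f0 y Vy) => E D D0.
  by field.
- exact: dg.
Qed.

(** If [M' = y^k f] and [M 0 = 0], this is the integral of [s^k f (r s)] over [0 <= s <= 1], which
    explains the value at 0. *)
Definition quotient k f M (r : R) : R := if r == 0 then f 0 / k.+1%:R else M r / r ^+ k.+1.

Section Quotient.
Variable c : R.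
Hypothesis c0 : 0 < c.
Let U : set R := [set x | `|x| < c].

Let oU : open U.
Proof.
rewrite (_ : U = ball (0 : R) c); first exact: ball_open.
by apply/seteqP; split => x; rewrite /U /ball/= sub0r normrN.
Qed.

(** The remainder [N] has the derivative [z^k] times the first-order remainder of [f], and the mean
    value theorem bounds it. Differentiability of the quotient at 0 comes down to this estimate. *)
Let quotient_taylor k f M (e d : R) : 0 < d -> d <= c ->
  (forall y : R, `|y| < d -> der y M (y ^+ k * f y)) -> M 0 = 0 ->
  (forall y : R, `|y| < d -> `|f y - f 0 - (derive1 f) 0 * y| <= e * `|y|) ->
  forall y, `|y| < d ->
  `|M y - f 0 / k.+1%:R * y ^+ k.+1 - (derive1 f) 0 / k.+2%:R * y ^+ k.+2| <= e * `|y| ^+ k.+2.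
Proof.
move=> d0 dc dM M0 fe y yd.
pose N (y : R) := M y - f 0 / k.+1%:R * y ^+ k.+1 - (derive1 f) 0 / k.+2%:R * y ^+ k.+2.
have dN (z : R) : `|z| < d -> der z N (z ^+ k * (f z - f 0 - (derive1 f) 0 * z)).
  move=> zd; have D := dM z zd; rewrite /N; derive; rewrite /= exprS.
  have k1 : k.+1%:R != 0 :> R by rewrite pnatr_eq0.
  have k2 : k.+2%:R != 0 :> R by rewrite pnatr_eq0.
  by move: (k.+1%:R) (k.+2%:R) k1 k2 => a b a0 b0; field; rewrite a0 b0.
have N0 : N 0 = 0 by rewrite /N M0 !expr0n/= !mulr0 !subr0.
have B (z : R) : `|z| <= `|y| -> `|z ^+ k * (f z - f 0 - (derive1 f) 0 * z)| <= e * `|y| ^+ k.+1.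
  move=> zy; have zd : `|z| < d := le_lt_trans zy yd.
  have e0 : 0 <= e * `|z| := le_trans (normr_ge0 _) (fe z zd).
  rewrite normrM normrX; apply: (@le_trans _ _ (`|z| ^+ k * (e * `|z|))).
    by rewrite ler_wpM2l ?exprn_ge0// fe.
  have -> : `|z| ^+ k * (e * `|z|) = e * `|z| ^+ k.+1 by rewrite exprS; ring.
  (* At [z = 0] the sign of [e] has to be extracted from the hypothesis at some nonzero point: [y]
     itself, or [d / 2] if [y = 0]. *)
  have [->|z0] := eqVneq z 0.
    rewrite normr0 expr0n/= mulr0 mulr_ge0 ?exprn_ge0//.
    have [y0|y0] := eqVneq y 0; last first.
      by have := le_trans (normr_ge0 _) (fe y yd); rewrite pmulr_lge0// normr_gt0.
    have h : `|d / 2| < d by rewrite gtr0_norm ?divr_gt0// ltr_pdivrMr// ltr_pMr// ltr1n.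
    have := le_trans (normr_ge0 _) (fe _ h); rewrite pmulr_lge0// normr_gt0.
    by rewrite mulf_neq0 ?gt_eqF.
  rewrite ler_wpM2l//; last by rewrite lerXn2r// nnegrE.
  by move: e0; rewrite pmulr_lge0// normr_gt0.
rewrite -/(N y) [e * _]mulrC exprS -mulrA mulrC [_ ^+ _ * e]mulrC.
have cN (a b : R) : (forall z, a <= z <= b -> `|z| < d) -> {within `[a, b], continuous N}.
  move=> ab; apply: continuous_within => z /=; rewrite in_itv/= => /ab zd.
  exact: der_continuous (dN z zd).
have [y0|y0|->] := ltrgtP y 0; last by rewrite N0 !normr0 mulr0.
- have yI z : y <= z <= 0 -> `|z| <= `|y|.
    by move=> /andP[yz z0]; rewrite !ler0_norm// ?lerN2// ltW.
  have [z|z zI] := @MVT _ N (fun z => z ^+ k * (f z - f 0 - (derive1 f) 0 * z)) _ _ y0 _ (cN y 0 (fun z zI => le_lt_trans (yI z zI) yd)).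
    by rewrite in_itv/= => /andP[yz z0]; apply: dN; apply: le_lt_trans (yI z _) yd; rewrite !ltW.
  move: zI; rewrite in_itv/= => /andP[yz z0].
  rewrite N0 !sub0r => /eqP; rewrite eqr_oppLR => /eqP ->.
  by rewrite normrN normrM normrN ler_wpM2r// B// yI// !ltW.
- have yI z : 0 <= z <= y -> `|z| <= `|y|.
    by move=> /andP[z0 zy]; rewrite !ger0_norm// ltW.
  have [z|z zI] := @MVT _ N (fun z => z ^+ k * (f z - f 0 - (derive1 f) 0 * z)) _ _ y0 _ (cN 0 y (fun z zI => le_lt_trans (yI z zI) yd)).
    by rewrite in_itv/= => /andP[yz z0]; apply: dN; apply: le_lt_trans (yI z _) yd; rewrite !ltW.
  move: zI; rewrite in_itv/= => /andP[yz z0].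
  rewrite N0 !subr0 => ->.
  by rewrite normrM ler_wpM2r// B// yI// !ltW.
Qed.

(** Differentiating the integral of [s^k f (r s)] gives that of [s^(k+1) f' (r s)], a quotient of
    the same kind; integration by parts identifies the new [M]. So the quotients form a class to
    which [smooth_coind] applies. *)
Lemma der_quotient k f M : smooth U f -> (forall y : R, U y -> der y M (y ^+ k * f y)) -> M 0 = 0 ->
  forall y : R, U y -> der y (quotient k f M)
    (quotient k.+1 (derive1 f) (fun r => f r * r ^+ k.+1 - k.+1%:R * M r) y).
Proof.
move=> sf dM M0 y Uy; rewrite [in X in is_derive _ _ _ X]/quotient.
have k1 : k.+1%:R != 0 :> R by rewrite pnatr_eq0.
have k2 : k.+2%:R != 0 :> R by rewrite pnatr_eq0.
have [y0|y0] := eqVneq y 0; last first.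
  apply: (der_near (g := fun r => M r / r ^+ k.+1)).
    have : \forall z \near y, z != 0.
      apply/nbhs_ballP; exists `|y|; rewrite /= ?normr_gt0// => z; rewrite /ball/= => yz.
      by apply/eqP => z0; move: yz; rewrite z0 subr0 ltxx.
    by apply: filterS => z z0; rewrite /quotient (negbTE z0).
  have D := dM y Uy; derive; first by rewrite expf_neq0.
  rewrite /=; have p0 : y ^+ k != 0 by rewrite expf_neq0.
  rewrite !exprS; move: (y ^+ k) (k.+1%:R) p0 => p a p0; field; by rewrite p0 y0.
rewrite {}y0 in Uy *; apply: der_lim; apply/cvgrPdist_le => /= e e0.
have /cvgrPdist_le/(_ _ e0) : h^-1 * (f (h + 0) - f 0) @[h --> 0^'] --> (derive1 f) 0.
  rewrite derive1E; have [/cvg_ex[l fl] _] := smooth_der sf Uy.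
  have <- : l = 'D_1 f 0 by symmetry; exact/cvg_lim.
  by move: fl; rewrite /GRing.scale/=; under eq_fun do rewrite mulr1.
rewrite !near_withinE => -[d1 /= d10 Hd1].
pose d := Num.min d1 c; have d0 : 0 < d by rewrite lt_min d10.
have T := @quotient_taylor k f M e d d0 _ _ M0.
exists d => //= h; rewrite /ball_/= sub0r normrN => hd h0.
have {}T : `|M h - f 0 / k.+1%:R * h ^+ k.+1 - (derive1 f) 0 / k.+2%:R * h ^+ k.+2| <= e * `|h| ^+ k.+2.
  apply: T => //.
  - by rewrite ge_min lexx orbT.
  - by move=> z; rewrite lt_min => /andP[_ zc]; exact: dM.
  - move=> z; rewrite lt_min => /andP[zd _].
    have [->|z0] := eqVneq z 0; first by rewrite mulr0 subrr subr0 normr0 mulr0.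
    have := Hd1 z; rewrite /= sub0r normrN => /(_ zd z0); rewrite addr0.
    rewrite -(@ler_pM2r _ `|z|) ?normr_gt0// -normrM distrC.
    by congr (`|_| <= _); field.
rewrite /quotient eqxx addr0 (negbTE h0) -(@ler_pM2r _ (`|h| ^+ k.+2)) ?exprn_gt0 ?normr_gt0//.
apply: le_trans T; rewrite -normrX -normrM distrC le_eqVlt; apply/orP; left; apply/eqP; congr `|_|.
have p0 : h ^+ k != 0 by rewrite expf_neq0.
rewrite !exprS; move: (h ^+ k) p0 => p p0.
by move: (k.+1%:R) (k.+2%:R) k1 k2 => a b a0 b0; field; rewrite a0 b0 p0 h0.
Qed.

Lemma smooth_quotient k f M : smooth U f -> (forall y : R, U y -> der y M (y ^+ k * f y)) -> M 0 = 0 ->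
  smooth U (quotient k f M).
Proof.
move=> sf dM M0.
apply: (@smooth_coind U (fun F => exists k f M, [/\ smooth U f,
  (forall y : R, U y -> der y M (y ^+ k * f y)), M 0 = 0 & F = quotient k f M]) oU); last by exists k, f, M.
move=> _ [{sf dM M0}l [g [N [sg dN N0 ->]]]].
exists (quotient l.+1 (derive1 g) (fun r => g r * r ^+ l.+1 - l.+1%:R * N r)); last exact: der_quotient.
exists l.+1, (derive1 g), (fun r => g r * r ^+ l.+1 - l.+1%:R * N r); split; last by [].
- exact: smooth_derive1.
- move=> y Uy; have D1 := smooth_der sg Uy; have D2 := dN y Uy.
  by derive; rewrite /= !exprS; ring.
- by rewrite N0 expr0n/= !mulr0 subr0.
Qed.

End Quotient.

End SmoothCalculus.

(** * The constant as a smooth decreasing function *)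

Section FrakC.
Context {R : realType}.
Implicit Types r s t : R.
Local Notation U := [set r : R | `|r| < 2].

(** The angle at which a chord of length [r] of the unit circle is seen from the centre:
    [sin a = r sqrt (4 - r^2) / 2] and [cos a = 1 - r^2 / 2]. *)
Definition chord_angle r : R := 2 * asin (r / 2).
(** The inverse of the square root is preferred because its derivative [r v^3] is a polynomial in
    [r] and [v]; the root itself is recovered as [(4 - r^2) v]. *)
Definition inv_width r : R := (Num.sqrt (4 - r ^+ 2))^-1.
Local Notation a := chord_angle.
Local Notation v := inv_width.
Local Notation w r := ((4 - r ^+ 2) * v r).

Lemma open_interval2 : open U.
Proof.
rewrite (_ : U = ball (0 : R) 2); first exact: ball_open.
by apply/seteqP; split => x; rewrite /ball/= sub0r normrN.
Qed.

Lemma four_sub_sqr_gt0 r : `|r| < 2 -> 0 < 4 - r ^+ 2.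
Proof.
move=> r2; have -> : 4 - r ^+ 2 = 2 ^+ 2 - `|r| ^+ 2 by rewrite real_normK ?num_real//; ring.
by rewrite subr_gt0 ltrXn2r ?nnegrE.
Qed.

Lemma inv_width_gt0 r : `|r| < 2 -> 0 < v r.
Proof. by move=> r2; rewrite invr_gt0 sqrtr_gt0 four_sub_sqr_gt0. Qed.

Lemma inv_width_sqr r : `|r| < 2 -> (4 - r ^+ 2) * v r ^+ 2 = 1.
Proof.
move=> r2; have h := four_sub_sqr_gt0 r2.
by rewrite exprVn sqr_sqrtr ?divff ?gt_eqF// ltW.
Qed.

Lemma sqrt_inv_width r : `|r| < 2 -> Num.sqrt (4 - r ^+ 2) = w r.
Proof.
move=> r2; have h := four_sub_sqr_gt0 r2; rewrite -{2}(sqr_sqrtr (ltW h)) expr2 mulfK//.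
by rewrite gt_eqF// sqrtr_gt0.
Qed.

Lemma der_chord_angle r : `|r| < 2 -> der r a (2 * v r).
Proof.
move=> r2; have h := four_sub_sqr_gt0 r2; have /andP[r3 r4] : -2 < r < 2 by rewrite -ltr_norml.
rewrite /a; derive; first by apply/andP; split; lra.
have -> : 1 - (r / 2) ^+ 2 = (4 - r ^+ 2) / 2 ^+ 2 by field.
rewrite sqrtrM ?(ltW h)// sqrtrV// sqrtr_sqr ger0_norm// /v.
have s0 : Num.sqrt (4 - r ^+ 2) != 0 by rewrite gt_eqF// sqrtr_gt0.
by move: (Num.sqrt _) s0 => s s0; field.
Qed.

Lemma der_inv_width r : `|r| < 2 -> der r v (r * v r ^+ 3).
Proof.
move=> r2; have h := four_sub_sqr_gt0 r2; rewrite /v; derive => //.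
  by rewrite gt_eqF// sqrtr_gt0.
have s0 : Num.sqrt (4 - r ^+ 2) != 0 by rewrite gt_eqF// sqrtr_gt0.
by rewrite /=; move: (Num.sqrt _) s0 => s s0; field.
Qed.

Lemma smooth_width : smooth U (fun r => w r).
Proof.
pose b (o : bool) : R -> R := if o then id else v.
pose X := Atom (R := R) true; pose Y := Atom (R := R) false.
pose d (o : bool) := if o then Const bool (1 : R) else Times X (Times Y (Times Y Y)).
have bd o (y : R) : U y -> der y (b o) (eval b (d o) y).
  by case: o => /= y2; [exact: der_id|apply: (der_eq (der_inv_width y2)); ring].
have S := @smooth_dexpr R bool U b d open_interval2 bd (Times (Plus (Const _ 4) (Times (Const _ (-1)) (Times X X))) Y).
by apply: (smooth_eq open_interval2 _ S) => y _ /=; ring.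
Qed.

(* [half_sum r = sin a + a], [numer r] is the numerator of the formula for
   [frakC r], and [slope_numer r = r numer' r - 3 numer r], where
   [a = chord_angle r]. *)
Definition half_sum r := r * w r / 2 + a r.
Definition numer r := r * w r * (2 + r ^+ 2) - 4 * (1 - r ^+ 2) * a r.
Definition slope_numer r := r * w r * (r ^+ 2 - 6) + (12 - 4 * r ^+ 2) * a r.

Let inv_width_cube r : `|r| < 2 -> (4 - r ^+ 2) * v r ^+ 3 = v r.
Proof.
move=> r2; transitivity ((4 - r ^+ 2) * v r ^+ 2 * v r); first by ring.
by rewrite inv_width_sqr// mul1r.
Qed.

Lemma der_half_sum r : `|r| < 2 -> der r half_sum (w r).
Proof.
move=> r2; have d1 := der_chord_angle r2; have d2 := der_inv_width r2.
rewrite /half_sum; derive; rewrite /=.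
have e := inv_width_cube r2.
transitivity (w r / 2 - r ^+ 2 * v r + r ^+ 2 / 2 * ((4 - r ^+ 2) * v r ^+ 3) + 2 * v r); first by field.
by rewrite e; field.
Qed.

Lemma der_numer r : `|r| < 2 -> der r numer (8 * r * half_sum r).
Proof.
move=> r2; have d1 := der_chord_angle r2; have d2 := der_inv_width r2.
rewrite /numer /half_sum; derive; rewrite /=.
have e := inv_width_cube r2.
set lhs := LHS; transitivity (lhs - r ^+ 2 * (2 + r ^+ 2) * ((4 - r ^+ 2) * v r ^+ 3 - v r)).
  by rewrite e subrr mulr0 subr0.
by rewrite /lhs; field.
Qed.

Lemma der_slope_numer r : `|r| < 2 -> der r slope_numer (8 * r * (r * w r / 2 - a r)).
Proof.
move=> r2; have d1 := der_chord_angle r2; have d2 := der_inv_width r2.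
rewrite /slope_numer; derive; rewrite /=.
have e := inv_width_cube r2.
set lhs := LHS; transitivity (lhs - r ^+ 2 * (r ^+ 2 - 6) * ((4 - r ^+ 2) * v r ^+ 3 - v r)).
  by rewrite e subrr mulr0 subr0.
by rewrite /lhs; field.
Qed.

Lemma chord_angle0 : a 0 = 0.
Proof.
have p2 : 0 <= pi / 2 :> R by rewrite divr_ge0 ?pi_ge0.
by rewrite /a mul0r -[X in asin X]sin0 sinK ?mulr0// in_itv/= oppr_le0 p2.
Qed.

(** In terms of the angle this is [sin a < a]; the difference [a - sin a] has the derivative
    [x^2 v x > 0]. *)
Lemma half_chord_lt_angle r : 0 < r < 2 -> r * w r / 2 - a r < 0.
Proof.
move=> /andP[r0 r2].
have D (x : R) : `|x| < 2 -> der x (fun x => a x - x * w x / 2) (x ^+ 2 * v x).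
  move=> x2; have d1 := der_chord_angle x2; have d2 := der_inv_width x2.
  derive; rewrite /=.
  have e := inv_width_cube x2.
  set lhs := LHS; transitivity (lhs + x ^+ 2 / 2 * ((4 - x ^+ 2) * v x ^+ 3 - v x)).
    by rewrite e subrr mulr0 addr0.
  by rewrite /lhs; field.
have xI (x : R) : 0 <= x <= r -> `|x| < 2.
  by move=> /andP[x0 xr]; rewrite ger0_norm// (le_lt_trans xr).
have := @der_lt _ (fun x => a x - x * w x / 2) (fun x => x ^+ 2 * v x) 0 r r0.
rewrite chord_angle0 !mul0r subrr subr_gt0 subr_lt0; apply.
- apply: continuous_within => x /=; rewrite in_itv/= => /xI x2; exact: der_continuous (D x x2).
- by move=> x /andP[x0 xr]; apply: D; apply: xI; rewrite !ltW.
- move=> x /andP[x0 xr]; rewrite mulr_gt0 ?exprn_gt0// inv_width_gt0//.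
  by apply: xI; rewrite !ltW.
Qed.

(** It vanishes at 0 and has the derivative [8 r (sin a - a) < 0]. Its sign is that of the
    derivative of the constant. *)
Lemma slope_numer_lt0 r : 0 < r < 2 -> slope_numer r < 0.
Proof.
move=> /andP[r0 r2].
have xI (x : R) : 0 <= x <= r -> `|x| < 2.
  by move=> /andP[x0 xr]; rewrite ger0_norm// (le_lt_trans xr).
have D (x : R) : `|x| < 2 -> der x (fun x => - slope_numer x) (- (8 * x * (x * w x / 2 - a x))).
  by move=> /der_slope_numer d; exact: der_opp.
have := @der_lt _ (fun x => - slope_numer x) (fun x => - (8 * x * (x * w x / 2 - a x))) 0 r r0.
rewrite /slope_numer chord_angle0 !mul0r mulr0 addr0 oppr0 -/(slope_numer r) oppr_gt0; apply.
- by apply: continuous_within => x /=; rewrite in_itv/= => /xI x2; exact: der_continuous (D x x2).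
- by move=> x /andP[x0 xr]; apply: D; apply: xI; rewrite !ltW.
- move=> x /andP[x0 xr]; rewrite oppr_gt0 nmulr_llt0 ?mulr_gt0//.
  by apply: half_chord_lt_angle; rewrite x0 (lt_trans xr).
Qed.

(** The indices 0 and 2 come from [half_sum' = w] and from [numer' = 8 r half_sum = r^2 * 8
    (half_sum / r)]. *)
Definition frakC_smooth : R -> R :=
  quotient 2 (fun r => 8 / pi * quotient 0 (fun r => w r) half_sum r) (fun r => numer r / pi).
Local Notation F := frakC_smooth.

Lemma frakC_smoothE r : r != 0 -> F r = numer r / pi / r ^+ 3.
Proof. by move=> r0; rewrite /F /quotient (negbTE r0). Qed.

Lemma smooth_frakC : smooth U F.
Proof.
have c2 : 0 < 2 :> R by [].
have sh : smooth U (quotient 0 (fun r => w r) half_sum).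
  refine (@smooth_quotient R 2 c2 0 (fun r => w r) half_sum smooth_width _ _).
    by move=> y /der_half_sum D; apply: (der_eq D); rewrite expr0 mul1r.
  by rewrite /half_sum chord_angle0 !mul0r addr0.
refine (@smooth_quotient R 2 c2 2 _ _ (smooth_scale open_interval2 sh) _ _).
- move=> y y2; have D := der_numer y2; derive => //; rewrite mulr0 addr0.
  rewrite /quotient; have [->|y0] := eqVneq y 0; first by rewrite expr0n/= !(mulr0, mul0r).
  by rewrite expr1 expr2; move: (half_sum y) (pi^-1) => m p; field.
- by rewrite /numer chord_angle0 !mul0r mulr0 subrr mul0r.
Qed.

Lemma frakC_smooth0 : F 0 = 16 / (3 * pi).
Proof.
rewrite /F /quotient !eqxx expr0n/= subr0 /v expr0n/= subr0.
have -> : Num.sqrt 4 = 2 :> R by rewrite (_ : 4 = 2 ^+ 2) ?sqrtr_sqr ?ger0_norm//; ring.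
by rewrite invfM; move: pi^-1 => p; field.
Qed.

Lemma der_frakC r : 0 < r < 2 -> der r F (slope_numer r / (pi * r ^+ 4)).
Proof.
move=> /andP[r0 r2]; have r2' : `|r| < 2 by rewrite gtr0_norm.
apply: (der_near (g := fun r => numer r / pi / r ^+ 3)).
  apply: filterS (lt_nbhsr r0) => z z0; apply/esym/frakC_smoothE; by rewrite gt_eqF.
have D := der_numer r2'; derive; first by rewrite expf_neq0// gt_eqF.
have p0 : pi != 0 :> R by rewrite gt_eqF ?pi_gt0.
rewrite /= /numer /slope_numer /half_sum; move: (@pi R) p0 (w r) (a r) => p p0 W A.
by field; rewrite p0 gt_eqF.
Qed.

Lemma frakC_derive_lt0 r : 0 < r < 2 -> derive1 F r < 0.
Proof.
move=> r02; have [_] := der_frakC r02; rewrite derive1E => ->; have /andP[r0 r2] := r02.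
by rewrite nmulr_rlt0 ?slope_numer_lt0// invr_gt0 mulr_gt0 ?pi_gt0 ?exprn_gt0.
Qed.

Lemma continuous_frakC (x : R) : `|x| < 2 -> {for x, continuous F}.
Proof. exact: smooth_continuous smooth_frakC. Qed.

Lemma frakC_decreasing r s : 0 <= r -> r < s -> s < 2 -> F s < F r.
Proof.
move=> r0 rs s2.
have xI (x : R) : r <= x <= s -> `|x| < 2.
  by move=> /andP[x0 xr]; rewrite ger0_norm// ?(le_lt_trans xr)// (le_trans r0).
have := @der_lt _ (fun x => - F x) (fun x => - derive1 F x) r s rs.
rewrite ltrN2; apply.
- apply: continuous_within => x /=; rewrite in_itv/= => /xI x2.
  by have c := continuous_frakC x2; exact: cont_opp.
- move=> x /andP[rx xs]; apply: der_opp; apply: smooth_der smooth_frakC _.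
  by apply: xI; rewrite !ltW.
- move=> x /andP[rx xs]; rewrite oppr_gt0 frakC_derive_lt0// (le_lt_trans r0)//.
  exact: lt_trans s2.
Qed.

(* The argument of the arctangent is [- tan a]. *)
Lemma atan_chord_angle r : 0 < r -> r ^+ 2 < 2 ->
  atan (r * Num.sqrt (4 - r ^+ 2) / (- 2 + r ^+ 2)) = - a r.
Proof.
move=> r0 r2.
have rlt2 : r < 2 by rewrite -(@ltr_pXn2r _ 2) ?nnegrE ?(ltW r0)//; apply: lt_trans r2 _; rewrite expr2; lra.
have rI : -1 <= r / 2 <= 1 by apply/andP; split; lra.
have sq : Num.sqrt (1 - (r / 2) ^+ 2) = Num.sqrt (4 - r ^+ 2) / 2.
  have -> : 1 - (r / 2) ^+ 2 = (4 - r ^+ 2) / 2 ^+ 2 by field.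
  have h := four_sub_sqr_gt0 (_ : `|r| < 2); rewrite sqrtrM ?sqrtrV ?sqrtr_sqr ?ger0_norm//.
  by rewrite ltW// h// gtr0_norm.
have aE : a r = asin (r / 2) *+ 2 by rewrite /a mulr_natl.
have sa : sin (a r) = r * Num.sqrt (4 - r ^+ 2) / 2.
  by rewrite aE sin_mulr2n cos_asin// sq asinK ?in_itv//= mulr2n; field.
have h4 : 0 <= 4 - r ^+ 2 by lra.
have ca : cos (a r) = (2 - r ^+ 2) / 2.
  by rewrite aE cos_mulr2n cos_asin// sq expr_div_n sqr_sqrtr// mulr2n; field.
have c0 : 0 < cos (a r) by rewrite ca divr_gt0// subr_gt0.
have a0 : 0 <= a r.
  have := half_chord_lt_angle (introT andP (conj r0 rlt2)).
  have : 0 < r * w r / 2 by rewrite divr_gt0// mulr_gt0// -sqrt_inv_width ?gtr0_norm// sqrtr_gt0; lra.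
  by lra.
(* Here [r^2 < 2] enters: it makes [cos a] positive, so [a] is on the branch where [atan] inverts
   [tan]. *)
have api : a r < pi / 2.
  rewrite ltNge; apply/negP => ha; move: c0; rewrite ltNge => /negP; apply.
  have hb : a r <= pi.
    have := asin_lepi2 rI.
    by rewrite /a; move: (@pi R) => p; lra.
  rewrite -oppr_ge0 -[a r](subrK pi) cosDpi opprK cos_ge0_pihalf//.
  by apply/andP; split; lra.
rewrite -[in RHS](tanK (x := a r)); last first.
  by rewrite in_itv/= api andbT (lt_le_trans _ a0)// oppr_lt0 divr_gt0// pi_gt0.
rewrite -atanN; congr atan; rewrite /tan sa ca; field.
by apply/andP; split; apply/eqP; lra.
Qed.

Lemma frakC_formulaE r : 0 < r -> r ^+ 2 < 2 -> frakC_formula r = F r.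
Proof.
move=> r0 r2.
have rlt2 : r < 2 by rewrite -(@ltr_pXn2r _ 2) ?nnegrE ?(ltW r0)//; apply: lt_trans r2 _; rewrite expr2; lra.
rewrite frakC_smoothE ?gt_eqF// /frakC_formula atan_chord_angle// sqrt_inv_width ?gtr0_norm// /numer.
have p0 : pi != 0 :> R by rewrite gt_eqF ?pi_gt0.
move: (@pi R) p0 (w r) (a r) => p p0 W A.
by field; rewrite p0 gt_eqF.
Qed.

Lemma frakCE r : 0 <= r -> r ^+ 2 < 2 -> frakC r = F r.
Proof.
rewrite le_eqVlt => /predU1P[<- _|r0 r2]; last by rewrite /frakC gt_eqF// frakC_formulaE.
rewrite /frakC eqxx; apply/cvg_lim => //.
have c : F s @[s --> 0^'+] --> F 0.
  by apply: cvg_at_right_filter; apply: continuous_frakC; rewrite normr0.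
apply: cvg_trans c; apply: near_eq_cvg; near=> s.
rewrite frakC_formulaE//.
apply: (@lt_trans _ _ 1) => //; last by rewrite ltr1n.
by rewrite expr_lt1// ltW.
Unshelve. all: by end_near. Qed.

End FrakC.

(** * The constant as a bijection with a smooth inverse *)

Section FrakCDiffeomorphism.
Context {R : realType}.
Local Notation F := (@frakC_smooth R).
Local Notation q := (3 / 2 : R).

Lemma frakC0E : @frakC R 0 = 16 / (3 * pi).
Proof. by rewrite frakCE ?frakC_smooth0// expr0n. Qed.

Lemma frakC1E : @frakC R 1 = 3 * Num.sqrt 3 / pi.
Proof.
rewrite /frakC oner_eq0 /frakC_formula !expr1n subrr mulr0 mul0r addr0 mulr1 mul1r.
have -> : 4 - 1 = 3 :> R by ring.
have -> : 2 + 1 = 3 :> R by ring.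
by rewrite [Num.sqrt 3 * 3]mulrC.
Qed.

Let unit_frakCE (x : R) : 0 <= x <= 1 -> frakC x = F x.
Proof.
move=> /andP[x0 x1]; rewrite frakCE//; apply: (@le_lt_trans _ _ 1); last by rewrite ltr1n.
by rewrite expr_le1.
Qed.

Lemma frakC_strictly_decreasing : {in `[0, 1] &, {homo @frakC R : r s /~ r < s}}.
Proof.
move=> r s; rewrite !in_itv/= => rI sI sr.
rewrite !unit_frakCE// frakC_decreasing//; first by case/andP: sI.
by case/andP: rI => _ /le_lt_trans; apply; rewrite ltr1n.
Qed.

Lemma frakC_inverse : exists g : R -> R,
  [/\ {in `[0, q], cancel F g}, {in `[F q, F 0], cancel g F},
      {within `[F q, F 0], continuous g} & forall y, y \in `[F q, F 0] -> 0 <= g y <= q].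
Proof.
have q0 : 0 <= q by rewrite divr_ge0.
have q2 : q < 2 by rewrite ltr_pdivrMr//; lra.
have cF : {within `[0, q], continuous F}.
  apply: continuous_within => x /=; rewrite in_itv/= => /andP[x0 xq].
  by apply: continuous_frakC; rewrite ger0_norm// (le_lt_trans xq).
have iF x z : 0 <= x <= q -> 0 <= z <= q -> F x = F z -> x = z.
  move=> /andP[x0 xq] /andP[z0 zq] xz; have [h|h|//] := ltgtP x z.
    by have := frakC_decreasing x0 h (le_lt_trans zq q2); rewrite xz ltxx.
  by have := frakC_decreasing z0 h (le_lt_trans xq q2); rewrite xz ltxx.
have [g gP] : exists g : R -> R, forall y, (exists2 x, 0 <= x <= q & F x = y) -> 0 <= g y <= q /\ F (g y) = y.
  have H y : exists x : R, (exists2 x, 0 <= x <= q & F x = y) -> 0 <= x <= q /\ F x = y.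
    have [[x xq xy]|nx] := pselect (exists2 x, 0 <= x <= q & F x = y); last by exists 0.
    by exists x.
  by have [g gP] := choice H; exists g.
have gF : {in `[0, q], cancel F g}.
  move=> x; rewrite in_itv/= => xI; have [gI gE] := gP (F x) (ex_intro2 _ _ x xI erefl).
  exact: iF.
have Fg : {in `[F q, F 0], cancel g F} := segment_continuous_ge_can_sym q0 cF gF.
exists g; split => //; first exact: segment_can_ge_continuous.
move=> y yI.
have [x xI <-] : exists2 x, x \in `[0, q] & F x = y.
  move: yI; rewrite in_itv/= => /andP[y1 y2].
  apply: (IVT q0 cF); rewrite ge_min le_max.
  by rewrite y1 y2 orbT.
by move: xI; rewrite in_itv/= => xI; have [] := gP (F x) (ex_intro2 _ _ x xI erefl).
Qed.

Let gt_frakC1 : F q < F 1.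
Proof. by apply: frakC_decreasing => //; lra. Qed.

Let frakC_bij (A B : set R) :
  (forall x, A x -> 0 <= x <= 1) -> (forall x, A x -> B (F x)) ->
  (forall y, B y -> exists2 x, A x & F x = y) -> set_bij A B (@frakC R).
Proof.
move=> A01 AB BA; split.
- by move=> x Ax /=; rewrite unit_frakCE; [exact: AB|exact: A01].
- move=> x y; rewrite !inE => Ax Ay; rewrite !unit_frakCE; [move=> xy|exact: A01..].
  have /andP[x0 x1] := A01 _ Ax; have /andP[y0 y1] := A01 _ Ay.
  have [h|h|//] := ltgtP x y.
    by have := frakC_decreasing x0 h (le_lt_trans y1 (ltr1n _ 2)); rewrite xy ltxx.
  by have := frakC_decreasing y0 h (le_lt_trans x1 (ltr1n _ 2)); rewrite xy ltxx.
- by move=> y /BA[x Ax <-]; exists x => //; rewrite unit_frakCE; [by []|exact: A01].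
Qed.

Let mem_range x : 0 <= x <= 1 -> F 1 <= F x <= F 0.
Proof.
move=> /andP[x0 x1]; apply/andP; split.
- move: x1; rewrite le_eqVlt => /predU1P[->//|x1].
  by rewrite ltW// frakC_decreasing// ltr1n.
- move: x0; rewrite le_eqVlt => /predU1P[<-//|x0].
  by rewrite ltW// frakC_decreasing// (le_lt_trans x1)// ltr1n.
Qed.

Let range_mem y : F 1 <= y <= F 0 -> exists2 x, 0 <= x <= 1 & F x = y.
Proof.
move=> /andP[y1 y0].
have c : {within `[0, 1], continuous F}.
  apply: continuous_within => x /=; rewrite in_itv/= => /andP[x0 x1].
  by apply: continuous_frakC; rewrite ger0_norm// (le_lt_trans x1)// ltr1n.
have [x xI <-] : exists2 x, x \in `[0, 1] & F x = y.
  by apply: (IVT ler01 c); rewrite ge_min le_max y1 y0 orbT.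
by exists x => //; move: xI; rewrite in_itv.
Qed.

Let within_frakC (A : set R) f : {within A, continuous F} -> (forall x, A x -> f x = F x) ->
  {within A, continuous f}.
Proof.
move=> c fF; apply: subspace_eq_continuous c => x; rewrite inE => /fF.
by [].
Qed.

Lemma frakC_homeomorphism : homeomorphism_on `[0, 1] `[F 1, F 0] (@frakC R).
Proof.
have [g [gF Fg cg gI]] := frakC_inverse.
have q01 (x : R) : 0 <= x <= 1 -> 0 <= x <= q by move=> /andP[-> /=]; lra.
split.
- apply: frakC_bij => [x|x|y] /=; rewrite ?in_itv//= ?in_itv/=.
  + exact: mem_range.
  + by move=> /range_mem[x xI xy]; exists x; rewrite ?in_itv.
- apply: (within_frakC (A := `[0, 1]%classic)); last first.
    by move=> x /=; rewrite in_itv/= => /unit_frakCE.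
  apply: continuous_within => x /=; rewrite in_itv/= => /andP[x0 x1].
  by apply: continuous_frakC; rewrite ger0_norm// (le_lt_trans x1)// ltr1n.
- exists g; split.
    move=> x /=; rewrite in_itv/= => xI; rewrite unit_frakCE// gF// in_itv/=.
    exact: q01.
  apply: continuous_subspaceW cg => y /=; rewrite !in_itv/= => /andP[y1 y0].
  by rewrite y0 (le_trans (ltW gt_frakC1)).
Qed.

Lemma frakC_smooth_on (A : set R) : (forall x, A x -> 0 <= x <= 1) -> smooth_on A (@frakC R).
Proof.
move=> A01 x Ax; exists [set r | `|r| < 2], F; split.
- exact: open_interval2.
- by have /andP[x0 x1] := A01 x Ax; rewrite /= ger0_norm// (le_lt_trans x1)// ltr1n.
- by move=> k y y2; exact: smooth_frakC.
- by move=> y _ Ay; rewrite unit_frakCE// A01.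
Qed.

(** The derivative of [F] is negative on []0, 2[], so [smooth_inverse_function] applies on []F q, F
    0[], an open interval that contains [F 1] but not [F 0]. *)
Lemma frakC_diffeomorphism : diffeomorphism_on `]0, 1] `[F 1, F 0[ (@frakC R).
Proof.
have [g [gF Fg cg gI]] := frakC_inverse.
have q01 (x : R) : 0 <= x <= 1 -> 0 <= x <= q by move=> /andP[-> /=]; lra.
have q2 : q < 2 by rewrite ltr_pdivrMr//; lra.
have gI' y : F q < y < F 0 -> 0 < g y < q.
  move=> /andP[y1 y0]; have yI : y \in `[F q, F 0] by rewrite in_itv/= !ltW.
  have /andP[g0 gq] := gI y yI; have E := Fg y yI; apply/andP; split.
  - by rewrite lt_neqAle g0 andbT; apply/eqP => h; move: y0; rewrite -E -h ltxx.
  - by rewrite lt_neqAle gq andbT; apply/eqP => h; move: y1; rewrite -E h ltxx.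
have gd (y : R) : F q < y < F 0 -> 0 < g y < 2.
  by move=> /gI'/andP[-> h]; exact: lt_trans h q2.
split.
- apply: frakC_bij => [x|x|y] /=; rewrite ?in_itv//= ?in_itv/=.
  + by move=> /andP[/ltW -> ->].
  + move=> /andP[x0 x1]; have /andP[-> _] /= := mem_range (introT andP (conj (ltW x0) x1)).
    by rewrite frakC_decreasing// (le_lt_trans x1)// ltr1n.
  + move=> /andP[y1 y0]; have /range_mem[x /andP[x0 x1] xy] : F 1 <= y <= F 0 by rewrite y1 ltW.
    exists x => //; rewrite in_itv/= x1 andbT lt_neqAle x0 andbT.
    by apply/eqP => h; move: y0; rewrite -xy -h ltxx.
- by apply: frakC_smooth_on => x /=; rewrite in_itv/= => /andP[/ltW -> ->].
- exists g; split.
    move=> x /=; rewrite in_itv/= => /andP[/ltW x0 x1]; rewrite unit_frakCE ?x0// gF// in_itv/=.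
    by apply: q01; rewrite x0.
  have V : smooth `]F q, F 0[%classic g.
    apply: (@smooth_inverse_function R [set r | `|r| < 2] _ g F).
    + exact: interval_open.
    + exact: smooth_frakC.
    + move=> y /=; rewrite in_itv/= => /gd/andP[g0 g2]; by rewrite gtr0_norm.
    + by move=> y /=; rewrite in_itv/= => /gd g2; rewrite lt_eqF// frakC_derive_lt0.
    + move=> y /=; rewrite in_itv/= => yI; have g2 := gd y yI.
      have yI' : y \in `[F q, F 0] by case/andP: yI => *; rewrite in_itv/= !ltW.
      have gn : `|g y| < 2 by case/andP: g2 => g0 ?; rewrite gtr0_norm.
      rewrite -{1}(Fg y yI'); apply: is_derive_inverse.
      * have : \forall x \near g y, x \in `]0, q[ by apply: near_in_itvoo; rewrite in_itv/=; exact: gI'.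
        by apply: filterS => x; rewrite in_itv/= => /andP[/ltW x0 /ltW xq]; rewrite gF// in_itv/= x0.
      * have : \forall x \near g y, x \in `]0, 2[ by apply: near_in_itvoo; rewrite in_itv/=.
        apply: filterS => x; rewrite in_itv/= => /andP[x0 x2].
        by apply: continuous_frakC; rewrite gtr0_norm.
      * exact: smooth_der smooth_frakC gn.
      * by rewrite lt_eqF// frakC_derive_lt0.
  move=> y /=; rewrite in_itv/= => /andP[y1 y0]; exists `]F q, F 0[%classic, g; split => //.
  by rewrite /= in_itv/= y0 andbT (lt_le_trans gt_frakC1).
Qed.

End FrakCDiffeomorphism.

(** * The sharp gradient estimate *)

Section SharpKernel.
Context {R : realType}.
Local Notation V := ('rV[R]_4).
Local Notation sqn y := (dot y y).
Local Notation E f := (\int[@sphere_prob R]_w f w).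
Local Notation mu := (@lebesgue_measure R).

Definition adjoint_isometries (A B : V -> V) :=
  [/\ (forall z z', dot z (A z') = dot (B z) z'),
      (forall z z', dot (A z) (A z') = dot z z') &
      (forall z z', dot (B z) (B z') = dot z z')].

Let normB0 (B : V -> V) : (forall z z', dot (B z) (B z') = dot z z') -> B 0 = 0.
Proof. by move=> BB; apply/eqP; rewrite -sqn_eq0 BB dot0l. Qed.

Lemma frame_pair (y l : V) : sqn l = 1 -> exists A B : V -> V, adjoint_isometries A B /\
  exists l1 l2 : R, [/\ 0 <= l2, l1 ^+ 2 + l2 ^+ 2 = 1, B y = euclidean_norm y *: delta_mx 0 0,
    B l = l1 *: delta_mx 0 0 + l2 *: delta_mx 0 1 & l1 * euclidean_norm y = dot l y].
Proof.
move=> l1; have [A [B [AB AA BB By [l2 l20 [m Bl]]]]] := frame y l.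
exists A, B; split=> //; exists m, l2; split => //.
- rewrite -l1 -BB Bl dotDl !dotZl !dotDr !dotZr !dot_delta !mxE/=; ring.
- by rewrite -BB By Bl dotDl !dotZl !dotZr !dot_delta !mxE/=; ring.
Qed.

Let sqn_lt1 (y : V) : sqn y < 1 -> 0 <= euclidean_norm y < 1.
Proof. by move=> /unit_ballE y1; rewrite euclidean_norm_ge0. Qed.

Let expectation_frame A B (y l : V) (r l1 l2 : R) : adjoint_isometries A B -> sqn y < 1 ->
  0 <= r < 1 -> 0 <= l2 ->
  B y = r *: delta_mx 0 0 -> B l = l1 *: delta_mx 0 0 + l2 *: delta_mx 0 1 ->
  E (fun w => `|directional_kernel l y (A (sphere_point w))| * sphere_density w) =
  4 / pi * fine (\int[mu]_(x in `[0%R, pi]) (polar_density r l1 l2 x)%:E)%E.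
Proof.
move=> [AB AA BB] y1 r01 l20 By Bl; have [_ <-] := @frame_kernel_expectation R r l1 l2 r01 l20.
by apply: eq_Rintegral => w _; rewrite (directional_kernel_frame w AB AA BB y1 By Bl).
Qed.

(** At [y = 0] the polar axis is taken along [l], so that [l1 = 1] and [l2 = 0]. *)
Let center A B (l : V) : adjoint_isometries A B -> B l = delta_mx 0 0 ->
  E (fun w => `|directional_kernel l 0 (A (sphere_point w))| * sphere_density w) = @frakC R 0.
Proof.
move=> AB Bl; have [_ _ BB] := AB.
have B0 : B 0 = 0 *: delta_mx 0 0 by rewrite scale0r normB0.
have Bl' : B l = 1 *: delta_mx 0 0 + 0 *: delta_mx 0 1 by rewrite scale1r scale0r addr0.
rewrite (expectation_frame AB _ _ _ B0 Bl') ?dot0l ?lexx ?ltr01//.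
rewrite polar_density_center frakC0E/= invfM.
have p0 : pi != 0 :> R by rewrite gt_eqF ?pi_gt0.
by move: (@pi R) p0 => p p0; field.
Qed.

Lemma kernel_expectation_le (y l : V) : sqn y < 1 -> sqn l = 1 -> exists A B : V -> V,
  adjoint_isometries A B /\
  E (fun w => `|directional_kernel l y (A (sphere_point w))| * sphere_density w) <=
  frakC (euclidean_norm y) / (1 - euclidean_norm y ^+ 2).
Proof.
move=> y1 l1; have [->|y0] := eqVneq y 0.
  have [A [B [AB [m [l2 [_ _ Bl _ _]]]]]] := frame_pair l l1.
  have n0 : euclidean_norm (0 : V) = 0 by rewrite euclidean_normE dot0l sqrtr0.
  exists A, B; split => //; rewrite (center AB).
    by rewrite n0 expr0n/= subr0 divr1.
  by rewrite Bl euclidean_normE l1 sqrtr1 scale1r.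
have [A [B [AB [m [l2 [l20 ml By Bl _]]]]]] := frame_pair y l1.
exists A, B; split=> //; have r01 := sqn_lt1 y1; have /andP[r0 r1] := r01.
have r0' : 0 < euclidean_norm y < 1.
  by rewrite r1 lt_neqAle r0 andbT euclidean_normE eq_sym gt_eqF// sqrtr_gt0 lt_def sqn_ge0 sqn_eq0 y0.
rewrite (expectation_frame AB y1 r01 l20 By Bl).
have [I0 _] := @frame_kernel_expectation R _ m l2 r01 l20.
(* The bound is stated for [l1 >= 0], whereas [m] may be negative; [polar_density] depends on [l1]
   through its absolute value only. *)
have I1 := @polar_density_le R _ `|m| l2 r0' (normr_ge0 m) l20.
rewrite real_normK ?num_real// in I1; have {}I1 := I1 ml.
have pE : polar_density (euclidean_norm y) `|m| l2 = polar_density (euclidean_norm y) m l2.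
  by apply/funext => x; rewrite /polar_density !normrM normr_id.
rewrite pE in I1; set I := (\int[_]_(_ in _) _)%E in I0 I1 *.
have If : (I \is a fin_num) by rewrite ge0_fin_numE// (le_lt_trans I1)// ltry.
have /andP[r0'' _] := r0'.
rewrite /frakC gt_eqF//.
move: I1; rewrite -(fineK If) lee_fin => I1.
rewrite mulrAC ler_pdivrMr ?pi_gt0//.
move: I1; move: (frakC_formula _ / _) (fine I) (@pi R) => c i p h; have -> : c * p = 4 * (p / 4 * c) by field. rewrite ler_pM2l//.
Qed.

Lemma kernel_expectation_radial (y : V) : sqn y < 1 -> exists l : V, sqn l = 1 /\
  exists A B : V -> V, adjoint_isometries A B /\
  E (fun w => `|directional_kernel l y (A (sphere_point w))| * sphere_density w) =
  frakC (euclidean_norm y) / (1 - euclidean_norm y ^+ 2).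
Proof.
move=> y1; have [->|y0] := eqVneq y 0.
  pose l : V := delta_mx 0 0.
  have l1 : sqn l = 1 by rewrite dot_delta mxE !eqxx.
  exists l; split => //; have [A [B [AB [m [l2 [_ _ Bl _ _]]]]]] := frame_pair l l1.
  have n0 : euclidean_norm (0 : V) = 0 by rewrite euclidean_normE dot0l sqrtr0.
  exists A, B; split => //; rewrite (center AB).
    by rewrite n0 expr0n/= subr0 divr1.
  by rewrite Bl euclidean_normE l1 sqrtr1 scale1r.
have r01 := sqn_lt1 y1; have /andP[r0 r1] := r01.
have r0'' : 0 < euclidean_norm y.
  by rewrite lt_neqAle r0 andbT euclidean_normE eq_sym gt_eqF// sqrtr_gt0 lt_def sqn_ge0 sqn_eq0 y0.
pose l := (euclidean_norm y)^-1 *: y.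
have ly : dot l y = euclidean_norm y.
  by rewrite dotZl -euclidean_norm_sqr expr2 mulKf// gt_eqF.
have l1 : sqn l = 1 by rewrite {2}/l dotZr ly mulVf// gt_eqF.
exists l; split => //.
have [A [B [AB [m [l2 [l20 ml By Bl mr]]]]]] := frame_pair y l1.
have m1 : m = 1 by apply: (mulIf (lt0r_neq0 r0'')); rewrite mr ly mul1r.
have l20' : l2 = 0.
  by apply/eqP; rewrite -sqrf_eq0; move: ml; rewrite m1 expr1n => /eqP; rewrite -subr_eq0 addrC addKr.
exists A, B; split => //.
rewrite (expectation_frame AB y1 r01 l20 By Bl) m1 l20' polar_density_radial ?r0''// /frakC gt_eqF//=.
have p0 : pi != 0 :> R by rewrite gt_eqF ?pi_gt0.
by move: (frakC_formula _ / _) (@pi R) p0 => c p p0; field.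
Qed.

End SharpKernel.

Section RotatedPoisson.
Context {R : realType}.
Local Notation V := ('rV[R]_4).
Local Notation sqn y := (dot y y).
Local Notation T := ((measurableTypeR R * measurableTypeR R) * measurableTypeR R)%type.
Local Notation P := (@sphere_prob R).
Local Notation E f := (\int[P]_w f w).
Local Notation W := (@sphere_density R).
Variables A B : V -> V.
Hypothesis AB : adjoint_isometries A B.
Local Notation eta w := (A (sphere_point w)).

Lemma measurable_rotated i : measurable_fun [set: T] (fun w => eta w 0 i).
Proof.
have [ab _ _] := AB; under eq_fun do rewrite -dot_delta ab.
exact: (measurable_dot_eta (@measurable_sphere_point R)).
Qed.

Lemma rotated_norm w : sqn (eta w) = 1.
Proof. by have [_ aa _] := AB; rewrite aa sphere_point_norm. Qed.

(** The rotated kernel at [y] is the original one at [B y], since [y . A e = B y . e] and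
    [|B y| = |y|]. *)
Lemma rotated_poisson_expectation (y : V) : sqn y < 1 -> E (fun w => poisson y (eta w) * W w) = 1.
Proof.
have [ab _ bb] := AB; rewrite -bb => y1; rewrite -(poisson_expectation y1).
by apply: eq_Rintegral => w _; rewrite /poisson ab bb.
Qed.

Lemma measurable_directional_kernel (l y : V) :
  measurable_fun [set: T] (fun w => directional_kernel l y (eta w)).
Proof.
apply: measurable_sum => i; apply: meas_mul; first exact: meas_cst.
exact: (measurable_poisson1 measurable_rotated).
Qed.

Lemma bounded_directional_kernel (l : V) (b : R) : b < 1 ->
  bounded_fun (ball_sphere b) (fun p : V * V => directional_kernel l p.1 p.2).
Proof.
move=> b1; have H i := bounded_poisson1 b1 i.
rewrite /directional_kernel; under eq_fun do rewrite !big_ord_recl big_ord0.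
have H0 := H ord0; have H1 := H (lift ord0 ord0); have H2 := H (lift ord0 (lift ord0 ord0)).
by have H3 := H (lift ord0 (lift ord0 (lift ord0 ord0))); bd.
Qed.

Lemma poisson_integral_gradient (f : T -> R) (M : R) (l y : V) :
  measurable_fun [set: T] f -> (forall w, `|f w| <= M) -> sqn y < 1 ->
  dot l (gradient (poisson_integral P (fun w => eta w) f) y) =
  E (fun w => directional_kernel l y (eta w) * f w).
Proof.
move=> mf fM y1.
have I i : P.-integrable [set: T] (EFin \o (fun w => poisson1 i y (eta w) * f w)).
  apply: (integrable_kernel P rotated_norm mf fM (q := poisson1 i)) => //.
    by move=> z; exact: (measurable_poisson1 measurable_rotated).
  by move=> b b1; exact: bounded_poisson1.
transitivity (\sum_i E (fun w => l 0 i * (poisson1 i y (eta w) * f w))).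
  apply: eq_bigr => i _; rewrite RintegralZl//; congr (_ * _).
  by rewrite mxE /partial; have [_ ->] := poisson_integral_partial P measurable_rotated rotated_norm mf fM i y1.
rewrite -expectation_sum; last by move=> i; exact: integrable_scale.
apply: eq_Rintegral => w _; rewrite /directional_kernel mulr_suml.
by apply: eq_bigr => i _; rewrite mulrA.
Qed.

Lemma gradient_near (u v : V -> R) (y : V) : (\forall z \near y, u z = v z) ->
  (forall i, derivable v y (delta_mx 0 i)) -> gradient u y = gradient v y.
Proof.
move=> uv dv; apply/rowP => i; rewrite !mxE /partial.
have /derivableP D := dv i.
have : is_derive y (delta_mx 0 i) u ('D_(delta_mx 0 i) v y).
  by apply: near_eq_is_derive D; apply: filterS uv => z ->.
by move=> [_ ->].
Qed.

Lemma gradient_kernel (v : V -> R) (l y : V) :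
  harmonic_on (@unit_ball R 4) v -> (forall z, sqn z <= 1 -> {for z, continuous v}) ->
  sqn y < 1 -> dot l (gradient v y) =
  E (fun w => directional_kernel l y (eta w) * (v (eta w) * W w)).
Proof.
move=> hv cv y1.
have mv : measurable_fun [set: T] (fun w => v (eta w)).
  apply: measurable_comp_continuous; first exact: measurable_rotated.
  by move=> w; apply: cv; rewrite rotated_norm.
have [M HM] := continuous_ball_bounded cv.
have mf : measurable_fun [set: T] (fun w => v (eta w) * W w).
  by apply: meas_mul => //; exact: measurable_sphere_density.
have fM w : `|v (eta w) * W w| <= M * pi.
  rewrite normrM ler_pM ?HM ?rotated_norm// ger0_norm ?sphere_density_ge0//.
  exact: sphere_density_le.
rewrite -(poisson_integral_gradient l mf fM y1); congr (dot _ _).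
apply: gradient_near.
  apply: filterS (near_sqn_lt y1) => z z1.
  apply: (poisson_representation measurable_rotated rotated_norm (@measurable_sphere_density R)
    (@sphere_density_ge0 R) (@sphere_density_le R)) => //.
  exact: rotated_poisson_expectation.
by move=> i; have [] := poisson_integral_partial P measurable_rotated rotated_norm mf fM i y1.
Qed.

End RotatedPoisson.

Section GradientEstimate.
Context {R : realType}.
Local Notation V := ('rV[R]_4).
Local Notation sqn y := (dot y y).
Local Notation T := ((measurableTypeR R * measurableTypeR R) * measurableTypeR R)%type.
Local Notation P := (@sphere_prob R).
Local Notation E f := (\int[P]_w f w).
Local Notation W := (@sphere_density R).

Lemma gradient_le (v : V -> R) (M : R) (l y : V) : harmonic_on (@unit_ball R 4) v ->
  (forall z, sqn z <= 1 -> {for z, continuous v}) -> (forall z, sqn z <= 1 -> `|v z| <= M) ->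
  sqn y < 1 -> sqn l = 1 ->
  dot l (gradient v y) <= frakC (euclidean_norm y) / (1 - euclidean_norm y ^+ 2) * M.
Proof.
move=> hv cv vM y1 l1; have [A [B [AB KC]]] := kernel_expectation_le y1 l1.
have M0 : 0 <= M by apply: le_trans (vM 0 _); rewrite ?normr_ge0// dot0l.
rewrite (gradient_kernel AB l hv cv y1).
have RN := rotated_norm AB.
pose K w := directional_kernel l y (A (sphere_point w)).
have mK : measurable_fun [set: T] K := measurable_directional_kernel AB l y.
have mW := @measurable_sphere_density R.
have WM (w : T) : `|W w| <= pi by rewrite ger0_norm ?sphere_density_ge0 ?sphere_density_le.
have [k Hk] : exists k, forall w, `|K w| <= k.
  have [k Hk] := bounded_directional_kernel l y1; exists k => w.
  by apply: (Hk (y, A (sphere_point w))); split => //=; rewrite RN.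
have mv : measurable_fun [set: T] (fun w => v (A (sphere_point w))).
  apply: measurable_comp_continuous; first exact: (measurable_rotated AB).
  by move=> w; apply: cv; rewrite RN.
have I1 : P.-integrable [set: T] (EFin \o (fun w => `|K w| * W w)).
  apply: (@bounded_integrable _ _ _ _ _ (k * pi)) => [|w]; first by meas.
  by rewrite normrM normr_id ler_pM.
apply: le_trans (_ : M * E (fun w => `|K w| * W w) <= _); last by rewrite mulrC ler_wpM2r.
rewrite -RintegralZl//; apply: le_Rintegral => //.
- apply: (@bounded_integrable _ _ _ _ _ (k * (M * pi))) => [|w].
    by apply: meas_mul => //; exact: meas_mul.
  by rewrite -/(K w) normrM ler_pM// normrM ler_pM// vM// RN.
- exact: integrable_scale.
move=> w _; apply: le_trans (ler_norm _) _.
rewrite -/(K w) normrM (normrM (v _)) (ger0_norm (sphere_density_ge0 w)) mulrCA.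
by apply: ler_wpM2r; [rewrite mulr_ge0 ?sphere_density_ge0|rewrite vM ?RN].
Qed.

Lemma frakC_gt0 (r : R) : 0 <= r <= 1 -> 0 < @frakC R r.
Proof.
move=> /andP[r0 r1]; have F1 : 0 < @frakC R 1.
  by rewrite frakC1E divr_gt0 ?pi_gt0// mulr_gt0// sqrtr_gt0.
move: r1; rewrite le_eqVlt => /predU1P[->//|r1]; apply: lt_trans F1 _.
by apply: frakC_strictly_decreasing; rewrite ?in_itv/= ?lexx ?ler01// r0 ltW.
Qed.

Lemma sharp_bound (x : V) (c' : R) : unit_ball x -> gradient_bound x c' ->
  frakC (euclidean_norm x) / (1 - euclidean_norm x ^+ 2) <= c'.
Proof.
move=> /unit_ballE x1 Hc'; have [l [l1 [A [B [AB KE]]]]] := kernel_expectation_radial x1.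
set c := frakC _ / _ in KE *.
have c0 : 0 < c.
  have r0 := euclidean_norm_ge0 x.
  have r1 : euclidean_norm x < 1 by move/unit_ballE : x1.
  by rewrite divr_gt0 ?frakC_gt0 ?r0 ?(ltW r1)// subr_gt0 expr_lt1.
pose K w := directional_kernel l x (A (sphere_point w)).
have mK : measurable_fun [set: T] K := measurable_directional_kernel AB l x.
have mW := @measurable_sphere_density R.
(* The sign is taken to be 1 at zeros of [K], so that [|f| = W] everywhere and the Poisson integral
   is bounded by 1. *)
pose f w := (if 0 <= K w then 1 else -1) * W w.
have mf : measurable_fun [set: T] f.
  by apply: meas_mul => //; apply: meas_if; [apply: meas_le => //; exact: meas_cst|exact: meas_cst..].
have fW w : `|f w| = W w.
  rewrite normrM (ger0_norm (sphere_density_ge0 w)).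
  by case: ifP => _; rewrite ?normrN normr1 mul1r.
have fM w : `|f w| <= pi by rewrite fW sphere_density_le.
pose u := poisson_integral P (fun w => A (sphere_point w)) f.
have meta := measurable_rotated AB; have eta1 := rotated_norm AB.
have hu : harmonic_on (@unit_ball R 4) u := poisson_integral_harmonic P meta eta1 mf fM.
have u1 y : unit_ball y -> `|u y| <= 1.
  move=> /unit_ballE y1; rewrite -(rotated_poisson_expectation AB y1).
  have I : P.-integrable [set: T] (EFin \o (fun w => poisson y (A (sphere_point w)) * f w)).
    apply: (integrable_kernel P eta1 mf fM (q := poisson)) => //.
      by move=> z; exact: (measurable_poisson meta).
    by move=> b b1; exact: bounded_poisson.
  apply: le_trans (le_normr_Rintegral _ I) _ => //.
  rewrite le_eqVlt; apply/orP; left; apply/eqP; apply: eq_Rintegral => w _.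
  by rewrite normrM fW gtr0_norm// poisson_gt0.
have Hu : hardy_infty u by split => //; exists 1.
have s1 : sup_norm_on (@unit_ball R 4) u <= 1.
  apply: ge_sup; last by move=> _ [y /u1 y1 <-].
  by exists `|u 0|; exists 0 => //; apply/unit_ballE; rewrite dot0l.
have s0 : 0 <= sup_norm_on (@unit_ball R 4) u.
  apply: le_trans (normr_ge0 (u 0)) _; apply: ub_le_sup.
    by exists 1 => _ [y /u1 y1 <-].
  by exists 0 => //; apply/unit_ballE; rewrite dot0l.
have gE : dot l (gradient u x) = c.
  rewrite (poisson_integral_gradient AB l mf fM x1) -KE.
  apply: eq_Rintegral => w _; rewrite /f -/(K w) mulrA; congr (_ * _).
  by case: (leP 0 (K w)) => k0; [rewrite mulr1 ger0_norm|rewrite mulrN1 ltr0_norm].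
have cg : c <= euclidean_norm (gradient u x).
  rewrite -gE; apply: le_trans (ler_norm _) _.
  rewrite -sqrtr_sqr euclidean_normE ler_wsqrtr//.
  by have := cauchy_schwarz l (gradient u x); rewrite l1 mul1r.
have := le_trans cg (Hc' u Hu).
(* Of the sup norm of [u] only the bounds 0 and 1 are known, so the sign of [c'] matters; a negative
   [c'] contradicts [c > 0]. *)
have [c'0|c'0] := leP 0 c'; first by move=> /le_trans; apply; rewrite ler_piMr.
by move=> /(lt_le_trans c0); rewrite ltNge mulr_le0_ge0// ltW.
Qed.

End GradientEstimate.

(** * Dilations of harmonic functions *)

Section Scaling.
Context {R : realType} {n : nat}.
Local Notation V := ('rV[R]_n.+1).
Local Notation sqn y := (dot y y).
Local Notation D := (@unit_ball R n.+1).
Implicit Types (u v : V -> R) (z : V) (c : R).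

Lemma partial_scale (i : 'I_n.+1) c u z : derivable u (c *: z) (delta_mx 0 i) ->
  is_derive z (delta_mx 0 i) (fun z => u (c *: z)) (c * partial i u (c *: z)).
Proof.
move=> /derivableP du; apply/is_derive_line0.
pose f (t : R) := u (t *: delta_mx 0 i + c *: z).
have df : der (c * 0) f (partial i u (c *: z)).
  by rewrite mulr0; exact: (is_derive_line0 _ _ _ _).1 du.
have dc : der (0 : R) (fun s => c * s) c by derive; rewrite mul0r add0r mulr1.
apply: (@der_ext _ _ (fun s => f (c * s))).
  by move=> s; rewrite /f scalerDr scalerA.
by rewrite mulrC; exact: (@der_comp R (fun s => c * s) f 0 c _ df dc).
Qed.

Lemma continuous_scale c u z : {for c *: z, continuous u} -> {for z, continuous (fun z => u (c *: z))}.
Proof.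
move=> cu; have cs : (fun z : V => c *: z) x @[x --> z] --> c *: z by exact: scaler_continuous.
exact: (cvg_comp _ _ cs cu).
Qed.

Lemma C1_on_eq u v : (forall z, D z -> u z = v z) -> C1_on D v ->
  C1_on D u /\ forall i z, D z -> partial i u z = partial i v z.
Proof.
move=> uv Cv.
have N z : D z -> \forall x \near z, u x = v x.
  by move=> /unit_ballE z1; apply: filterS (near_sqn_lt z1) => x /unit_ballE /uv.
have P i z : D z -> is_derive z (delta_mx 0 i) u (partial i v z).
  move=> Dz; have [_ /(_ i) [/derivableP dv _]] := Cv z Dz.
  by apply: near_eq_is_derive dv; apply: filterS (N z Dz) => x ->.
have PE i z : D z -> partial i u z = partial i v z by move=> /(P i) [_ <-].
split; last exact: PE.
move=> z Dz; have [cv dcv] := Cv z Dz; split.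
  by apply: (continuous_near_eq _ cv); apply: filterS (N z Dz) => x ->.
move=> i; have [_ cp] := dcv i; split; first by have [] := P i z Dz.
apply: (continuous_near_eq _ cp); move/unit_ballE : Dz => z1.
by apply: filterS (near_sqn_lt z1) => x /unit_ballE /PE ->.
Qed.

(** The factor [a] makes the lemma apply to its own outcome: a partial derivative of a dilated
    function is again a multiple of a dilated function, which gives the second derivatives. *)
Lemma C1_on_dilation a c u : `|c| <= 1 -> C1_on D u ->
  C1_on D (fun z => a * u (c *: z)) /\
  forall i z, D z -> partial i (fun z => a * u (c *: z)) z = a * c * partial i u (c *: z).
Proof.
move=> c1 Cu.
have Dc z : D z -> D (c *: z).
  move=> /unit_ballE z1; apply/unit_ballE; rewrite dotZl dotZr mulrA -expr2.
  apply: le_lt_trans z1; rewrite ler_piMl ?sqn_ge0//.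
  by rewrite -(real_normK (num_real c)) expr_le1.
have P i z : D z -> is_derive z (delta_mx 0 i) (fun z => a * u (c *: z)) (a * c * partial i u (c *: z)).
  move=> /Dc Dz; have [_ /(_ i) [du _]] := Cu _ Dz.
  have /is_derive_line0 d := partial_scale du; apply/is_derive_line0.
  by apply: (der_eq (der_mul (der_cst a 0) d)); rewrite mul0r add0r mulrA.
have PE i z : D z -> partial i (fun z => a * u (c *: z)) z = a * c * partial i u (c *: z).
  by move=> /(P i) [_ <-].
split; last exact: PE.
move=> z Dz; have [cu dcu] := Cu _ (Dc z Dz); split.
  by have cs := continuous_scale cu; cont.
move=> i; have [_ cp] := dcu i; split; first by have [] := P i z Dz.
apply: (@continuous_near_eq _ _ (fun z => a * c * partial i u (c *: z))); last first.
  by have cs := continuous_scale cp; cont.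
by move/unit_ballE : Dz => z1; apply: filterS (near_sqn_lt z1) => x /unit_ballE /PE.
Qed.

Lemma harmonic_dilation c u : `|c| <= 1 -> harmonic_on D u ->
  harmonic_on D (fun z => u (c *: z)) /\ forall z, D z -> gradient (fun z => u (c *: z)) z = c *: gradient u (c *: z).
Proof.
move=> c1 [[Cu C2u] Lu].
have E : (fun z => u (c *: z)) = (fun z => 1 * u (c *: z)) by apply/funext => z; rewrite mul1r.
rewrite E; have [Cv Pv] := C1_on_dilation 1 c1 Cu.
have C2 i := C1_on_dilation (1 * c) c1 (C2u i).
have Q i := C1_on_eq (Pv i) (C2 i).1.
have Dc z : D z -> D (c *: z).
  move=> /unit_ballE z1; apply/unit_ballE; rewrite dotZl dotZr mulrA -expr2.
  apply: le_lt_trans z1; rewrite ler_piMl ?sqn_ge0//.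
  by rewrite -(real_normK (num_real c)) expr_le1.
split; last first.
  by move=> z Dz; apply/rowP => i; rewrite !mxE Pv// mul1r.
split; first by split; [exact: Cv|move=> i; exact: (Q i).1].
move=> z Dz; transitivity (c * c * laplacian u (c *: z)); last by rewrite Lu ?mulr0//; exact: Dc.
rewrite /laplacian mulr_sumr; apply: eq_bigr => i _.
by rewrite (Q i).2// (C2 i).2// mul1r.
Qed.

End Scaling.

Section GradientBound.
Context {R : realType}.
Local Notation V := ('rV[R]_4).
Local Notation sqn y := (dot y y).
Local Notation D := (@unit_ball R 4).

Lemma gradient_bound_frakC (x : V) : unit_ball x ->
  gradient_bound x (frakC (euclidean_norm x) / (1 - euclidean_norm x ^+ 2)).
Proof.
move=> Dx u [hu [M0 HM0]]; set r := euclidean_norm x.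
have r0 : 0 <= r := euclidean_norm_ge0 x.
have r1 : r < 1 by exact: Dx.
pose M := sup_norm_on D u.
have HM y : unit_ball y -> `|u y| <= M.
  move=> Dy; apply: ub_le_sup; last by exists y.
  by exists M0 => _ [z /HM0 z1 <-].
have M_ge0 : 0 <= M := le_trans (normr_ge0 _) (HM x Dx).
have rI (t : R) : r < t -> 0 <= r / t < 1.
  by move=> rt; have t0 := le_lt_trans r0 rt; rewrite divr_ge0 ?(ltW t0)//= ltr_pdivrMr// mul1r.
(* [gradient_le] is applied to [z -> u (t z)], which is continuous on the closed ball, at the point
   [x / t]; its gradient there is [t] times that of [u] at [x]. *)
have bound (l : V) (t : R) : sqn l = 1 -> r < t < 1 ->
    t * dot l (gradient u x) <= frakC_smooth (r / t) / (1 - (r / t) ^+ 2) * M.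
  move=> l1 /andP[rt t1]; have t0 := le_lt_trans r0 rt.
  have ta : `|t| <= 1 by rewrite gtr0_norm// ltW.
  have [hv gv] := harmonic_dilation ta hu.
  have Dt (z : V) : sqn z <= 1 -> D (t *: z).
    move=> z1; apply/unit_ballE; rewrite dotZl dotZr mulrA -expr2.
    apply: le_lt_trans (_ : t ^+ 2 < 1); last by rewrite expr_lt1// ltW.
    by rewrite ler_piMr// sqr_ge0.
  pose y := t^-1 *: x.
  have tyx : t *: y = x by rewrite scalerA divff ?scale1r// gt_eqF.
  have ny : euclidean_norm y = r / t.
    rewrite euclidean_normE dotZl dotZr mulrA -expr2 sqrtrM ?sqr_ge0// sqrtr_sqr gtr0_norm ?invr_gt0//.
    by rewrite -euclidean_normE mulrC.
  have Dy : unit_ball y by rewrite /unit_ball/= ny; have /andP[] := rI t rt.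
  have := @gradient_le R (fun z => u (t *: z)) M l y hv _ _ ((unit_ballE y).1 Dy) l1.
  rewrite gv// tyx dotZr ny frakCE; last 2 first.
  - by have /andP[] := rI t rt.
  - by have /andP[a b] := rI t rt; apply: (@lt_trans _ _ 1); rewrite ?expr_lt1// ltr1n.
  apply.
  - move=> z /Dt Dz; apply: continuous_scale; by have [] := hu.1.1 _ Dz.
  - by move=> z /Dt /HM.
have r2 : r ^+ 2 < 2 by apply: (@lt_trans _ _ 1); rewrite ?expr_lt1// ltr1n.
have lim (l : V) : sqn l = 1 ->
    dot l (gradient u x) <= frakC r / (1 - r ^+ 2) * M.
  (* A strict violation in the limit [t = 1] would persist for [t] near 1. The constant appears
     through [frakC_smooth], whose continuity is known. *)
  move=> l1; rewrite frakCE// leNgt; apply/negP => h.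
  pose phi (t : R) := t * dot l (gradient u x) - frakC_smooth (r / t) / (1 - (r / t) ^+ 2) * M.
  have cphi : {for 1, continuous phi}.
    have c0 : {for 1, continuous (fun t : R => t)} by exact: cvg_id.
    have c1 : {for 1, continuous (fun t : R => r / t)} by cont; rewrite oner_neq0.
    have c2 : {for 1, continuous (fun t : R => frakC_smooth (r / t))}.
      apply: (cvg_comp _ _ c1); apply: continuous_frakC.
      by rewrite divr1 ger0_norm// (lt_trans r1)// ltr1n.
    by rewrite /phi; cont; rewrite ?oner_neq0// divr1 gt_eqF// subr_gt0 expr_lt1.
  have phi1 : 0 < phi 1 by rewrite /phi divr1 mul1r subr_gt0.
  have /nbhs_ballP[e /= e0 He] : \forall t \near (1 : R), 0 < phi t.
    by have /cvgr_gt := cphi; apply.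
  (* The first entry places [t] above [r], the second within [e] of 1; both are below 1. *)
  pose t := Num.max ((1 + r) / 2) (1 - e / 2).
  have rt : r < t by rewrite lt_max; apply/orP; left; lra.
  have t1 : t < 1 by rewrite gt_max; apply/andP; split; lra.
  have te : ball (1 : R) e t.
    have : 1 - e / 2 <= t by rewrite le_max lexx orbT.
    by rewrite /ball/= => h1; rewrite ger0_norm; lra.
  have := He t te; rewrite /phi subr_gt0 ltNge => /negP; apply.
  by apply: bound => //; rewrite rt.
set g := gradient u x.
have [g0|g0] := eqVneq g 0.
  rewrite g0 {1}euclidean_normE dot0l sqrtr0 mulr_ge0// divr_ge0//.
    by rewrite ltW// frakC_gt0// r0 ltW.
  by rewrite subr_ge0 expr_le1// ltW.
have gn : 0 < euclidean_norm g by rewrite euclidean_normE sqrtr_gt0 lt_def sqn_ge0 sqn_eq0 g0.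
have lg : dot ((euclidean_norm g)^-1 *: g) g = euclidean_norm g.
  by rewrite dotZl -euclidean_norm_sqr expr2 mulKf// gt_eqF.
rewrite -[leLHS]lg; apply: lim.
by rewrite dotZr lg mulVf// gt_eqF.
Qed.

End GradientBound.

Theorem corollary1p4 (R : realType) :
  let a : R := 3 * Num.sqrt 3 / pi in
  let b : R := 16 / (3 * pi) in
  [/\ {in `[0, 1] &, {homo @frakC R : r s /~ r < s}},
      homeomorphism_on `[0, 1] `[a, b] (@frakC R),
      smooth_on `[0, 1] (@frakC R)
    & diffeomorphism_on `]0, 1] `[a, b[ (@frakC R)]
  /\
  forall x : 'rV[R]_4, unit_ball x ->
    let r := euclidean_norm x in
    let c := frakC r / (1 - r ^+ 2) in
    gradient_bound x c /\ (forall c' : R, gradient_bound x c' -> c <= c').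
Proof.
have F1 : frakC_smooth 1 = 3 * Num.sqrt 3 / pi :> R.
  by rewrite -frakC1E frakCE// expr1n ltr1n.
have F0 : frakC_smooth 0 = 16 / (3 * pi) :> R := frakC_smooth0.
split.
  rewrite -F1 -F0; split.
  - exact: frakC_strictly_decreasing.
  - exact: frakC_homeomorphism.
  - by apply: frakC_smooth_on => x /=; rewrite in_itv.
  - exact: frakC_diffeomorphism.
move=> x Dx /=; split; first exact: gradient_bound_frakC.
by move=> c'; exact: sharp_bound.
Qed.
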